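(* Let $S$ be a semigroup, let $X$ be a separable locally compact metric space, and let $S\curvearrowright X$ be an action by proper maps. Assume that $S\curvearrowright X$ is continuously pointwise ergodic and vanishes at infinity. Let $\Phi_\infty\colon \widehat{X}\to M_1^+(\widehat{X},S)$ be the ergodic map of the compactified system, let $\pi_\infty \colon \widehat{X}\to \widehat{X}/\Phi_\infty$ be the quotient map, and let $\widetilde{\Phi}_\infty\colon \widehat{X}/\Phi_\infty\to \Phi_\infty(\widehat{X})$ be the induced bijection. Then the following assertions hold. (1) $E_1^+(\widehat{X},S)$ is homeomorphic to the quotient space $\widehat{X}/\Phi_\infty$. Moreover, $M_1^+(\widehat{X},S)$ is a Bauer simplex affinely weak* homeomorphic to $M_1^+(\widehat{X}/\Phi_\infty)$. (2) For every $\nu \in M_1^+(\widehat{X})$, $$P_\infty^*\nu = \int_{\widehat{X}}\Phi_\infty\,d\nu = \int_{E_1^+(\widehat{X},S)} \operatorname{id}_{M(\widehat{X})}\,d(\Phi_\infty)_*\nu,$$ where $P_\infty$ is the mean ergodic projection of the compactified system. In particular, if $\mu \in M_1^+(\widehat{X},S)$, then $(\Phi_\infty)_*\mu$ is its ergodic decomposition, and $$r_\infty^{-1}=(\Phi_\infty)_*\big|_{M_1^+(\widehat{X},S)},\qquad r_\infty\circ(\Phi_\infty)_* = P_\infty^*\big|_{M_1^+(\widehat{X})},$$ where $r_\infty\colon M_1^+(E_1^+(\widehat{X},S))\to M_1^+(\widehat{X},S)$ denotes the resultant map. (3) The pullback $\pi_\infty^*\colon C(\widehat{X}/\Phi_\infty)\to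 C(\widehat{X})$, $f\mapsto f\circ\pi_\infty$, is an isometric isomorphism onto $\operatorname{Fix}(\kappa_\infty)$. The pushforward $(\pi_\infty)_*\colon M(\widehat X)\to M(\widehat X/\Phi_\infty)$ is a linear weak*-to-weak* continuous surjection and $\ker((\pi_\infty)_* ) = \overline{\operatorname{Cob}}^{*}(\kappa_\infty^* )$. Moreover, $M(\widehat{X},S)$ and $M(\widehat X/\Phi_\infty)$ are linearly weak*-to-weak* homeomorphic.
   Context: For a separable locally compact metric space $Z$: $C_0(Z)$ is the space of continuous $f\colon Z\to\mathbb R$ with $\{|f|\ge\epsilon\}$ compact for every $\epsilon>0$ ($=C(Z)$ if $Z$ compact), with sup norm; $M(Z)\cong C_0(Z)^*$ is the space of finite signed regular Borel measures, with pairing $\langle f,\nu\rangle=\int f\,d\nu$ and weak* topology $\sigma(M(Z),C_0(Z))$; $M_1^+(Z)$, $M_{\le1}^+(Z)$ are the sets of probability and subprobability measures. An action by proper maps is a map $(s,x)\mapsto sx$ with $(st)x=s(tx)$ and each $x\mapsto sx$ continuous and proper. $Sx=\{sx:s\in S\}$. $s_*\nu(A)=\nu(s^{-1}A)$, and $\nu$ is $S$-invariant if $s_*\nu=\nu$ for all $s\in S$. $M(\cdot,S)$, $M_1^+(\cdot,S)$, $M_{\le1}^+(\cdot,S)$ denote the $S$-invariant members (those on a closed invariant set are viewed as measures on the ambient space supported there). $E_1^+(\cdot,S)$ is the set of $S$-ergodic invariant probability measures, i.e. $\mu\in M_1^+(\cdot,S)$ such that every Borel $A$ with $\mu(A\Delta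 s^{-1}A)=0$ for all $s\in S$ has $\mu(A)\in\{0,1\}$; it carries the weak* topology. A point $x$ escapes to infinity if $\operatorname{cl}_X(Sx)$ is not compact. The action on $X$ is pointwise uniquely ergodic if $M_1^+(\operatorname{cl}_X(Sx),S)$ is empty for every $x$ escaping to infinity and a singleton $\{\mu_x\}$ for every other $x$; then $\Phi(x)=0$ if $x$ escapes to infinity and $\Phi(x)=\mu_x$ otherwise. It is continuously pointwise ergodic if it is pointwise uniquely ergodic and $\Phi\colon X\to M_{\le1}^+(X,S)$ is weak* continuous; it then vanishes at infinity if $x\mapsto\int f\,d\Phi(x)$ is in $C_0(X)$ for every $f\in C_0(X)$. $\widehat X=X\sqcup\{\infty\}$ is the one-point compactification ($X$ with an added isolated point $\infty$ if $X$ is compact), a compact metrizable space; the action extends uniquely to an action by continuous maps $S\curvearrowright\widehat X$ fixing $\infty$ (the compactified system). With $j\colon X\hookrightarrow\widehat X$ the inclusion, the ergodic map of the compactified system is $\Phi_\infty(x)=j_*\Phi(x)$ if $x\in X$ and $\operatorname{cl}_X(Sx)$ is compact, and $\Phi_\infty(x)=\delta_\infty$ otherwise; equivalently, $\Phi_\infty(x)$ is the unique $S$-invariant probability measure on $\operatorname{cl}_{\widehat X}(Sx)$. $\widehat X/\Phi_\infty$ is the quotient of $\widehat X$ by $x\sim x'\iff\Phi_\infty(x)=\Phi_\infty(x')$, with the quotient topology; $\widetilde\Phi_\infty([x])=\Phi_\infty(x)$. Pushforward: $F_*\nu(B)=\nu(F^{-1}(B))$. $\kappa_\infty$ is the Koopman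 representation on $C(\widehat X)$, $(\kappa_\infty(s)f)(x)=f(sx)$, and $\kappa_\infty^*(s)\nu=s_*\nu$ on $M(\widehat X)$. $\operatorname{Fix}(\kappa_\infty)$ is the space of $f\in C(\widehat X)$ fixed by all $\kappa_\infty(s)$; $\overline{\operatorname{Cob}}(\kappa_\infty)$ is the norm closure of $\operatorname{span}\{f-\kappa_\infty(s)f\}$; $\overline{\operatorname{Cob}}^{*}(\kappa_\infty^* )$ is the weak* closure of $\operatorname{span}\{\nu-\kappa_\infty^*(s)\nu:\nu\in M(\widehat X),s\in S\}$. The mean ergodic projection $P_\infty$ is the bounded projection on $C(\widehat X)$ with range $\operatorname{Fix}(\kappa_\infty)$ and kernel $\overline{\operatorname{Cob}}(\kappa_\infty)$ (under the hypotheses of the claim, $C(\widehat X)$ is the direct sum of these two subspaces). Integrals of measure-valued maps are Gelfand integrals: $\int\Psi\,d\nu$ is the measure with $\langle f,\int\Psi\,d\nu\rangle=\int\langle f,\Psi(\cdot)\rangle\,d\nu$ for all $f\in C(\widehat X)$. For a compact metrizable $Z$ on which $S$ acts by continuous maps with $M_1^+(Z,S)\neq\emptyset$, $M_1^+(Z,S)$ is a Choquet simplex with extreme points $E_1^+(Z,S)$; it is called a Bauer simplex if $E_1^+(Z,S)$ is closed in it. In that case the resultant map $r\colon M_1^+(E_1^+(Z,S))\to M_1^+(Z,S)$, $r(\lambda)=\int_{E_1^+(Z,S)}\operatorname{id}_{M(Z)}\,d\lambda$, is an affine homeomorphism, and $r^{-1}(\mu)$ is called the ergodic decomposition of $\mu$.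 *)

(* Defs.v *)
From HB Require Import structures.
From mathcomp Require Export all_boot all_order all_algebra.
From mathcomp Require Export all_classical all_reals all_analysis.
Export Order.TTheory GRing.Theory Num.Theory.
Export numFieldNormedType.Exports.

Set Implicit Arguments.
Unset Strict Implicit.
Unset Printing Implicit Defensive.

Global Open Scope classical_set_scope.
Global Open Scope ring_scope.
Global Open Scope quotient_scope.

(* measurable types are pointed, hence so are the spaces carrying measures *)
#[short(type="pmetricType")]
HB.structure Definition PointedMetric (K : numDomainType) :=
  {M of Metric K M & isPointed M}.

Definition separable (Z : topologicalType) : Prop :=
  exists D : set Z, countable D /\ dense D.

Definition proper_map (Y Z : topologicalType) (f : Y -> Z) : Prop :=
  forall K : set Z, compact K -> compact (f @^-1` K).

Definition homeomorphism (Y Z : topologicalType) (h : Y -> Z) : Prop :=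
  continuous h /\
  exists g : Z -> Y, [/\ continuous g, cancel h g & cancel g h].

Definition lin_span (R : realType) (V : lmodType R) (G : set V) : set V :=
  [set v | exists n (c : 'I_n -> R) (w : 'I_n -> V),
     (forall i, G (w i)) /\ v = \sum_(i < n) c i *: w i].

Section C0_space.
Context (R : realType) (Z : topologicalType).

Definition vanishing : {pred (Z -> R^o)} := fun f =>
  `[< continuous (f : Z -> R) /\
      forall e : R, 0 < e -> compact [set x | e <= `|f x|] >].

Record C0 := MkC0 { C0_fun :> Z -> R^o ; C0_funP : C0_fun \in vanishing }.

HB.instance Definition _ := [isSub for C0_fun].
HB.instance Definition _ := [Choice of C0 by <:].

Lemma vanishing_submod_closed : submod_closed vanishing.
Proof.
split.
  apply/asboolP; split; first exact: cst_continuous.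
  move=> e e0; rewrite (_ : [set _ | _] = set0); first exact: compact0.
  by apply/seteqP; split => // x /=; rewrite normr0 leNgt e0.
move=> a f g /asboolP[cf vf] /asboolP[cg vg]; apply/asboolP.
have cfg : continuous (a *: f + g : Z -> R).
  move=> x; apply: (@cvgD _ R^o); last exact: cg.
  by apply: (@cvgZr _ R^o); exact: cf.
split=> // e e0; pose b := `|a| + 1.
have b0 : 0 < b by rewrite ltr_wpDl.
have cK : compact ([set x | e / 2 / b <= `|f x|] `|` [set x | e / 2 <= `|g x|]).
  by apply: compactU; [apply: vf|apply: vg]; rewrite !divr_gt0.
apply: (subclosed_compact _ cK).
  apply: (@closed_comp _ _ (fun x => `|(a *: f + g) x|) [set y : R | e <= y]).
    by move=> x _; apply: continuous_comp; [exact: cfg|exact: norm_continuous].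
  exact: closed_ge.
move=> x /= efg; case: (leP (e / 2 / b) `|f x|) => [|fx]; first by left.
right => /=; rewrite leNgt; apply/negP => gx.
move: efg; rewrite leNgt => /negP; apply.
apply: (le_lt_trans (ler_normD _ _)); rewrite normrM [ltRHS](splitr e).
apply: ler_ltD gx; apply: (@le_trans _ _ (b * `|f x|)).
  by rewrite ler_wpM2r// /b lerDl.
by rewrite mulrC -ler_pdivlMr// ltW.
Qed.

HB.instance Definition _ := GRing.isSubmodClosed.Build R (Z -> R^o) vanishing
  vanishing_submod_closed.
HB.instance Definition _ := [SubChoice_isSubLmodule of C0 by <:].

Definition C0_norm (f : C0) : R := sup [set `|f x| | x in [set: Z]].

Lemma C0_continuous (f : C0) : continuous (f : Z -> R).
Proof. by case: f => f /= /asboolP[]. Qed.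

Lemma C0_has_ubound (f : C0) : has_ubound [set `|f x| | x in [set: Z]].
Proof.
have [_ /(_ 1 ltr01) cK] := asboolW (C0_funP f).
have /compact_bounded [M [_ Mb]] :
    compact ((f : Z -> R) @` [set x | 1 <= `|f x|]).
  by apply: continuous_compact => //; apply: continuous_subspaceT;
     exact: C0_continuous.
exists (Num.max 1 (M + 1)) => _ [x _ <-]; rewrite le_max.
case: (leP `|f x| 1) => //= /ltW fx.
by apply: (Mb (M + 1)); [rewrite ltrDl|exists x].
Qed.

Lemma C0_norm_ub (f : C0) x : `|f x| <= C0_norm f.
Proof. by apply: ub_le_sup; [exact: C0_has_ubound|exists x]. Qed.

Lemma C0_norm_le (f : C0) (c : R) :
  0 <= c -> (forall x, `|f x| <= c) -> C0_norm f <= c.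
Proof.
move=> c0 fc; have [Z0|/set0P[y _]] := eqVneq [set: Z] set0.
  by rewrite /C0_norm Z0 image_set0 sup0.
by apply: ge_sup; [exists `|f y|, y|move=> _ [x _ <-]].
Qed.

Lemma C0_norm_ge0 (f : C0) : 0 <= C0_norm f.
Proof.
have [Z0|/set0P[y _]] := eqVneq [set: Z] set0.
  by rewrite /C0_norm Z0 image_set0 sup0.
exact: le_trans (C0_norm_ub f y).
Qed.

Lemma C0_normD (f g : C0) : C0_norm (f + g) <= C0_norm f + C0_norm g.
Proof.
apply: C0_norm_le; first by rewrite addr_ge0 ?C0_norm_ge0.
move=> x; apply: le_trans (ler_normD (f x) (g x)) _.
by rewrite lerD ?C0_norm_ub.
Qed.

Lemma C0_normZ (a : R) (f : C0) : C0_norm (a *: f) = `|a| * C0_norm f.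
Proof.
have le_Z (b : R) (h : C0) : C0_norm (b *: h) <= `|b| * C0_norm h.
  apply: C0_norm_le; first by rewrite mulr_ge0 ?C0_norm_ge0.
  by move=> x; rewrite [X in X <= _](normrM b (h x)) ler_wpM2l ?C0_norm_ub.
have [->|a0] := eqVneq a 0.
  by apply/eqP; rewrite eq_le le_Z normr0 mul0r C0_norm_ge0.
apply/eqP; rewrite eq_le le_Z/= -ler_pdivlMl ?normr_gt0//.
by have := le_Z a^-1 (a *: f); rewrite scalerA mulVf// scale1r normfV.
Qed.

Lemma C0_norm_eq0 (f : C0) : C0_norm f = 0 -> f = 0.
Proof.
move=> f0; apply/val_inj/funext => x /=; apply/eqP.
by rewrite -normr_le0 -f0 C0_norm_ub.
Qed.

HB.instance Definition _ := Lmodule_isNormed.Build R C0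
  C0_normD C0_normZ C0_norm_eq0.

End C0_space.

Section signed_measures.
Context (R : realType) (Z : ptopologicalType).

Definition borel : measurableType _ := g_sigma_algebraType (@open Z).

Definition is_borel (A : set Z) : Prop := measurable (A : set borel).

(* The condition on [B] says that the total variation of [nu] on [U `\` K] is
   small: the variation of a set lies between the supremum of [`|nu B|] over
   its Borel subsets [B] and twice that supremum. *)
Definition regular (nu : set Z -> R) : Prop :=
  forall A, is_borel A -> forall e : R, 0 < e ->
  exists K U : set Z, [/\ compact K, open U, K `<=` A, A `<=` U &
    forall B, is_borel B -> B `<=` U `\` K -> `|nu B| <= e].

(* Set functions are defined on all subsets, so a measure is normalised to
   vanish off the Borel sets: Leibniz equality is then equality of measures. *)
Definition signed_regular : {pred (set Z -> R^o)} := fun nu =>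
  `[< [/\ nu set0 = 0,
          semi_sigma_additive (fun A : set borel => (nu A)%:E),
          regular nu &
          forall A, ~ is_borel A -> nu A = 0] >].

Record smeasure := MkSmeasure {
  smeasure_fun :> set Z -> R^o ;
  smeasure_funP : smeasure_fun \in signed_regular }.

HB.instance Definition _ := [isSub for smeasure_fun].
HB.instance Definition _ := [Choice of smeasure by <:].

Lemma signed_regular_submod_closed : submod_closed signed_regular.
Proof.
split.
  apply/asboolP; split => //.
    move=> F _ _ _; under eq_fun do rewrite big1//; exact: cvg_cst.
  move=> A mA e e0; exists set0, setT; split => //; first exact: compact0.
    exact: openT.
  by move=> B _ _; rewrite normr0 ltW.
move=> a m n /asboolP[m0 madd mreg mN] /asboolP[n0 nadd nreg nN].
apply/asboolP; split.
- by rewrite [LHS](_ : _ = a * m set0 + n set0)// m0 n0 mulr0 addr0.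
- move=> F mF tF mUF.
  have cm := madd F mF tF mUF; have cn := nadd F mF tF mUF.
  rewrite [X in X @ _ --> _](_ : _ =
      (fun k => a%:E * \sum_(0 <= i < k) (m (F i))%:E +
                \sum_(0 <= i < k) (n (F i))%:E)%E); last first.
    by apply/funext => k; rewrite !sumEFin -EFinM -EFinD big_split/= -mulr_sumr.
  rewrite [X in _ --> X](_ : _ = (a%:E * (m (\bigcup_k F k))%:E +
      (n (\bigcup_k F k))%:E)%E); last by rewrite -EFinM -EFinD.
  by apply: cvgeD => //; apply: cvgeZl.
- move=> A mA e e0; pose b := `|a| + 1.
  have b0 : 0 < b by rewrite ltr_wpDl.
  have [|K1 [U1 [cK1 oU1 K1A AU1 h1]]] := mreg A mA (e / 2 / b).
    by rewrite !divr_gt0.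
  have [|K2 [U2 [cK2 oU2 K2A AU2 h2]]] := nreg A mA (e / 2).
    by rewrite !divr_gt0.
  exists (K1 `|` K2), (U1 `&` U2); split.
  + exact: compactU.
  + exact: openI.
  + by move=> x [/K1A|/K2A].
  + by move=> x Ax; split; [exact: AU1|exact: AU2].
  + move=> B mB BUK; apply: le_trans (ler_normD (a * m B) (n B)) _.
    rewrite (splitr e); apply: lerD; last first.
      by apply: h2 => // x /BUK[[_ ?] /not_orP[]].
    have {}h1 : `|m B| <= e / 2 / b.
      by apply: h1 => // x /BUK[[? _] /not_orP[]].
    rewrite normrM; apply: (@le_trans _ _ (b * `|m B|)).
      by rewrite ler_wpM2r// /b lerDl.
    by rewrite mulrC -ler_pdivlMr.
- move=> A nA.
  by rewrite [LHS](_ : _ = a * m A + n A)// mN// nN// mulr0 addr0.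
Qed.

HB.instance Definition _ := GRing.isSubmodClosed.Build R (set Z -> R^o)
  signed_regular signed_regular_submod_closed.
HB.instance Definition _ := [SubChoice_isSubLmodule of smeasure by <:].

Definition charge_of (nu : smeasure) : set borel -> \bar R :=
  fun A => (nu A)%:E.

Section charge_of_charge.
Variable nu : smeasure.

Let charge_of0 : charge_of nu set0 = 0%E.
Proof. by rewrite /charge_of; have [-> _ _ _] := asboolW (smeasure_funP nu). Qed.

Let charge_of_fin A : measurable A -> charge_of nu A \is a fin_num.
Proof. by []. Qed.

Let charge_of_add : semi_sigma_additive (charge_of nu).
Proof. by have [_ ? _ _] := asboolW (smeasure_funP nu). Qed.

HB.instance Definition _ := isCharge.Build _ _ _ (charge_of nu)
  charge_of0 charge_of_fin charge_of_add.
End charge_of_charge.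

Lemma hahn_ex (nu : smeasure) :
  exists PN : set borel * set borel,
    hahn_decomposition (charge_of nu) PN.1 PN.2.
Proof.
by have [P [N PN]] := Hahn_decomposition (charge_of nu); exists (P, N).
Qed.

(* [<f, nu>]; the integral does not depend on the Hahn decomposition chosen *)
Definition pairing (f : Z -> R) (nu : smeasure) : R :=
  let H := projT2 (cid (hahn_ex nu)) in
  Rintegral (jordan_pos H) [set: borel] f -
  Rintegral (jordan_neg H) [set: borel] f.

Definition weakstar : Type := initial_topology
  (fun nu : smeasure =>
     (fun f : C0 R Z => pairing f nu) : prod_topology (fun _ : C0 R Z => R)).

HB.instance Definition _ := Topological.copy smeasure weakstar.

(* the member of [M(Z)] that agrees with [m] on Borel sets; 0 if there is none *)
Definition smeasure_of (m : set Z -> \bar R) : smeasure :=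
  insubd 0 (fun A => if `[< is_borel A >] then fine (m A) else 0).

Definition smeasure_dirac (x : Z) : smeasure := smeasure_of (\d_(x : borel)).

Definition M1 : set smeasure :=
  [set nu | (forall A, 0 <= nu A) /\ nu setT = 1].

End signed_measures.
Arguments is_borel {Z} A.
Arguments smeasure_dirac {R Z} x.
Arguments M1 {R Z}.

Definition pushforwardM (R : realType) (Y Z : ptopologicalType) (F : Y -> Z)
    (nu : smeasure R Y) : smeasure R Z :=
  smeasure_of (pushforward (charge_of nu) (F : borel Y -> borel Z)).

Definition is_gelfand_integral (R : realType) (Y Z : ptopologicalType)
    (Psi : Y -> smeasure R Z) (nu : smeasure R Y) (m : smeasure R Z) : Prop :=
  forall f : C0 R Z, pairing f m = pairing (fun y => pairing f (Psi y)) nu.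

Section simplices.
Context (R : realType) (Z : ptopologicalType).
Implicit Types K E : set (smeasure R Z).

Definition extreme_points K : set (smeasure R Z) :=
  [set m | K m /\ forall m1 m2 (t : R), K m1 -> K m2 -> 0 < t -> t < 1 ->
     m = t *: m1 + (1 - t) *: m2 -> m1 = m /\ m2 = m].

Definition cone K : set (smeasure R Z) :=
  [set m | exists t k, [/\ (0 : R) <= t, K k & m = t *: k]].

(* For [K] in an affine hyperplane missing 0, this is Choquet's definition: the
   cone over [K] is a lattice in its own order. *)
Definition choquet_simplex K : Prop :=
  [/\ K !=set0, compact K, convex_set (K : set (convex_lmodType _)) &
    forall m1 m2, cone K m1 -> cone K m2 ->
      exists m, [/\ cone K m, cone K (m - m1), cone K (m - m2) &
        forall m', cone K m' -> cone K (m' - m1) -> cone K (m' - m2) ->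
          cone K (m' - m)]].

Definition closed_in E K : Prop := exists2 F, closed F & E = K `&` F.

End simplices.

Section dynamics.
Context (R : realType) (S : Type) (Z : ptopologicalType) (a : S -> Z -> Z).

Definition orbit (x : Z) : set Z := [set a s x | s in [set: S]].

Definition Minv : set (smeasure R Z) :=
  [set nu | forall s, pushforwardM (a s) nu = nu].

Definition M1inv : set (smeasure R Z) := M1 `&` Minv.

Definition M1inv_on (K : set Z) : set (smeasure R Z) :=
  [set mu | M1inv mu /\ mu (~` K) = 0].

Definition E1 : set (smeasure R Z) :=
  [set mu | M1inv mu /\ forall A, is_borel A ->
     (forall s, mu (A `+` a s @^-1` A) = 0) -> mu A = 0 \/ mu A = 1].

(* the invariant probability measures form a Choquet simplex whose extreme
   points are the ergodic measures, and these are closed in it *)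
Definition bauer_simplex : Prop :=
  [/\ choquet_simplex M1inv, extreme_points M1inv = E1 & closed_in E1 M1inv].

Definition koopman (s : S) (f : Z -> R) : Z -> R := f \o a s.

Definition Fix : set (C0 R Z) :=
  [set f | forall s, koopman s f = f :> (Z -> R)].

Definition Cob_gen : set (C0 R Z) :=
  [set h | exists (f : C0 R Z) s, h = f \- koopman s f :> (Z -> R)].

Definition Cob_closure : set (C0 R Z) := closure (lin_span Cob_gen).

Definition Cob_star_gen : set (smeasure R Z) :=
  [set h | exists nu s, h = nu - pushforwardM (a s) nu].

(* [closure] is taken in the weak* topology, the topology of [smeasure R Z] *)
Definition Cob_star_closure : set (smeasure R Z) :=
  closure (lin_span Cob_star_gen).

Definition mean_ergodic_projection (P : {linear C0 R Z -> C0 R Z}) : Prop :=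
  [/\ exists c : R, forall f, `|P f| <= c * `|f|,
      P \o P =1 P,
      range P = Fix &
      [set f | P f = 0] = Cob_closure].

End dynamics.
Arguments orbit {S Z} a x.
Arguments Minv R {S Z} a.
Arguments M1inv R {S Z} a.
Arguments M1inv_on R {S Z} a K.
Arguments E1 R {S Z} a.
Arguments bauer_simplex R {S Z} a.
Arguments Fix R {S Z} a.
Arguments Cob_star_closure R {S Z} a.

Record proper_action (S : semigroupType) (X : topologicalType) := ProperAction {
  act :> S -> X -> X ;
  act_mul : forall s t x, act (s * t)%g x = act s (act t x) ;
  act_continuous : forall s, continuous (act s) ;
  act_proper : forall s, proper_map (act s) }.

Definition infty {X : Type} : one_point_compactification X := None.

Section compactified_system.
Context (R : realType) (S : semigroupType) (X : pmetricType R).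
Variable a : proper_action S X.

Local Notation M Z := (smeasure R Z).
Local Notation Xhat := (one_point_compactification X).

Definition escapes (x : X) : Prop := ~ compact (closure (orbit a x)).

Definition pointwise_uniquely_ergodic : Prop := forall x,
  (escapes x -> M1inv_on R a (closure (orbit a x)) = set0) /\
  (~ escapes x -> exists mu, M1inv_on R a (closure (orbit a x)) = [set mu]).

Definition Phi (x : X) : M X :=
  if `[< escapes x >] then 0 else xget 0 (M1inv_on R a (closure (orbit a x))).

Definition continuously_pointwise_ergodic : Prop :=
  pointwise_uniquely_ergodic /\ continuous Phi.

Definition vanishes_at_infinity : Prop :=
  forall f : C0 R X, (fun x => pairing f (Phi x)) \in @vanishing R X.

Definition act_hat (s : S) : Xhat -> Xhat := omap (a s).

Definition Phi_infty (x : Xhat) : M Xhat :=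
  if x is Some y then
    if `[< escapes y >] then smeasure_dirac infty
    else pushforwardM (Some : X -> Xhat) (Phi y)
  else smeasure_dirac infty.

Definition Phi_rel : rel Xhat := fun x y => `[< Phi_infty x = Phi_infty y >].

Lemma Phi_rel_refl : reflexive Phi_rel.
Proof. by move=> x; apply/asboolP. Qed.

Lemma Phi_rel_sym : symmetric Phi_rel.
Proof. by move=> x y; apply/asboolP/asboolP. Qed.

Lemma Phi_rel_trans : transitive Phi_rel.
Proof. by move=> y x z /asboolP xy /asboolP yz; apply/asboolP; rewrite xy. Qed.

Canonical Phi_equiv := EquivRel Phi_rel Phi_rel_refl Phi_rel_sym Phi_rel_trans.

Definition Xquot := quotient_topology {eq_quot Phi_equiv}.
HB.instance Definition _ := PointedTopological.on Xquot.
HB.instance Definition _ := Quotient.on Xquot.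

Definition pi_infty (x : Xhat) : Xquot := \pi_Xquot x.

Definition Phi_tilde (q : Xquot) : M Xhat := Phi_infty (repr q).

Lemma act_hat_continuous s : continuous (act_hat s).
Proof.
move=> [x|] U /=.
  exact: (@act_continuous _ _ a s x).
move=> [C [cC clC] CU]; exists (a s @^-1` C).
  split; first exact: act_proper.
  by apply: closed_comp => // y _; exact: act_continuous.
move=> y /= [[z /= nCz <-]|->]; last by apply: CU; right.
by apply: CU; left; exists (a s z).
Qed.

Lemma is_borel_act_hat s (A : set Xhat) :
  is_borel A -> is_borel (act_hat s @^-1` A).
Proof.
have /measurability borelP : @measurable _ (borel Xhat) = <<s open >> by [].
move=> mA; rewrite -[X in is_borel X]setTI.
apply: (borelP _ _ [set: borel Xhat] (act_hat s)) => //.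
move=> _ [B oB <-]; rewrite setTI; apply: sub_sigma_algebra.
by move/continuousP: (@act_hat_continuous s); exact.
Qed.

Lemma dirac_inftyE (A : set Xhat) : is_borel A ->
  smeasure_dirac infty A = \1_A infty :> R.
Proof.
move=> mA; rewrite /smeasure_dirac /smeasure_of [LHS](congr1 (@^~ A) (insubdK _ _)).
  by rewrite (asboolT mA) diracE indicE.
apply/asboolP; split.
- by case: ifPn => // _; rewrite dirac0.
- move=> F mF tF mUF.
  rewrite [X in X @ _ --> _](_ : _ =
      (fun n => \sum_(0 <= i < n) \d_(infty : borel Xhat) (F i))%E); last first.
    apply/funext => n; apply: eq_bigr => i _.
    by rewrite (asboolT (mF i : is_borel _)) fineK// diracE.
  rewrite (asboolT (mUF : is_borel _)) fineK; last by rewrite diracE.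
  exact: measure_semi_sigma_additive.
- move=> B mB e e0; have [Binf|Binf] := pselect (B infty).
    exists [set infty], setT; split => //; first exact: compact_set1.
    + exact: openT.
    + by move=> _ ->.
    + move=> D mD DT; rewrite (asboolT mD) diracE memNset ?normr0 ?ltW//.
      by move=> /DT[_ /(_ erefl)].
  exists set0, (Some @` [set: X]); split => //; first exact: compact0.
  + exact/one_point_compactification_open_some/openT.
  + by move=> [y _|/Binf//]; exists y.
  + move=> D mD DT; rewrite (asboolT mD) diracE memNset ?normr0 ?ltW//.
    by move=> /DT[[]].
- by move=> B nB; rewrite (asboolF nB).
Qed.

Lemma smeasureP (m n : M Xhat) :
  (forall A, is_borel A -> m A = n A) -> m = n.
Proof.
move=> mn; apply/val_inj/funext => A /=; have [mA|nA] := pselect (is_borel A).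
  exact: mn.
have [_ _ _ ->//] := asboolW (smeasure_funP m).
by have [_ _ _ ->] := asboolW (smeasure_funP n).
Qed.

Lemma E1_dirac_infty : E1 R act_hat (smeasure_dirac infty).
Proof.
have mT : is_borel [set: Xhat] by exact: measurableT.
split; last first.
  move=> A mA _; rewrite dirac_inftyE// indicE.
  by case: (_ \in _); [right|left].
split; first split.
- move=> A; have [mA|nA] := pselect (is_borel A).
    by rewrite dirac_inftyE// indicE ler0n.
  by have [_ _ _ ->] := asboolW (smeasure_funP (smeasure_dirac infty : M Xhat)).
- by rewrite dirac_inftyE// indicE in_setT.
- move=> s; rewrite /pushforwardM (_ : smeasure_of _ = smeasure_dirac infty)//.
  rewrite {2}/smeasure_dirac /smeasure_of; congr insubd; apply/funext => A.
  case: ifPn => // /asboolP mA.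
  rewrite /pushforward /charge_of /= dirac_inftyE; last exact: is_borel_act_hat.
  by [].
Qed.

Definition Ehat := set_type (E1 R act_hat).
HB.instance Definition _ := Topological.on Ehat.
(* pointed by the Dirac mass at infinity so that it carries a Borel structure *)
HB.instance Definition _ := isPointed.Build Ehat
  (SigSub (mem_set E1_dirac_infty)).

Definition Ehat_val : Ehat -> M Xhat := set_val.

End compactified_system.

(* Main.v *)
From HB Require Import structures.
From mathcomp Require Import measurable_realfun ring lra.
Require Import Defs.

Set Implicit Arguments.
Unset Strict Implicit.
Unset Printing Implicit Defensive.

(** For a point [x] of the compactification let [Phi_oo x] be the invariant
    probability measure on the closure of its orbit; it is unique there, also at
    points that escape to infinity, where it is the Dirac mass at infinity
    ([M1inv_on_hat]). Put [P f x := pairing f (Phi_oo x)]. Continuity of the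
    ergodic map on [X] and vanishing at infinity make [Phi_oo] weak* continuous
    ([Phi_infty_continuous]), so [P f] is a continuous function. It is invariant,
    and [P] fixes the invariant functions, since these are constant on closures of
    orbits. Everything else follows from one identity, [pairing_P_Minv]: for an
    invariant measure [nu], [P f] and [f] have the same integral.

    The semigroup is arbitrary, so no averages are available to prove this
    identity; density of orbits takes their place. The set of points whose orbit
    meets an open set is invariant up to null sets. If an invariant probability
    measure gives measure 0 or 1 to these sets for the members of a countable
    basis, then almost every orbit meets all basic sets of positive measure, its
    closure carries the measure, and by uniqueness the measure is some [Phi_oo x]
    ([dense_orbit]). In particular ergodic measures are values of [Phi_oo]. These
    values are extreme points, again by uniqueness on orbit closures, and extreme
    points are ergodic, by conditioning on an invariant set. For a general
    invariant probability measure, minimise the integral of [P f - f] over the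
    compact set of all of them, and among the minimisers successively the measures
    of the sets above. The result cannot be split along such a set, so it is some
    [Phi_oo x], for which the integral is 0; hence the integral is nonnegative for
    every invariant probability measure ([pairing_P_le]), and replacing [f] by
    [- f] gives equality.

    Compactness of the set of probability measures, and the construction of
    measures by duality, come from the Riesz theorem ([riesz_representation]),
    proved with an outer measure of Daniell type. With the Hahn-Banach theorem the
    identity above shows that the kernel of [P] is the closure of the coboundaries
    ([annihilator_closure], [mean_ergodic]); the weak* closure of the coboundaries
    of measures is found by solving finitely many linear equations at a time
    ([match_pairings], [push_pi_kernel]).

    Finally [Phi_oo] factors through the quotient, which therefore embeds into the
    space of measures and is compact Hausdorff, and is homeomorphic to the space
    of ergodic measures. On invariant measures, integrating the factored map is
    inverse to pushing forward ([gelfand_pushforward], [pushforward_gelfand]):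
    pushing forward loses nothing by the identity above, and a function lifted from
    the quotient is invariant, hence integrated by [Phi_oo x] to its value at [x].
    Applied to the quotient this gives the affine and linear homeomorphisms, and
    applied to the ergodic measures it gives the ergodic decomposition. *)

(** * Integration against a signed measure *)

Lemma fin_num_swap (R : realType) (a b c d : \bar R) :
  a \is a fin_num -> b \is a fin_num -> c \is a fin_num -> d \is a fin_num ->
  (a - b = c - d -> a + d = c + b)%E.
Proof.
move=> /fineK <- /fineK <- /fineK <- /fineK <-.
by rewrite -!EFinB -!EFinD => -[e]; congr _%:E; lra.
Qed.

Lemma fin_num_addBB (R : realType) (a b c d : \bar R) :
  a \is a fin_num -> b \is a fin_num -> c \is a fin_num -> d \is a fin_num ->
  ((a - b) + (c - d) = (a + c) - (b + d))%E.
Proof.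
move=> /fineK <- /fineK <- /fineK <- /fineK <-.
by rewrite -!EFinB -!EFinD; congr _%:E; lra.
Qed.

Section bounded_measurable.
Context (R : realType) (Z : ptopologicalType).
Implicit Types (f g : Z -> R).

Definition bounded_borel f : Prop :=
  measurable_fun [set: borel Z] (f : borel Z -> R) /\
  exists M, forall x, `|f x| <= M.

Lemma open_is_borel (U : set Z) : open U -> is_borel U.
Proof. by move=> oU; apply: sub_sigma_algebra. Qed.

Lemma closed_is_borel (C : set Z) : closed C -> is_borel C.
Proof.
move=> cC; rewrite -(setCK C); apply: (@measurableC _ (borel Z)).
by apply: open_is_borel; exact: closed_openC.
Qed.

Lemma borel_setC_closure (C : set Z) : is_borel (~` closure C).
Proof. by apply: open_is_borel; apply: closed_openC; exact: closed_closure. Qed.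

Lemma continuous_measurable f : continuous f ->
  measurable_fun [set: borel Z] (f : borel Z -> R).
Proof.
move=> /continuousP cf; move=> mD; apply: (measurability _ (RGenOpens.measurableE R)) => //.
move=> _ [_ [a [b ->]] <-]; rewrite setTI.
by apply: open_is_borel; apply: cf; exact: interval_open.
Qed.

Lemma bounded_borel_integrable (m : {measure set (borel Z) -> \bar R}) f :
  (m [set: borel Z] < +oo)%E -> bounded_borel f ->
  m.-integrable [set: borel Z] (EFin \o f).
Proof.
move=> moo [mf [M fM]]; apply: measurable_bounded_integrable => //.
exists M; split; first exact: num_real.
by move=> N MN x _ /=; apply: le_trans (fM x) (ltW MN).
Qed.

Lemma bounded_borelZD (k : R) f g : bounded_borel f -> bounded_borel g ->
  bounded_borel (fun x => k * f x + g x).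
Proof.
move=> [mf [M fM]] [mg [N gN]]; split.
  by apply: measurable_funD => //; exact: measurable_funM.
exists (`|k| * M + N) => x; apply: le_trans (ler_normD _ _) _.
by rewrite lerD// normrM ler_wpM2l.
Qed.

Lemma bounded_borel_cst (k : R) : bounded_borel (fun=> k).
Proof. by split; [exact: measurable_cst|exists `|k|]. Qed.

Lemma bounded_borel_indic (A : set Z) : is_borel A -> bounded_borel (\1_A).
Proof.
move=> mA; split; first exact: measurable_indic.
by exists 1 => x; rewrite indicE; case: (_ \in _); rewrite ?normr1 ?normr0.
Qed.

Lemma bounded_borel_C0 (f : C0 R Z) : bounded_borel f.
Proof.
split; first by apply: continuous_measurable; exact: C0_continuous.
by exists (C0_norm f) => x; exact: C0_norm_ub.
Qed.

End bounded_measurable.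

Section pairing_theory.
Context (R : realType) (Z : ptopologicalType).
Implicit Types (f g : Z -> R) (nu : smeasure R Z).

Definition pos_part nu : {finite_measure set (borel Z) -> \bar R} :=
  jordan_pos (projT2 (cid (hahn_ex nu))).
Definition neg_part nu : {finite_measure set (borel Z) -> \bar R} :=
  jordan_neg (projT2 (cid (hahn_ex nu))).

Lemma jordanE nu (A : set (borel Z)) : measurable A ->
  (nu A)%:E = (pos_part nu A - neg_part nu A)%E.
Proof.
move=> mA; have := jordan_decomp (projT2 (cid (hahn_ex nu))) mA.
by rewrite /cadd /= cscaleN1 => <-.
Qed.

Lemma finite_fin_num (m : {measure set (borel Z) -> \bar R}) A :
  (m [set: borel Z] < +oo)%E -> measurable A -> m A \is a fin_num.
Proof.
move=> moo mA; rewrite ge0_fin_numE//; apply: le_lt_trans moo.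
by apply: le_measure => //; rewrite inE.
Qed.

Lemma fine_Rintegral (m : {measure set (borel Z) -> \bar R}) f :
  (m [set: borel Z] < +oo)%E -> bounded_borel f ->
  (\int[m]_x (f x)%:E)%E = (Rintegral m [set: borel Z] f)%:E.
Proof.
move=> moo bf; rewrite fineK//.
exact: integrable_fin_num (bounded_borel_integrable moo bf).
Qed.

Lemma finite_measure_lty (m : {finite_measure set (borel Z) -> \bar R}) :
  (m [set: borel Z] < +oo)%E.
Proof. by rewrite ltey_eq fin_num_measure. Qed.

(** The definition of [pairing] goes through a chosen Hahn decomposition; any
    other way of writing [nu] as a difference of finite measures does as well,
    since adding the negative parts crosswise gives equal measures. All the
    linearity properties below come from this. *)
Lemma pairing_diff nu (m1 m2 : {measure set (borel Z) -> \bar R}) f :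
  (m1 [set: borel Z] < +oo)%E -> (m2 [set: borel Z] < +oo)%E ->
  (forall A : set (borel Z), measurable A -> (nu A)%:E = (m1 A - m2 A)%E) ->
  bounded_borel f ->
  pairing f nu = Rintegral m1 [set: borel Z] f - Rintegral m2 [set: borel Z] f.
Proof.
move=> m1oo m2oo h bf; rewrite /pairing -/(pos_part nu) -/(neg_part nu).
have poo := finite_measure_lty (pos_part nu).
have noo := finite_measure_lty (neg_part nu).
have E : (\int[measure_add (pos_part nu) m2]_x (f x)%:E =
          \int[measure_add m1 (neg_part nu)]_x (f x)%:E)%E.
  apply: eq_measure_integral => A mA _.
  rewrite [LHS]measure_addE [RHS]measure_addE.
  by apply: fin_num_swap; rewrite ?finite_fin_num// -h// jordanE.
have mf : measurable_fun [set: borel Z] (EFin \o f).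
  by apply/measurable_EFinP; exact: bf.1.
move: E; rewrite !integral_measure_add//; try exact: bounded_borel_integrable.
rewrite !fine_Rintegral// -!EFinD => -[e]; lra.
Qed.

Lemma pairingE nu f : pairing f nu = Rintegral (pos_part nu) [set: borel Z] f -
  Rintegral (neg_part nu) [set: borel Z] f.
Proof. by []. Qed.

Lemma pairing0r f : bounded_borel f -> pairing f 0 = 0.
Proof.
move=> bf; rewrite (@pairing_diff _ mzero mzero) ?subrr//; try exact: ltry.
by move=> A mA; rewrite /mzero sube0.
Qed.

Lemma pairingNr nu f : bounded_borel f -> pairing f (- nu) = - pairing f nu.
Proof.
move=> bf; rewrite (@pairing_diff _ (neg_part nu) (pos_part nu))//.
- by rewrite pairingE opprB.
- exact: finite_measure_lty.
- exact: finite_measure_lty.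
move=> A mA; rewrite [X in X%:E](_ : _ = - nu A)// EFinN jordanE//.
by rewrite fin_num_oppeB ?fin_num_measure// addeC.
Qed.

Lemma pairingDr nu1 nu2 f : bounded_borel f ->
  pairing f (nu1 + nu2) = pairing f nu1 + pairing f nu2.
Proof.
move=> bf; have fl := finite_measure_lty.
rewrite (@pairing_diff _ (measure_add (pos_part nu1) (pos_part nu2))
  (measure_add (neg_part nu1) (neg_part nu2)))//.
- have mf : measurable_fun [set: borel Z] (EFin \o f).
    by apply/measurable_EFinP; exact: bf.1.
  have h (m1 m2 : {finite_measure set (borel Z) -> \bar R}) :
      Rintegral (measure_add m1 m2) [set: borel Z] f =
      Rintegral m1 [set: borel Z] f + Rintegral m2 [set: borel Z] f.
    rewrite {1}/Rintegral integral_measure_add//; try exact: (bounded_borel_integrable (fl _)).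
    by rewrite (fine_Rintegral (fl m1) bf) (fine_Rintegral (fl m2) bf).
  by rewrite !h !pairingE; lra.
- by rewrite [X in (X < _)%E]measure_addE; apply: lte_add_pinfty; exact: fl.
- by rewrite [X in (X < _)%E]measure_addE; apply: lte_add_pinfty; exact: fl.
move=> A mA; rewrite [X in X%:E](_ : _ = nu1 A + nu2 A)// EFinD !jordanE//.
rewrite [X in _ = (X - _)%E]measure_addE [X in _ = (_ - X)%E]measure_addE.
by apply: fin_num_addBB; exact: fin_num_measure.
Qed.

Lemma Rintegral_mscale (k : {nonneg R}) (m : {measure set (borel Z) -> \bar R}) f :
  (m [set: borel Z] < +oo)%E -> bounded_borel f ->
  Rintegral (mscale k m) [set: borel Z] f = k%:num * Rintegral m [set: borel Z] f.
Proof.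
move=> moo bf; have mf : measurable_fun [set: borel Z] (EFin \o f).
  by apply/measurable_EFinP; exact: bf.1.
rewrite {1}/Rintegral integralE.
rewrite !ge0_integral_mscale//; last 2 first.
- exact: measurable_funeneg.
- exact: measurable_funepos.
have fin := bounded_borel_integrable moo bf.
rewrite -muleBr// -?integralE ?fine_Rintegral//.
rewrite fin_num_adde_defl// fin_numN.
exact: integrable_fin_num (integrable_funeneg measurableT fin).
Qed.

Lemma pairingZr (k : R) nu f : bounded_borel f -> pairing f (k *: nu) = k * pairing f nu.
Proof.
move=> bf; wlog k0 : k / 0 <= k => [hw|].
  have [k0|k0] := leP 0 k; first exact: hw.
  rewrite -[k]opprK scaleNr pairingNr// hw ?mulNr// oppr_ge0; exact: ltW.
rewrite (@pairing_diff _ (mscale (NngNum k0) (pos_part nu))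
  (mscale (NngNum k0) (neg_part nu)))//.
- by rewrite !Rintegral_mscale ?finite_measure_lty//= -mulrBr.
- by rewrite /mscale/= lte_mul_pinfty// finite_measure_lty.
- by rewrite /mscale/= lte_mul_pinfty// finite_measure_lty.
move=> A mA; rewrite [X in X%:E](_ : _ = k * nu A)// EFinM jordanE//.
by rewrite /mscale/= muleBr// fin_num_adde_defl// fin_numN fin_num_measure.
Qed.

Lemma pairingBr nu1 nu2 f : bounded_borel f ->
  pairing f (nu1 - nu2) = pairing f nu1 - pairing f nu2.
Proof. by move=> bf; rewrite pairingDr// pairingNr. Qed.

Lemma pairingZDl (k : R) nu f g : bounded_borel f -> bounded_borel g ->
  pairing (fun x => k * f x + g x) nu = k * pairing f nu + pairing g nu.
Proof.
move=> bf bg; have h (m : {finite_measure set (borel Z) -> \bar R}) :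
    Rintegral m [set: borel Z] (fun x => k * f x + g x) =
    k * Rintegral m [set: borel Z] f + Rintegral m [set: borel Z] g.
  have moo := finite_measure_lty m.
  rewrite RintegralD//; try exact: (bounded_borel_integrable moo).
    by rewrite RintegralZl//; exact: (bounded_borel_integrable moo).
  have := bounded_borelZD k bf (bounded_borel_cst Z 0).
  under [X in bounded_borel X]eq_fun do rewrite addr0.
  exact: (bounded_borel_integrable moo).
by rewrite !pairingE !h; lra.
Qed.

Lemma pairingDl nu f g : bounded_borel f -> bounded_borel g ->
  pairing (fun x => f x + g x) nu = pairing f nu + pairing g nu.
Proof.
move=> bf bg; have := pairingZDl 1 nu bf bg.
by under eq_fun do rewrite mul1r; rewrite mul1r.
Qed.

Lemma pairingZl (k : R) nu f : bounded_borel f ->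
  pairing (fun x => k * f x) nu = k * pairing f nu.
Proof.
move=> bf; have b0 := bounded_borel_cst Z (0 : R).
have p0 : pairing (fun=> 0 : R) nu = 0.
  by rewrite pairingE !Rintegral_cst// !mul0r subrr.
have := pairingZDl k nu bf b0; rewrite p0 addr0.
by under eq_fun do rewrite addr0.
Qed.

Lemma eq_pairing nu f g : f =1 g -> pairing f nu = pairing g nu.
Proof. by move=> /funext ->. Qed.

Lemma pairing_indic nu (A : set Z) : is_borel A -> pairing (\1_A) nu = nu A.
Proof.
move=> mA; rewrite pairingE /Rintegral !integral_indic// !setIT.
by have := jordanE nu mA; rewrite -(fineK (fin_num_measure (pos_part nu) _ mA))
  -(fineK (fin_num_measure (neg_part nu) _ mA)) -EFinD => -[->].
Qed.

Lemma pairing_cst nu (k : R) : pairing (fun=> k) nu = k * nu setT.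
Proof.
have -> : (fun=> k) = (fun x => k * \1_(@setT Z) x).
  by apply/funext => x; rewrite indicE in_setT mulr1.
by rewrite pairingZl ?pairing_indic//; [exact: measurableT|
  apply: bounded_borel_indic; exact: measurableT].
Qed.

End pairing_theory.
Arguments pos_part {R Z} nu : simpl never.
Arguments neg_part {R Z} nu : simpl never.

(** * Signs and null sets *)

Section variation.
Context (R : realType) (Z : ptopologicalType).
Implicit Types (f g : Z -> R) (nu : smeasure R Z).

Lemma le_norm_Rintegral (m : {finite_measure set (borel Z) -> \bar R}) f
    (A : set Z) (M : R) :
  is_borel A -> bounded_borel f -> (forall x, `|f x| <= M * \1_A x) ->
  `|Rintegral m [set: borel Z] f| <= M * fine (m A).
Proof.
move=> mA bf fM; have moo := finite_measure_lty m.
have i1 := bounded_borel_integrable moo bf.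
apply: le_trans (le_normr_Rintegral _ i1) _ => //.
have bA : bounded_borel (fun x => M * (\1_A x : R)).
  by have := bounded_borelZD M (bounded_borel_indic R mA) (bounded_borel_cst Z 0);
  under [X in bounded_borel X]eq_fun do rewrite addr0.
have -> : M * fine (m A) = Rintegral m [set: borel Z] (fun x => M * \1_A x).
  rewrite RintegralZl//; last exact: (bounded_borel_integrable moo (bounded_borel_indic R mA)).
  by rewrite /Rintegral integral_indic// setIT.
apply: le_Rintegral => //; last exact: (bounded_borel_integrable moo bA).
exact: (integrable_norm i1).
Qed.

(** Recovers the Hahn sets hidden behind the choice made in [pos_part] and
    [neg_part]. *)
Lemma jordan_supports nu : exists P N : set Z,
  [/\ is_borel P, is_borel N &
   forall A, is_borel A -> pos_part nu A = (nu (A `&` P))%:E /\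
     neg_part nu A = (- nu (A `&` N))%:E].
Proof.
rewrite /pos_part /neg_part; case: (cid _) => -[P N] H /=.
have [[mP _] [mN _] _ _] := H.
exists P, N; split => // A mA; split.
  by rewrite jordan_posE charge.cjordan_posE /crestr0 mem_set.
by rewrite jordan_negE charge.cjordan_negE /crestr0 mem_set// EFinN.
Qed.

Lemma nonneg_parts nu : (forall A, 0 <= nu A) -> forall A, is_borel A ->
  pos_part nu A = (nu A)%:E /\ neg_part nu A = 0%E.
Proof.
move=> nu0 A mA.
have n0 : neg_part nu A = 0%E.
  have [P [N [mP mN /(_ A mA)[_ n0]]]] := jordan_supports nu.
  apply/eqP; rewrite eq_le measure_ge0 andbT n0 lee_fin oppr_le0; exact: nu0.
by split => //; have := jordanE nu mA; rewrite n0 sube0 => ->.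
Qed.

Lemma pairing_nonneg nu f : (forall A, 0 <= nu A) -> bounded_borel f ->
  pairing f nu = Rintegral (pos_part nu) [set: borel Z] f.
Proof.
move=> nu0 bf; rewrite (@pairing_diff _ _ nu (pos_part nu) mzero) => //.
- by rewrite [X in _ - X](_ : _ = 0) ?subr0// /Rintegral integral_measure_zero.
- exact: finite_measure_lty.
- by rewrite /mzero ltry.
- by move=> A mA; rewrite /mzero sube0; exact: esym (nonneg_parts nu0 mA).1.
Qed.

Lemma pairing_ge0 nu f : (forall A, 0 <= nu A) -> bounded_borel f ->
  (forall x, 0 <= f x) -> 0 <= pairing f nu.
Proof. by move=> nu0 bf f0; rewrite pairing_nonneg// Rintegral_ge0. Qed.

Lemma le_pairing nu f g : (forall A, 0 <= nu A) -> bounded_borel f -> bounded_borel g ->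
  (forall x, f x <= g x) -> pairing f nu <= pairing g nu.
Proof.
move=> nu0 bf bg fg; rewrite !pairing_nonneg//.
by apply: le_Rintegral => //; exact: (bounded_borel_integrable (finite_measure_lty _)).
Qed.

Lemma pairing_M1_le nu f M : M1 nu -> bounded_borel f -> (forall x, f x <= M) ->
  pairing f nu <= M.
Proof.
move=> [nu0 nu1] bf fM; have -> : M = pairing (fun=> M) nu.
  by rewrite pairing_cst nu1 mulr1.
by apply: le_pairing => //; exact: bounded_borel_cst.
Qed.

(** Regularity bounds the values of a measure on subsets of [A], not its
    variation; the bound doubles because each Jordan part takes one such value. *)
Lemma pairing_small nu f (A : set Z) (e : R) : is_borel A -> bounded_borel f ->
  (forall B, is_borel B -> B `<=` A -> `|nu B| <= e) ->
  (forall x, `|f x| <= \1_A x) -> `|pairing f nu| <= e + e.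
Proof.
move=> mA bf h fA; rewrite pairingE; apply: le_trans (ler_normB _ _) _.
have [P [N [mP mN PN]]] := jordan_supports nu.
have f1 x : `|f x| <= 1 * \1_A x by rewrite mul1r.
apply: lerD; apply: le_trans (le_norm_Rintegral _ mA bf f1) _; rewrite mul1r.
  rewrite (PN _ mA).1 [fine _]/=; apply: le_trans (ler_norm _) _.
  by apply: h; [exact: measurableI|exact: subIsetl].
rewrite (PN _ mA).2 [fine _]/=; apply: le_trans (ler_norm _) _; rewrite normrN.
by apply: h; [exact: measurableI|exact: subIsetl].
Qed.

Lemma pairing_null nu f g (A : set Z) : (forall B, 0 <= nu B) -> is_borel A ->
  nu A = 0 -> bounded_borel f -> bounded_borel g -> (forall x, ~ A x -> f x = g x) ->
  pairing f nu = pairing g nu.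
Proof.
move=> nu0 mA A0 bf bg fg; rewrite !pairing_nonneg// /Rintegral.
congr fine; apply: ae_eq_integral => //.
- by apply/measurable_EFinP; exact: bf.1.
- by apply/measurable_EFinP; exact: bg.1.
- exists A; split => //; first by apply: etrans (nonneg_parts nu0 mA).1 _; rewrite A0.
  by move=> x /= /not_implyP[_ h]; apply: contrapT => /fg e; apply: h; rewrite /= e.
Qed.

End variation.

Section smeasure_basic.
Context (R : realType) (Z : ptopologicalType).
Implicit Types (nu : smeasure R Z) (A B : set Z).

Lemma smeasure_ext (m n : smeasure R Z) :
  (forall A, is_borel A -> m A = n A) -> m = n.
Proof.
move=> mn; apply/val_inj/funext => A /=; have [mA|nA] := pselect (is_borel A).
  exact: mn.
have [_ _ _ ->//] := asboolW (smeasure_funP m).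
by have [_ _ _ ->] := asboolW (smeasure_funP n).
Qed.

Lemma smeasure_nonborel nu A : ~ is_borel A -> nu A = 0.
Proof. by have [_ _ _] := asboolW (smeasure_funP nu); exact. Qed.

Lemma smeasure0 nu : nu set0 = 0.
Proof. by have [] := asboolW (smeasure_funP nu). Qed.

Lemma smeasure_regular nu : regular nu.
Proof. by have [] := asboolW (smeasure_funP nu). Qed.

Lemma smeasureD nu1 nu2 A : (nu1 + nu2) A = nu1 A + nu2 A.
Proof. by []. Qed.

Lemma smeasureN nu A : (- nu) A = - nu A.
Proof. by []. Qed.

Lemma smeasureZ (k : R) nu A : (k *: nu) A = k * nu A.
Proof. by []. Qed.

Lemma smeasureU nu A B : is_borel A -> is_borel B -> A `&` B = set0 ->
  nu (A `|` B) = nu A + nu B.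
Proof.
move=> mA mB AB; have := chargeU (charge_of nu) mA mB AB.
by rewrite /charge_of -EFinD => -[].
Qed.

Lemma smeasureDI nu A B : is_borel A -> is_borel B ->
  nu A = nu (A `&` B) + nu (A `\` B).
Proof.
move=> mA mB; rewrite -smeasureU ?setUIDK//.
- exact: measurableI.
- exact: measurableD.
- by rewrite setDE setIACA setICr setI0.
Qed.

Lemma smeasureC nu A : is_borel A -> nu (~` A) = nu setT - nu A.
Proof.
by move=> mA; rewrite (@smeasureDI nu setT A measurableT mA) setTI setTD; lra.
Qed.

Lemma le_smeasure nu A B : (forall A, 0 <= nu A) -> is_borel A -> is_borel B ->
  A `<=` B -> nu A <= nu B.
Proof.
move=> nu0 mA mB AB; rewrite (@smeasureDI nu B A)//.
by rewrite (_ : B `&` A = A) ?lerDl//; exact/setIidPr.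
Qed.

Lemma smeasure_subnull nu A B : (forall A, 0 <= nu A) -> is_borel B ->
  A `<=` B -> nu B = 0 -> nu A = 0.
Proof.
move=> nu0 mB AB B0; have [mA|] := pselect (is_borel A); last exact: smeasure_nonborel.
by apply/eqP; rewrite eq_le nu0 andbT -B0 le_smeasure.
Qed.

Lemma smeasure_bigcup_null nu (F : nat -> set Z) : (forall A, 0 <= nu A) ->
  (forall n, is_borel (F n)) -> (forall n, nu (F n) = 0) ->
  nu (\bigcup_n F n) = 0.
Proof.
move=> nu0 mF F0; have mU : is_borel (\bigcup_n F n) by apply: (@bigcup_measurable _ (borel Z)) => k _; exact: mF.
have := (nonneg_parts nu0 mU).1.
suff -> : pos_part nu (\bigcup_n F n) = 0%E by move=> [<-].
apply/eqP; rewrite eq_le measure_ge0 andbT.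
have := measure_sigma_subadditive (pos_part nu) mF mU (@subset_refl _ _).
move/le_trans; apply.
rewrite eseries0// => n _ _; apply: etrans (nonneg_parts nu0 (mF n)).1 _.
by rewrite F0.
Qed.

(** Since [smeasure_of] is 0 on set functions that are not regular measures,
    every use of it starts by checking these four conditions. *)
Lemma smeasure_ofE (m : set Z -> \bar R) : m set0 = 0%E ->
  (forall A, is_borel A -> m A \is a fin_num) ->
  semi_sigma_additive (m : set (borel Z) -> \bar R) ->
  regular (fun A => if `[< is_borel A >] then fine (m A) else 0) ->
  forall A, is_borel A -> smeasure_of m A = fine (m A).
Proof.
move=> m0 mfin madd mreg A mA.
rewrite /smeasure_of [LHS](congr1 (@^~ A) (insubdK _ _)).
  by rewrite (asboolT mA).
apply/asboolP; split => //.
- by rewrite m0; case: ifP.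
- move=> F mF tF mUF.
  rewrite [X in X @ _ --> _](_ : _ =
      (fun n => \sum_(0 <= i < n) m (F i))%E); last first.
    apply/funext => n; apply: eq_bigr => i _.
    by rewrite (asboolT (mF i : is_borel _)) fineK//; exact: (mfin _ (mF i)).
  rewrite (asboolT (mUF : is_borel _)) fineK; last exact: (mfin _ mUF).
  exact: madd.
- by move=> B nB; rewrite (asboolF nB).
Qed.

End smeasure_basic.

(** * Image measures *)

Section pushforwards.
Context (R : realType) (Y Z : ptopologicalType).
Implicit Types (F : Y -> Z) (nu : smeasure R Y).

Lemma continuous_borel F : continuous F ->
  measurable_fun [set: borel Y] (F : borel Y -> borel Z).
Proof.
have /measurability borelP : @measurable _ (borel Z) = <<s open >> by [].
move=> /continuousP cF; apply: borelP => _ [B oB <-]; rewrite setTI.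
by apply: open_is_borel; exact: cF.
Qed.

Lemma is_borel_preimage F (A : set Z) : continuous F -> is_borel A ->
  is_borel (F @^-1` A).
Proof.
move=> /continuous_borel mF mA; rewrite /is_borel -[X in measurable X]setTI.
exact: mF.
Qed.

Lemma bounded_borel_comp F (f : Z -> R) : continuous F -> bounded_borel f -> bounded_borel (f \o F).
Proof.
move=> cF [mf [M fM]]; split; last by exists M => x; exact: fM.
exact: (measurableT_comp mf (continuous_borel cF)).
Qed.

Lemma pushforward_measure_ex F (m : {measure set (borel Y) -> \bar R}) :
  continuous F -> (m [set: borel Y] < +oo)%E ->
  exists m' : {measure set (borel Z) -> \bar R},
    (forall A, m' A = m (F @^-1` A)) /\
    forall f, bounded_borel f -> Rintegral m' [set: borel Z] f =
      Rintegral m [set: borel Y] (f \o F).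
Proof.
move=> cF moo; have mF := continuous_borel cF.
unshelve eexists (pushforward m (F : borel Y -> borel Z)); first exact: mF.
split => // f bf; rewrite /Rintegral integral_pushforward//.
- by apply/measurable_EFinP; exact: bf.1.
- exact: (bounded_borel_integrable moo (bounded_borel_comp cF bf)).
Qed.

(** Inner regularity transports along the image of compact sets, and outer
    regularity follows by applying it to the complement, compact sets being
    closed in a Hausdorff space. *)
Lemma pushforwardME F nu (A : set Z) : hausdorff_space Z -> continuous F ->
  is_borel A -> pushforwardM F nu A = nu (F @^-1` A).
Proof.
move=> hZ cF; move: A; rewrite /pushforwardM => A mA.
have mF := continuous_borel cF.
rewrite (@smeasure_ofE _ _ (pushforward (charge_of nu) (F : borel Y -> borel Z)))//.
- by rewrite /pushforward preimage_set0 charge0.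
- move=> B mB tB mUB; rewrite /pushforward preimage_bigcup.
  have [_ madd _ _] := asboolW (smeasure_funP nu); apply: madd.
  + by move=> n; exact: (is_borel_preimage cF (mB n)).
  + apply/trivIsetP => /= i j _ _ ij; rewrite -preimage_setI.
    by move/trivIsetP : tB => /(_ _ _ _ _ ij) ->//; rewrite preimage_set0.
  + by rewrite -preimage_bigcup; exact: (is_borel_preimage cF mUB).
move=> {mA}A mA e e0; have mFA := is_borel_preimage cF mA.
have mCA : is_borel (~` A) by exact: (@measurableC _ (borel Z)).
have e20 : 0 < e / 2 by rewrite divr_gt0.
have [K [U [cK oU KA AU KU]]] := @smeasure_regular _ _ nu _ mFA _ e20.
have [K' [U' [cK' oU' KA' AU' KU']]] :=
  @smeasure_regular _ _ nu _ (is_borel_preimage cF mCA) _ e20.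
have cFK : compact (F @` K).
  by apply: continuous_compact => //; exact: continuous_subspaceT.
have cFK' : compact (F @` K').
  by apply: continuous_compact => //; exact: continuous_subspaceT.
exists (F @` K), (~` (F @` K')); split => //.
- by apply: closed_openC; exact: compact_closed.
- by move=> _ [x /KA Ax <-].
- by move=> y Ay [x /KA' /= nA xy]; apply: nA; rewrite xy.
move=> B mB BUK; rewrite (asboolT mB) /pushforward /charge_of /=.
have mFB := is_borel_preimage cF mB.
rewrite (@smeasureDI _ _ nu _ (F @^-1` A))//.
apply: le_trans (ler_normD _ _) _; rewrite (splitr e); apply: lerD.
  apply: KU; first exact: measurableI.
  move=> x [/BUK[_ nK] FA]; split; first exact: AU.
  by move=> Kx; apply: nK; exists x.
apply: KU'; first exact: measurableD.
move=> x [/BUK[nK _] FA]; split; first exact: AU'.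
by move=> Kx; apply: nK; exists x.
Qed.

Lemma pairing_pushforward F nu (f : Z -> R) : hausdorff_space Z ->
  continuous F -> bounded_borel f ->
  pairing f (pushforwardM F nu) = pairing (f \o F) nu.
Proof.
move=> hZ cF bf.
have [m1 [m1E m1f]] := pushforward_measure_ex cF (finite_measure_lty (pos_part nu)).
have [m2 [m2E m2f]] := pushforward_measure_ex cF (finite_measure_lty (neg_part nu)).
rewrite (@pairing_diff _ _ _ m1 m2)// ?m1f ?m2f//.
- by rewrite m1E preimage_setT finite_measure_lty.
- by rewrite m2E preimage_setT finite_measure_lty.
move=> A mA; rewrite m1E m2E pushforwardME//.
by apply: jordanE; exact: is_borel_preimage.
Qed.

Lemma pushforwardM_M1 F nu : hausdorff_space Z -> continuous F -> M1 nu ->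
  M1 (pushforwardM F nu).
Proof.
move=> hZ cF [nu0 nu1]; split => [A|].
  have [mA|nA] := pselect (is_borel A); first by rewrite pushforwardME.
  by rewrite smeasure_nonborel.
by rewrite pushforwardME//; exact: measurableT.
Qed.

Lemma pushforwardM_linear F : hausdorff_space Z -> continuous F ->
  linear (pushforwardM F : smeasure R Y -> smeasure R Z).
Proof.
move=> hZ cF k m n; apply: smeasure_ext => A mA.
by rewrite pushforwardME// !smeasureD !smeasureZ !pushforwardME.
Qed.

End pushforwards.

Lemma pushforwardM_comp (R : realType) (X Y Z : ptopologicalType) (F : X -> Y)
    (G : Y -> Z) (nu : smeasure R X) :
  hausdorff_space Y -> hausdorff_space Z -> continuous F -> continuous G ->
  pushforwardM G (pushforwardM F nu) = pushforwardM (G \o F) nu.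
Proof.
move=> hY hZ cF cG; apply: smeasure_ext => A mA.
have cGF : continuous (G \o F) by move=> x; apply: continuous_comp; [exact: cF|exact: cG].
by rewrite !pushforwardME//; exact: is_borel_preimage.
Qed.

(** * Measures are determined by continuous functions *)

Section continuous_functions.
Context (R : realType) (Z : ptopologicalType).
Hypothesis cZ : compact [set: Z].

Lemma continuous_vanishing (f : Z -> R^o) : continuous (f : Z -> R) ->
  f \in @vanishing R Z.
Proof.
move=> cf; apply/asboolP; split=> // e e0.
apply: (subclosed_compact _ cZ) => //.
apply: (@preimage_closed _ _ (fun x => `|f x|) [set y : R | e <= y]).
  by move=> x _; apply: continuous_comp; [exact: cf|exact: norm_continuous].
exact: closed_ge.
Qed.

Definition C0_of (f : Z -> R^o) (cf : continuous (f : Z -> R)) : C0 R Z :=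
  MkC0 (continuous_vanishing cf).

Lemma C0_ext (f g : C0 R Z) : (forall x, f x = g x) -> f = g.
Proof. by move=> fg; apply/val_inj/funext. Qed.

Lemma bounded_borel_continuous (f : Z -> R) : continuous f -> bounded_borel f.
Proof. by move=> cf; exact: (bounded_borel_C0 (C0_of cf)). Qed.

Hypothesis hZ : hausdorff_space Z.

Lemma urysohn_compact (A B : set Z) : closed A -> closed B -> A `&` B = set0 ->
  exists f : Z -> R, [/\ continuous f, forall x, 0 <= f x <= 1,
    forall x, A x -> f x = 0 & forall x, B x -> f x = 1].
Proof.
move=> cA cB AB.
have sep : uniform_separator A B.
  by apply: (proj1 (@normal_separatorP R Z)) => //; exact: compact_normal.
exists (@Urysohn Z R A B); split.
- exact: Urysohn_continuous.
- move=> x; have := @Urysohn_range Z R A B; move=> /(_ (Urysohn A B x)).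
  by rewrite /= in_itv/=; apply; exists x.
- move=> x Ax; have := Urysohn_sub0 (R := R) sep; move=> /(_ (Urysohn A B x)).
  by apply; exists x.
- move=> x Ax; have := Urysohn_sub1 (R := R) sep; move=> /(_ (Urysohn A B x)).
  by apply; exists x.
Qed.

(** Regularity puts the Borel set between a compact and an open set that differ
    by a set of small variation; a Urysohn function separates them. *)
Lemma smeasure_approx (nu : smeasure R Z) (A : set Z) (e : R) :
  is_borel A -> 0 < e -> exists f : C0 R Z,
    (forall x, 0 <= f x <= 1) /\ `|nu A - pairing f nu| <= e.
Proof.
move=> mA e0; have e30 : 0 < e / 3 by rewrite divr_gt0.
have [K [U [cK oU KA AU KU]]] := @smeasure_regular _ _ nu _ mA _ e30.
have clK : closed K by exact: compact_closed.
have [|g [cg g01 gU gK]] := urysohn_compact (open_closedC oU) clK.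
  by apply/seteqP; split => // x [/= nU Kx]; apply/nU/AU/KA.
have mK := closed_is_borel clK; have mU := open_is_borel oU.
exists (C0_of cg); split=> //=.
have bg : bounded_borel g by exact: bounded_borel_continuous.
have bK : bounded_borel (\1_K : Z -> R) by exact: bounded_borel_indic.
rewrite (@smeasureDI _ _ nu A K)// (setIidr KA).
have bgK : bounded_borel (fun x => -1 * \1_K x + g x) by exact: bounded_borelZD.
have -> : pairing g nu = nu K + pairing (fun x => -1 * \1_K x + g x) nu.
  by rewrite pairingZDl// pairing_indic//; lra.
have mUK : is_borel (U `\` K) by exact: measurableD.
have s1 : `|nu (A `\` K)| <= e / 3.
  apply: KU; first exact: measurableD.
  by move=> x [/AU ? ?].
have s2 : `|pairing (fun x => -1 * \1_K x + g x) nu| <= e / 3 + e / 3.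
  apply: (pairing_small mUK) => // x; rewrite !indicE.
  have [Kx|nKx] := pselect (K x).
    rewrite (mem_set Kx) gK// memNset; last by case.
    by rewrite /= mulN1r addNr normr0.
  rewrite (memNset nKx); have [Ux|nUx] := pselect (U x).
    by rewrite mem_set//= mulr0 add0r ger0_norm; have /andP[] := g01 x.
  by rewrite gU// mulr0 add0r normr0.
rewrite [X in `|X|](_ : _ = nu (A `\` K) -
  pairing (fun x => -1 * \1_K x + g x) nu); last by lra.
by apply: le_trans (ler_normB _ _) _; lra.
Qed.

Lemma pairing_pos_smeasure (nu : smeasure R Z) :
  (forall f : C0 R Z, (forall x, 0 <= f x) -> 0 <= pairing f nu) ->
  forall A, 0 <= nu A.
Proof.
move=> h A; have [mA|nA] := pselect (is_borel A); last by rewrite smeasure_nonborel.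
apply/ler_addgt0Pr => e e0; have [f [f01 fe]] := smeasure_approx nu mA e0.
have := h f (fun x => proj1 (andP (f01 x))); move: fe; rewrite ler_norml => /andP[]; lra.
Qed.

(** The difference of the two measures and its opposite are both nonnegative. *)
Lemma pairing_inj (m n : smeasure R Z) :
  (forall f : C0 R Z, pairing f m = pairing f n) -> m = n.
Proof.
move=> h; apply/eqP; rewrite -subr_eq0; apply/eqP; apply: smeasure_ext => A mA.
have z (f : C0 R Z) : pairing f (m - n) = 0.
  by rewrite pairingBr ?h ?subrr//; exact: bounded_borel_C0.
have p1 : 0 <= (m - n) A by apply: pairing_pos_smeasure => f _; rewrite z.
have p2 : 0 <= (- (m - n)) A.
  by apply: pairing_pos_smeasure => f _; rewrite pairingNr ?z ?oppr0//; exact: bounded_borel_C0.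
rewrite [RHS](_ : _ = 0)//; move: p2; rewrite smeasureN => p2; lra.
Qed.

End continuous_functions.

(** * The weak* topology *)

Lemma initial_cvgP (S : choiceType) (T : topologicalType) (f : S -> T)
    (F : set_system S) (s : S) : Filter F ->
  F --> (s : initial_topology f) <-> f @ F --> f s.
Proof.
move=> FF; split=> [Fs|Ffs].
  by apply: cvg_trans (@initial_continuous _ _ f s); exact: cvg_app.
move=> A /= [_ [[B oB <-] Bs] BA]; apply: (filterS BA).
by apply: Ffs; apply: open_nbhs_nbhs.
Qed.

Lemma prod_cvgP (I : Type) (K : I -> topologicalType)
    (F : set_system (prod_topology K)) (f : prod_topology K) : Filter F ->
  F --> f <-> forall i, (fun g : prod_topology K => g i) @ F --> f i.
Proof.
move=> FF; split=> [Ff i|h].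
  by move/cvg_sup : Ff => /(_ i) /initial_cvgP.
by apply/cvg_sup => i; apply/initial_cvgP; exact: h.
Qed.

Section weak_star.
Context (R : realType) (Z : ptopologicalType).

Lemma weakstar_cvgP (F : set_system (smeasure R Z)) (nu : smeasure R Z) :
  Filter F -> F --> nu <-> forall f : C0 R Z, pairing f @ F --> pairing f nu.
Proof.
move=> FF; split=> [Fnu f|h].
  by move/initial_cvgP : Fnu => /prod_cvgP /(_ f).
by apply/initial_cvgP; apply/prod_cvgP => f; exact: h.
Qed.

Lemma pairing_continuous (f : C0 R Z) :
  continuous (pairing f : smeasure R Z -> R).
Proof. by move=> nu; have /weakstar_cvgP := @cvg_id _ (nbhs nu); exact. Qed.

Lemma weakstar_continuous (T : topologicalType) (g : T -> smeasure R Z) :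
  (forall f : C0 R Z, continuous (fun t => pairing f (g t))) -> continuous g.
Proof. by move=> h t; apply/weakstar_cvgP => f; exact: h. Qed.

Lemma weakstar_hausdorff : compact [set: Z] -> hausdorff_space Z ->
  hausdorff_space (smeasure R Z).
Proof.
move=> cZ hZ m n mn; apply: (pairing_inj cZ hZ) => f.
apply: (@Rhausdorff R) => A B mA nB.
have [nu [Anu Bnu]] := mn _ _ (pairing_continuous mA) (pairing_continuous nB).
by exists (pairing f nu).
Qed.

Lemma closed_pairing_le (f : C0 R Z) (c : R) :
  closed [set nu : smeasure R Z | pairing f nu <= c].
Proof.
apply: (@preimage_closed _ _ (pairing f) [set y : R | y <= c]).
  by move=> nu _; exact: pairing_continuous.
exact: closed_le.
Qed.

Lemma closed_pairing_ge (f : C0 R Z) (c : R) :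
  closed [set nu : smeasure R Z | c <= pairing f nu].
Proof.
apply: (@preimage_closed _ _ (pairing f) [set y : R | c <= y]).
  by move=> nu _; exact: pairing_continuous.
exact: closed_ge.
Qed.

Lemma closed_pairing_eq (f : C0 R Z) (c : R) :
  closed [set nu : smeasure R Z | pairing f nu = c].
Proof.
have -> : [set nu : smeasure R Z | pairing f nu = c] =
    [set nu | pairing f nu <= c] `&` [set nu | c <= pairing f nu].
  apply/seteqP; split=> nu /=; first by move=> ->.
  by move=> [h1 h2]; apply/eqP; rewrite eq_le h1.
by apply: closedI; [exact: closed_pairing_le|exact: closed_pairing_ge].
Qed.

End weak_star.

Lemma pushforwardM_continuous (R : realType) (Y Z : ptopologicalType)
    (F : Y -> Z) : compact [set: Y] -> hausdorff_space Z -> continuous F ->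
  continuous (pushforwardM F : smeasure R Y -> smeasure R Z).
Proof.
move=> cY hZ cF; apply: weakstar_continuous => f.
have cfF : continuous (f \o F : Y -> R).
  by move=> x; apply: continuous_comp; [exact: cF|exact: C0_continuous].
under eq_fun do rewrite (pairing_pushforward _ hZ cF (bounded_borel_C0 f)).
exact: (@pairing_continuous _ _ (C0_of cY cfF)).
Qed.

(** * The Riesz representation theorem *)

(** The increasing continuous approximation of an open set that metrisability
    provides; stated directly because the one-point compactification comes
    without a metric. *)
Definition exhaustible (R : realType) (Z : topologicalType) (U : set Z) : Prop :=
  exists g : nat -> Z -> R, [/\ forall n, continuous (g n),
    forall n x, 0 <= g n x <= 1, forall x, nondecreasing_seq (g ^~ x),
    forall n x, ~ U x -> g n x = 0 & forall x, U x -> exists n, g n x = 1].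

Section C0_compact_ops.
Context (R : realType) (Z : ptopologicalType).
Hypothesis cZ : compact [set: Z].
Implicit Types f g : C0 R Z.

Lemma open_C0_gt f (c : R) : open [set x | c < f x].
Proof.
apply: (@open_comp _ _ (f : Z -> R) [set y | c < y]); last exact: open_gt.
by move=> x _; exact: C0_continuous.
Qed.

Lemma mulC0_continuous f (g : Z -> R) : continuous g ->
  continuous (fun x => f x * g x : R).
Proof. by move=> cg x; apply: continuousM; [exact: C0_continuous|exact: cg]. Qed.

Definition mulC0 f (g : Z -> R) (cg : continuous g) : C0 R Z :=
  C0_of cZ (@mulC0_continuous f g cg).

Definition cstC0 (k : R) : C0 R Z := C0_of cZ (@cst_continuous Z R k).

Lemma minC0_continuous f (k : R) : continuous (fun x => Num.min (f x) k : R).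
Proof.
by move=> x; apply: continuous_min; [exact: C0_continuous|exact: cst_continuous].
Qed.

Definition minC0 f (k : R) : C0 R Z := C0_of cZ (@minC0_continuous f k).

End C0_compact_ops.

Section riesz.
Context (R : realType) (Z : ptopologicalType).
Hypothesis cZ : compact [set: Z].
Hypothesis exh : forall U : set Z, open U -> exhaustible R U.

Implicit Types f g : C0 R Z.
Variable L : C0 R Z -> R.
Hypothesis Llin : forall k f g, L (k *: f + g) = k * L f + L g.
Hypothesis Lpos : forall f, (forall x, 0 <= f x) -> 0 <= L f.

Let LD f g : L (f + g) = L f + L g.
Proof. by have := Llin 1 f g; rewrite scale1r mul1r. Qed.
Let L0 : L 0 = 0.
Proof. by have := LD 0 0; rewrite addr0 => h; lra. Qed.
Let LZ k f : L (k *: f) = k * L f.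
Proof. by have := Llin k f 0; rewrite L0 !addr0. Qed.
Let LB f g : L (f - g) = L f - L g.
Proof. by rewrite LD -scaleN1r LZ mulN1r. Qed.
Let Lle f g : (forall x, f x <= g x) -> L f <= L g.
Proof.
move=> fg; rewrite -subr_ge0 -LB; apply: Lpos => x.
by rewrite [leRHS](_ : _ = g x - f x) ?subr_ge0.
Qed.

(** The outer measure of [A] is the infimum of these bounds [c]. Increasing
    sequences stand for countable families of functions summing to at least 1 on
    [A], so that no double series appears when countably many covers are merged. *)
Definition covers (A : set Z) (G : nat -> C0 R Z) (c : R) : Prop :=
  [/\ forall n x, 0 <= G n x, forall x, nondecreasing_seq (fun n => G n x : R),
      forall x, A x -> exists n, 1 <= G n x & forall n, L (G n) <= c].

Definition riesz_real (A : set Z) : R := inf [set c | exists G, covers A G c].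

Let covers_ge0 A G c : covers A G c -> 0 <= c.
Proof. by move=> [G0 _ _ /(_ 0%N)]; apply: le_trans; apply: Lpos; exact: G0. Qed.

Let covers_lb A : has_lbound [set c | exists G, covers A G c].
Proof. by exists 0 => c [G /covers_ge0]. Qed.

Let cover_cst A f : (forall x, 0 <= f x) -> (forall x, A x -> 1 <= f x) ->
  covers A (fun=> f) (L f).
Proof.
move=> f0 fA; split => //; first by move=> x n m _.
by move=> x /fA; exists 0%N.
Qed.

Let has_inf_covers A : has_inf [set c | exists G, covers A G c].
Proof.
split=> //; exists (L (cstC0 cZ 1)), (fun=> cstC0 cZ 1).
by apply: cover_cst => x //=.
Qed.

Let riesz_le A G c : covers A G c -> riesz_real A <= c.
Proof. by move=> h; apply: inf_lbound => //; exists G. Qed.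

Let riesz_ge A c : (forall G b, covers A G b -> c <= b) -> c <= riesz_real A.
Proof.
by move=> h; apply: lb_le_inf; [exact: (has_inf_covers A).1|move=> b [G /h]].
Qed.

Let riesz_adh A e : 0 < e -> exists G c, covers A G c /\ c < riesz_real A + e.
Proof.
move=> e0; have [c [G h] hc] := inf_adherent e0 (has_inf_covers A).
by exists G, c.
Qed.

Let riesz_ge0 A : 0 <= riesz_real A.
Proof. by apply: riesz_ge => G c /covers_ge0. Qed.

Let riesz0 : riesz_real set0 = 0.
Proof.
apply/eqP; rewrite eq_le riesz_ge0 andbT -L0.
by apply: (@riesz_le _ (fun=> 0)); apply: cover_cst.
Qed.

Let riesz_mono A B : A `<=` B -> riesz_real A <= riesz_real B.
Proof.
move=> AB; apply: riesz_ge => G c [G0 Gm GB Gc].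
by apply: (@riesz_le _ G); split => // x /AB; exact: GB.
Qed.

Definition riesz_outer (A : set Z) : \bar R := (riesz_real A)%:E.

Let outer0 : riesz_outer set0 = 0%E.
Proof. by rewrite /riesz_outer riesz0. Qed.

Let outer_ge0 A : (0 <= riesz_outer A)%E.
Proof. by rewrite lee_fin. Qed.

Let outer_le : {homo riesz_outer : A B / A `<=` B >-> (A <= B)%E}.
Proof. by move=> A B AB; rewrite lee_fin riesz_mono. Qed.

Let sum_half n : \sum_(k < n) (2^-1 : R) ^+ k.+1 <= 1.
Proof.
suff -> : \sum_(k < n) (2^-1 : R) ^+ k.+1 = 1 - 2^-1 ^+ n.
  by rewrite gerBl exprn_ge0// invr_ge0.
elim: n => [|n IH]; first by rewrite big_ord0 expr0 subrr.
rewrite big_ord_recr /= IH exprS; lra.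
Qed.

(** The covers of the sets [F k] are merged diagonally: the [n]-th function sums
    the [n]-th functions of the first [n] covers. *)
Let outer_sigma : sigma_subadditive riesz_outer.
Proof.
move=> F; have [->|] := eqVneq (\sum_(i <oo) riesz_outer (F i))%E +oo%E.
  by rewrite leey.
move=> Snoo.
have S0 : (0 <= \sum_(i <oo) riesz_outer (F i))%E by apply: nneseries_ge0.
have Sfin : (\sum_(i <oo) riesz_outer (F i))%E \is a fin_num.
  by rewrite ge0_fin_numE// ltey.
rewrite -(fineK Sfin) lee_fin; set s := fine _.
have part n : \sum_(k < n) riesz_real (F k) <= s.
  rewrite -lee_fin (fineK Sfin).
  have := @nneseries_lim_ge _ (fun i => riesz_outer (F i)) xpredT 0 n.
  rewrite big_mkord -sumEFin; apply => i _ _; exact: outer_ge0.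
apply/ler_addgt0Pr => e e0.
have /choice[Gc hGc] n : exists Gc : (nat -> C0 R Z) * R,
    covers (F n) Gc.1 Gc.2 /\ Gc.2 < riesz_real (F n) + e * 2^-1 ^+ n.+1.
  have [|G [c [h1 h2]]] := @riesz_adh (F n) (e * 2^-1 ^+ n.+1).
    by rewrite mulr_gt0// exprn_gt0.
  by exists (G, c).
pose H n := \sum_(k < n) (Gc k).1 n.
have HE n x : H n x = \sum_(k < n) (Gc k).1 n x.
  rewrite /H; elim/big_ind2 : _ => // f1 r1 f2 r2 <- <-.
  by [].
apply: (@riesz_le _ H); split.
- by move=> n x; rewrite HE; apply: sumr_ge0 => k _; have [[]] := hGc k.
- move=> x; apply/nondecreasing_seqP => n; rewrite !HE big_ord_recr /=.
  rewrite -[leLHS]addr0; apply: lerD; last by have [[]] := hGc n.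
  by apply: ler_sum => k _; have [[_ m _ _] _] := hGc k; exact: m.
- move=> x [k _ Fkx]; have [[G0 Gm GF Gb] _] := hGc k.
  have [n n1] := GF _ Fkx; exists (maxn n k.+1); rewrite HE.
  have km : (k < maxn n k.+1)%N by rewrite leq_max ltnSn orbT.
  rewrite (bigD1 (Ordinal km))//=.
  rewrite -[1]addr0; apply: lerD; last first.
    by apply: sumr_ge0 => i _; have [[]] := hGc i.
  by apply: le_trans n1 _; apply: Gm; rewrite leq_maxl.
- move=> n; have -> : L (H n) = \sum_(k < n) L ((Gc k).1 n).
    by rewrite /H; elim/big_ind2 : _ => // f1 r1 f2 r2 <- <-.
  apply: (@le_trans _ _ (\sum_(k < n) (riesz_real (F k) + e * 2^-1 ^+ k.+1))).
    apply: ler_sum => k _; have [[_ _ _ Gb] /ltW] := hGc k.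
    by apply: le_trans; exact: Gb.
  rewrite big_split/= -mulr_sumr; apply: lerD; first exact: part.
  by rewrite -[leRHS]mulr1 ler_wpM2l ?(ltW e0)//; exact: sum_half.
Qed.

HB.instance Definition _ := isOuterMeasure.Build R Z riesz_outer
  outer0 outer_ge0 outer_le outer_sigma.

Let mu : {outer_measure set Z -> \bar R} := riesz_outer.

(** Multiplying a cover of [A] by the functions exhausting [U] gives a cover of
    the part of [A] inside [U]; the remainders cover the part outside. *)
Let open_caratheodory U : open U -> mu.-caratheodory U.
Proof.
move=> /exh[g [cg g01 gm gU0 gU1]]; apply: le_caratheodory_measurable => A.
rewrite /mu /= /riesz_outer -EFinD lee_fin; apply: riesz_ge => G c [G0 Gm GA Gc].
pose P n m := mulC0 cZ (G n) (cg m).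
have Pmon n m n' m' : (n <= n')%N -> (m <= m')%N -> L (P n m) <= L (P n' m').
  move=> nn mm; apply: Lle => x /=.
  have /andP[h1 h2] := g01 m x; apply: ler_pM; [exact: G0|by []|exact: Gm|exact: gm].
have PG n m : L (P n m) <= L (G n).
  apply: Lle => x /=; have /andP[h1 h2] := g01 m x.
  by rewrite -[leRHS]mulr1 ler_wpM2l.
have subP : has_sup (range (fun n => L (P n n))).
  split; first by exists (L (P 0%N 0%N)), 0%N.
  by exists c => _ [n _ <-]; apply: le_trans (PG _ _) (Gc _).
pose c' := sup (range (fun n => L (P n n))).
have in_le : riesz_real (A `&` U) <= c'.
  apply: (@riesz_le _ (fun n => P n n)); split.
  - by move=> n x; apply: mulr_ge0; [exact: G0|have /andP[] := g01 n x].
  - move=> x n m nm /=; have /andP[h1 h2] := g01 n x.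
    by apply: ler_pM; [exact: G0|by []|exact: Gm|exact: gm].
  - move=> x [/GA[n n1] /gU1[m m1]]; exists (maxn n m) => /=.
    have -> : g (maxn n m) x = 1.
      apply/eqP; rewrite eq_le; have /andP[_ ->] := g01 (maxn n m) x.
      by rewrite -m1; apply: gm; rewrite leq_maxr.
    by rewrite mulr1; apply: le_trans n1 _; apply: Gm; rewrite leq_maxl.
  - by move=> n; apply: (sup_ubound subP.2); exists n.
apply/ler_addgt0Pr => e e0.
have [_ [m _ <-] mc'] := sup_adherent e0 subP.
suff : riesz_real (A `&` ~` U) <= c - (c' - e) by move: in_le; lra.
apply: (@riesz_le _ (fun n => G n - P n m)); split.
- move=> n x; rewrite [leRHS](_ : _ = G n x - G n x * g m x)//.
  by have /andP[h1 h2] := g01 m x; rewrite subr_ge0 -[leRHS]mulr1 ler_wpM2l.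
- move=> x n n' nn; rewrite [leLHS](_ : _ = G n x * (1 - g m x)); last first.
    by rewrite mulrBr mulr1.
  rewrite [leRHS](_ : _ = G n' x * (1 - g m x)); last by rewrite mulrBr mulr1.
  by rewrite ler_wpM2r ?Gm// subr_ge0; have /andP[] := g01 m x.
- move=> x [/GA[n n1] /(gU0 m) g0]; exists n.
  by rewrite [leRHS](_ : _ = G n x - G n x * g m x)// g0 mulr0 subr0.
- move=> n; rewrite LB; have h := Gc (maxn n m).
  have h1 : L (G n) - L (P n m) <= L (G (maxn n m)) - L (P (maxn n m) m).
    rewrite -!LB; apply: Lle => x.
    rewrite [leLHS](_ : _ = G n x * (1 - g m x)); last by rewrite mulrBr mulr1.
    rewrite [leRHS](_ : _ = G (maxn n m) x * (1 - g m x)); last by rewrite mulrBr mulr1.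
    rewrite ler_wpM2r//; first by rewrite subr_ge0; have /andP[] := g01 m x.
    by apply: Gm; rewrite leq_maxl.
  have h2 : L (P m m) <= L (P (maxn n m) m) by apply: Pmon; rewrite ?leq_maxr.
  move: mc' h h1 h2; rewrite -/c'; lra.
Qed.

Let borel_caratheodory A : is_borel A -> mu.-caratheodory A.
Proof.
suff : @measurable _ (borel Z) `<=` mu.-cara.-measurable by apply.
apply: smallest_sub; last by move=> U /open_caratheodory.
exact: (@sigma_algebra_measurable _ (caratheodory_type mu)).
Qed.

Let outer_sigma_additive :
  semi_sigma_additive (riesz_outer : set (borel Z) -> \bar R).
Proof.
move=> F mF tF mUF; apply: (@caratheodory_measure_sigma_additive R Z mu) => //.
- by move=> n; exact: (borel_caratheodory (mF n)).
- exact: (borel_caratheodory mUF).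
Qed.

(** The union of the open sets where a cover exceeds [1 / (1 + d)] contains [A]
    and is covered by the same functions multiplied by [1 + d]. *)
Let outer_regular A : forall e, 0 < e -> exists U, [/\ open U, A `<=` U &
  riesz_real U <= riesz_real A + e].
Proof.
(* [d] makes [d * c] at most [e / 2] for bounds [c] up to [riesz_real A + e]. *)
move=> e e0; pose d := e / (2 * (riesz_real A + e + 1)).
have rA := riesz_ge0 A.
have d0 : 0 < d by rewrite divr_gt0// mulr_gt0//; lra.
have e20 : 0 < e / 2 by rewrite divr_gt0.
have [G [c [hG cA]]] := riesz_adh A e20; have c0 := covers_ge0 hG.
have [G0 Gm GA Gc] := hG.
exists (\bigcup_n [set x | (1 + d)^-1 < G n x]); split.
- by apply: bigcup_open => n _; exact: open_C0_gt.
- move=> x /GA[n n1]; exists n => //=; apply: lt_le_trans n1.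
  by rewrite invf_lt1; lra.
apply: (@le_trans _ _ ((1 + d) * c)).
  have d1 : 0 <= 1 + d by lra.
  apply: (@riesz_le _ (fun n => (1 + d) *: G n)); split.
  - by move=> n x; rewrite [leRHS](_ : _ = (1 + d) * G n x)// mulr_ge0.
  - move=> x n m nm; rewrite [leLHS](_ : _ = (1 + d) * G n x)//.
    by rewrite [leRHS](_ : _ = (1 + d) * G m x)// ler_wpM2l//; exact: Gm.
  - move=> x [n _ /= h]; exists n; rewrite [leRHS](_ : _ = (1 + d) * G n x)//.
    by rewrite -ler_pdivrMl ?mulr1 ?ltW//; lra.
  - by move=> n; rewrite LZ ler_wpM2l.
have : d * c <= e / 2.
  have : d * c <= d * (riesz_real A + e + 1) by rewrite ler_wpM2l ?ltW//; lra.
  move/le_trans; apply; rewrite /d; set t := riesz_real A + e + 1.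
  have t0 : t != 0 by rewrite gt_eqF// /t; lra.
  by rewrite invfM mulrA mulfVK.
rewrite mulrDl mul1r; lra.
Qed.

Definition riesz_measure : smeasure R Z := smeasure_of riesz_outer.

Let rieszD A B : is_borel A -> A `<=` B -> riesz_real B = riesz_real A + riesz_real (B `\` A).
Proof.
move=> /borel_caratheodory /(_ B) h AB; have : mu B = mu B by [].
by rewrite {1}h (setIidr AB) -setDE /mu /= /riesz_outer -EFinD => -[->].
Qed.

Lemma riesz_measureE A : is_borel A -> riesz_measure A = riesz_real A.
Proof.
move=> mA; rewrite /riesz_measure smeasure_ofE// => {mA}A mA e e0.
have mCA : is_borel (~` A) by exact: (@measurableC _ (borel Z)).
have e20 : 0 < e / 2 by rewrite divr_gt0.
have [U [oU AU Ue]] := outer_regular A e20.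
have [V [oV AV Ve]] := outer_regular (~` A) e20.
exists (~` V), U; split => //.
- by apply: (subclosed_compact _ cZ) => //; exact: open_closedC.
- by move=> x nV; apply: contrapT => /AV.
move=> B mB BUV; rewrite (asboolT mB) /= ger0_norm ?riesz_ge0//.
have sub : B `<=` (U `\` A) `|` (V `\` ~` A).
  move=> x /BUV[Ux nV]; have [Ax|nAx] := pselect (A x); last by left.
  by right; split; [apply: contrapT|].
have hU := rieszD mA AU; have hV := rieszD mCA AV.
have -> : e = e / 2 + e / 2 by lra.
have mUA : is_borel (U `\` A).
  by apply: (@measurableD _ (borel Z)) => //; exact: open_is_borel.
have := @rieszD (U `\` A) ((U `\` A) `|` (V `\` ~` A)) mUA (@subsetUl _ _ _).
have : riesz_real (((U `\` A) `|` (V `\` ~` A)) `\` (U `\` A)) <=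
  riesz_real (V `\` ~` A) by apply: riesz_mono => x [[]].
by move: (riesz_mono sub) Ue Ve; lra.
Qed.

Lemma riesz_measure_ge0 A : 0 <= riesz_measure A.
Proof.
have [mA|] := pselect (is_borel A); first by rewrite riesz_measureE ?riesz_ge0.
by move=> /smeasure_nonborel ->.
Qed.

Let cst1 := cstC0 (R:=R) cZ 1.

(** By compactness one function of a cover of the whole space is at least
    [1 - d] everywhere. *)
Let riesz_total : riesz_real setT = L cst1.
Proof.
apply/eqP; rewrite eq_le; apply/andP; split.
  by apply: (@riesz_le _ (fun=> cst1)); apply: cover_cst => x //=.
apply: riesz_ge => G c [G0 Gm GT Gc].
have c0 : 0 <= c by apply: le_trans (Gc 0%N); exact: Lpos.
have key d : 0 < d -> d < 1 -> (1 - d) * L cst1 <= c.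
  move=> d0 d1.
  have : cover_compact [set: Z] by rewrite -compact_cover.
  move=> /(_ nat setT (fun n => [set x | 1 - d < G n x])) [].
  - by move=> n _; exact: open_C0_gt.
  - move=> x _; have [n n1] := GT x I; exists n => //=; lra.
  move=> D _ Dc; pose N := \max_(i <- finmap.enum_fset D) i.
  apply: le_trans (Gc N); rewrite -LZ; apply: Lle => x.
  rewrite [leLHS](_ : _ = (1 - d) * 1)// mulr1.
  have [n nD /= /ltW nx] := Dc x I; apply: le_trans nx _; apply: Gm.
  by rewrite /N (big_rem _ nD) /=; exact: leq_maxl.
apply/ler_addgt0Pr => e e0; have l0 : 0 <= L cst1 by apply: Lpos => x /=.
pose d := e / (e + L cst1 + 1).
have t0 : 0 < e + L cst1 + 1 by lra.
have d0 : 0 < d by rewrite divr_gt0.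
have d1 : d < 1 by rewrite ltr_pdivrMr//; lra.
have := key _ d0 d1.
suff : d * L cst1 <= e by rewrite mulrBl mul1r; lra.
rewrite /d mulrAC ler_pdivrMr// ler_wpM2l ?ltW//; lra.
Qed.

(** Cut [f] into horizontal layers of height [1 / N]. The layer above level
    [u] vanishes off the set where [f > u], and the layer below that level,
    multiplied by [N], is a cover of this set. Each layer thus has its integral
    bounded by the functional at the previous layer, and the lowest one costs at
    most the total mass divided by [N]. *)
Let pairing_le f : (forall x, 0 <= f x <= 1) -> pairing f riesz_measure <= L f.
Proof.
move=> f01; have mT : is_borel (@setT Z) by exact: measurableT.
set s := riesz_real setT.
have nu0 := riesz_measure_ge0.
have bC (h : C0 R Z) := bounded_borel_C0 h.
have step (N : nat) i : pairing (minC0 cZ f (i.+1%:R / N.+1%:R)) riesz_measure <=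
    L (minC0 cZ f (i%:R / N.+1%:R)) + s / N.+1%:R.
  have N0 : (0 : R) < N.+1%:R by [].
  elim: i => [|i IH].
    have -> : minC0 cZ f (0%:R / N.+1%:R) = 0.
      apply: C0_ext => x /=; rewrite mul0r; apply/min_idPr.
      by have /andP[] := f01 x.
    rewrite L0 add0r; apply: le_trans (_ : pairing (fun=> 1 / N.+1%:R) riesz_measure <= _).
      apply: le_pairing => //; first exact: bounded_borel_cst.
      by move=> x /=; rewrite ge_min lexx orbT.
    by rewrite pairing_cst riesz_measureE// -/s; rewrite mul1r mulrC.
  pose u := i.+1%:R / N.+1%:R : R; pose v := i%:R / N.+1%:R : R.
  pose w := i.+2%:R / N.+1%:R : R.
  have uv : u = v + N.+1%:R^-1 by rewrite /u /v -addn1 natrD mulrDl mul1r.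
  have wu : w = u + N.+1%:R^-1 by rewrite /w /u -(addn1 i.+1) natrD mulrDl mul1r.
  have iN0 : (0 : R) < N.+1%:R^-1 by rewrite invr_gt0.
  pose B := [set x | u < f x].
  have mB : is_borel B.
    by apply: open_is_borel; exact: open_C0_gt.
  have bB : bounded_borel (fun x => N.+1%:R^-1 * \1_B x : R).
    have := bounded_borelZD (N.+1%:R^-1) (bounded_borel_indic R mB) (bounded_borel_cst Z 0).
    by under [X in bounded_borel X]eq_fun do rewrite addr0.
  have h1 : pairing (minC0 cZ f w) riesz_measure <=
      N.+1%:R^-1 * riesz_real B + pairing (minC0 cZ f u) riesz_measure.
    rewrite -(riesz_measureE mB) -pairing_indic// -pairingZDl//; last exact: bounded_borel_indic.
    apply: le_pairing => //; first by apply: bounded_borelZD => //; exact: bounded_borel_indic.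
    move=> x /=; rewrite indicE; have [xB|xB] := boolP (x \in B).
      rewrite mulr1; move: xB; rewrite inE /B /= => xB.
      by rewrite [X in _ <= _ + X]min_r ?(ltW xB)// wu [leRHS]addrC ge_min lexx orbT.
    rewrite mulr0 add0r; have fu : f x <= u.
      by rewrite leNgt; apply: contraNN xB => h; rewrite inE.
    by rewrite [leRHS]min_l// ge_min lexx.
  have h2 : N.+1%:R^-1 * riesz_real B <= L (minC0 cZ f u) - L (minC0 cZ f v).
    rewrite -LB mulrC ler_pdivrMr// mulrC -LZ.
    apply: (@riesz_le _ (fun=> N.+1%:R *: (minC0 cZ f u - minC0 cZ f v))).
    apply: cover_cst => x.
      rewrite [leRHS](_ : _ = N.+1%:R * (Num.min (f x) u - Num.min (f x) v))//.
      rewrite mulr_ge0// subr_ge0 le_min !ge_min lexx /=.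
      by rewrite uv lerDl (ltW iN0) orbT.
    rewrite /B /= => xB.
    rewrite [leRHS](_ : _ = N.+1%:R * (Num.min (f x) u - Num.min (f x) v))//.
    have vf : v <= f x by apply: le_trans (ltW xB); rewrite uv lerDl ltW.
    rewrite (min_r vf) (min_r (ltW xB)).
    by rewrite uv [v + _]addrC addrK mulfV.
  move: h1 h2 IH; rewrite -/u -/v -/w.
  move: (N.+1%:R^-1 * _) (s / _) (pairing (minC0 cZ f w) _).
  move: (pairing (minC0 cZ f u) _) (L (minC0 cZ f u)) (L (minC0 cZ f v)).
  by move=> p1 p2 p3 p4 p5 p6; lra.
apply/ler_addgt0Pr => e e0.
have s0 : 0 <= s by exact: riesz_ge0.
pose N := Num.trunc (s / e).
have Ne : s / N.+1%:R <= e.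
  rewrite ler_pdivrMr// -ler_pdivrMl// mulrC ltW//.
  by apply: truncnS_gt.
have := step N N.
have -> : minC0 cZ f (N.+1%:R / N.+1%:R) = f.
  apply: C0_ext => x /=; rewrite divff//; apply/min_idPl; by have /andP[] := f01 x.
have : L (minC0 cZ f (N%:R / N.+1%:R)) <= L f.
  by apply: Lle => x /=; rewrite ge_min lexx.
by move: Ne; move: (s / _) (L _) (pairing _ _) (L _) => q l1 p l2; lra.
Qed.

(** For [0 <= f <= 1] the inequality [pairing_le] also holds for [1 - f], and
    both sides agree at the constant 1. *)
Lemma riesz_representation : exists nu : smeasure R Z,
  (forall A, 0 <= nu A) /\ forall f : C0 R Z, pairing f nu = L f.
Proof.
exists riesz_measure; split; first exact: riesz_measure_ge0.
have eq01 f : (forall x, 0 <= f x <= 1) -> pairing f riesz_measure = L f.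
  move=> f01; apply/eqP; rewrite eq_le pairing_le//=.
  have := @pairing_le (cst1 - f); rewrite LB.
  have -> : pairing (cst1 - f) riesz_measure =
      L cst1 - pairing f riesz_measure.
    have -> : (cst1 - f : Z -> R) = fun x => -1 * f x + 1.
      by apply/funext => x; rewrite mulN1r addrC.
    rewrite pairingZDl; [|exact: bounded_borel_C0|exact: bounded_borel_cst].
    rewrite pairing_cst mul1r riesz_measureE ?riesz_total; first by lra.
    exact: measurableT.
  move=> h; suff : L cst1 - pairing f riesz_measure <= L cst1 - L f by lra.
  apply: h => x; rewrite [X in _ <= X <= _](_ : _ = 1 - f x)//.
  by have /andP[] := f01 x; lra.
move=> f; pose M := `|f| + 1.
have M0 : 0 < M by rewrite ltr_wpDl// normr_ge0.
have fM x : - M <= f x <= M.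
  by rewrite -ler_norml; apply: le_trans (C0_norm_ub f x) _; rewrite /M lerDl.
clearbody M; pose u := (2 * M)^-1 *: (f + M *: cst1).
have M2 : 0 < 2 * M by rewrite mulr_gt0.
have uE x : u x = (2 * M)^-1 * (f x + M * 1) by [].
have fu : f = (2 * M) *: u - M *: cst1.
  by rewrite /u scalerA divff ?gt_eqF// scale1r addrK.
have u01 x : 0 <= u x <= 1.
  rewrite uE mulr1; have /andP[h1 h2] := fM x; apply/andP; split.
    by rewrite mulr_ge0 ?invr_ge0 ?(ltW M2)//; lra.
  by rewrite mulrC ler_pdivrMr// mul1r; lra.
have c01 x : 0 <= cst1 x <= 1 by rewrite /= ler01 lexx.
have e1 := eq01 _ u01; have e2 := eq01 _ c01.
have -> : pairing f riesz_measure = 2 * M * pairing u riesz_measure +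
    - M * pairing cst1 riesz_measure.
  have bMc : bounded_borel (fun x => - M * cst1 x) := bounded_borel_C0 (- M *: cst1).
  rewrite -(pairingZl (- M) _ (bounded_borel_C0 cst1)) -(pairingZDl _ _ (bounded_borel_C0 u) bMc).
  by congr pairing; apply/funext => x; rewrite {1}fu mulNr.
by rewrite e1 e2 [in RHS]fu LB !LZ mulNr.
Qed.

End riesz.

(** * Restrictions of measures and the Jordan decomposition *)

Section restriction.
Context (R : realType) (Z : ptopologicalType).
Implicit Types (nu : smeasure R Z) (A P : set Z).

Definition smeasure_restr nu P : smeasure R Z :=
  smeasure_of (fun A => (nu (A `&` P))%:E).

Lemma smeasure_restrE nu P A : is_borel P -> is_borel A ->
  smeasure_restr nu P A = nu (A `&` P).
Proof.
move=> mP mA; rewrite /smeasure_restr smeasure_ofE// => {mA A}.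
- by rewrite set0I smeasure0.
- move=> F mF tF mUF; have [_ madd _ _] := asboolW (smeasure_funP nu).
  rewrite setI_bigcupl; apply: madd.
  + by move=> n; exact: measurableI.
  + by apply/trivIsetP => i j _ _ ij; rewrite setIACA;
      move/trivIsetP : tF => /(_ i j I I ij) ->; rewrite set0I.
  + by rewrite -setI_bigcupl; exact: measurableI.
- move=> A mA e e0; have [K [U [cK oU KA AU KU]]] := @smeasure_regular _ _ nu _ mA _ e0.
  exists K, U; split => // B mB BUK; rewrite (asboolT mB) /=.
  by apply: KU; [exact: measurableI|move=> x [/BUK]].
Qed.

Lemma smeasure_jordan nu : exists P N : set Z,
  [/\ is_borel P, is_borel N, forall A, 0 <= smeasure_restr nu P A,
    forall A, smeasure_restr nu N A <= 0 &
    nu = smeasure_restr nu P + smeasure_restr nu N].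
Proof.
have [P [N [mP mN PN]]] := jordan_supports nu; exists P, N; split => //.
- move=> A; have [mA|/smeasure_nonborel->//] := pselect (is_borel A).
  by rewrite smeasure_restrE// -lee_fin -(PN _ mA).1.
- move=> A; have [mA|/smeasure_nonborel->//] := pselect (is_borel A).
  by rewrite smeasure_restrE// -oppr_ge0 -lee_fin -(PN _ mA).2.
apply: smeasure_ext => A mA; rewrite smeasureD !smeasure_restrE//.
have := jordanE nu mA; rewrite (PN _ mA).1 (PN _ mA).2 -EFinB => -[->].
by rewrite opprK.
Qed.

End restriction.

(** * Compactness of the set of probability measures *)

Lemma ultra_fmap (T U : Type) (f : T -> U) (F : set_system T) :
  UltraFilter F -> UltraFilter (f @ F).
Proof.
move=> FU; split; first exact: fmap_proper_filter.
move=> G PG FG; apply/funext => A; apply/propext; split=> [GA|/FG//].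
have [//|nA] := in_ultra_setVsetC (f @^-1` A) FU.
by have /filter_ex [? []] : G (A `&` ~` A) by apply: filterI => //; exact: FG.
Qed.

Section M1_compactness.
Context (R : realType) (Z : ptopologicalType).
Hypothesis cZ : compact [set: Z].
Hypothesis exh : forall U : set Z, open U -> exhaustible R U.

(** Along an ultrafilter of probability measures the integrals of each
    continuous function converge; their limits form a positive functional, which
    the Riesz theorem represents. *)
Lemma M1_compact : compact (M1 : set (smeasure R Z)).
Proof.
rewrite compact_ultra => F FU FM.
have /choice[L hL] (f : C0 R Z) : exists l : R, pairing f @ F --> l.
  have := @segment_compact R (- `|f|) `|f|.
  rewrite compact_ultra => /(_ _ (ultra_fmap (pairing f) FU))[].
    change (F (pairing f @^-1` `[- `|f|, `|f|])).
    apply: filterS FM => nu M1nu /=; rewrite in_itv/=.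
    have fl x : f x <= `|f| by apply: le_trans (ler_norm _) _; exact: C0_norm_ub.
    have fg x : (- f) x <= `|f|.
      by apply: le_trans (ler_norm _) _; rewrite normrN; exact: C0_norm_ub.
    have h1 : pairing f nu <= `|f| := pairing_M1_le M1nu (bounded_borel_C0 f) fl.
    have h2 : - pairing f nu <= `|f|.
      rewrite -mulN1r -(pairingZl _ _ (bounded_borel_C0 f)).
      apply: (pairing_M1_le M1nu (bounded_borel_C0 (-1 *: f))) => x.
      by apply: le_trans (fg x); rewrite [leLHS](_ : _ = -1 * f x)// mulN1r.
    by apply/andP; split; [rewrite lerNl|].
  by move=> l [_ h]; exists l.
have uniq (u : smeasure R Z -> R) (l1 l2 : R) : u @ F --> l1 -> u @ F --> l2 -> l1 = l2.
  by move=> h1 h2; apply: (cvg_unique (@Rhausdorff R) h1 h2).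
have Llin (k : R) (f g : C0 R Z) : L (k *: f + g) = k * L f + L g.
  apply: (uniq _ _ _ (hL _)).
  rewrite (_ : pairing _ = fun nu => k * pairing f nu + pairing g nu).
    by apply: (@cvgD _ R^o); [apply: cvgMr; exact: hL|exact: hL].
  by apply/funext => nu; rewrite -pairingZDl//; exact: bounded_borel_C0.
have ge_lim (f : C0 R Z) c : (forall x, c <= f x) -> c <= L f.
  move=> fc; apply: (@closed_cvg _ _ F _ (pairing f) _ (@closed_ge R c) _ _ (hL f)).
  apply: filterS FM => nu [nu0 nu1] /=; have -> : c = pairing (fun=> c) nu.
    by rewrite pairing_cst nu1 mulr1.
  by apply: le_pairing => //; [exact: bounded_borel_cst|exact: bounded_borel_C0].
have Lpos (f : C0 R Z) : (forall x, 0 <= f x) -> 0 <= L f by exact: ge_lim.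
have [nu [nu0 nuL]] := riesz_representation cZ exh Llin Lpos.
exists nu; split; last first.
  by apply/weakstar_cvgP => f; rewrite nuL; exact: hL.
split=> //; have -> : nu setT = pairing (cstC0 cZ 1) nu by rewrite pairing_cst mul1r.
rewrite nuL; apply: (uniq _ _ _ (hL _)); apply: cvg_near_cst.
by apply: filterS FM => m [_ m1]; rewrite pairing_cst m1 mulr1.
Qed.

End M1_compactness.

(** * Gelfand integrals *)

Section gelfand.
Context (R : realType) (Y Z : ptopologicalType).
Hypothesis cY : compact [set: Y].
Hypothesis cZ : compact [set: Z].
Hypothesis exh : forall U : set Z, open U -> exhaustible R U.
Variable Psi : Y -> smeasure R Z.
Hypothesis cPsi : continuous Psi.
Hypothesis Psi1 : forall y, M1 (Psi y).

Lemma pairing_Psi_continuous (f : C0 R Z) : continuous (fun y => pairing f (Psi y)).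
Proof.
by move=> y; apply: continuous_comp; [exact: cPsi|exact: pairing_continuous].
Qed.

Definition gelfand_op (f : C0 R Z) : C0 R Y := C0_of cY (@pairing_Psi_continuous f).

Lemma gelfand_op_linear (k : R) (f g : C0 R Z) :
  gelfand_op (k *: f + g) = k *: gelfand_op f + gelfand_op g.
Proof.
by apply: C0_ext => y; apply: (pairingZDl k _ (bounded_borel_C0 f) (bounded_borel_C0 g)).
Qed.

Let gelfand_nonneg (nu : smeasure R Y) : (forall A, 0 <= nu A) ->
  exists m : smeasure R Z, (forall A, 0 <= m A) /\ is_gelfand_integral Psi nu m.
Proof.
move=> nu0; pose L (f : C0 R Z) := pairing (gelfand_op f) nu.
have Llin (k : R) (f g : C0 R Z) : L (k *: f + g) = k * L f + L g.
  rewrite /L gelfand_op_linear.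
  exact: (pairingZDl k _ (bounded_borel_C0 (gelfand_op f)) (bounded_borel_C0 (gelfand_op g))).
have Lpos (f : C0 R Z) : (forall x, 0 <= f x) -> 0 <= L f.
  move=> f0; apply: pairing_ge0 => //; first exact: bounded_borel_C0.
  by move=> y /=; apply: pairing_ge0 => //; [exact: (Psi1 y).1|exact: bounded_borel_C0].
have [m [m0 mL]] := riesz_representation cZ exh Llin Lpos.
by exists m; split.
Qed.

(** Integrating [y |-> pairing f (Psi y)] against a nonnegative measure is a
    positive functional of [f]; the Jordan decomposition gives the general case. *)
Lemma gelfand_ex (nu : smeasure R Y) :
  exists m : smeasure R Z, is_gelfand_integral Psi nu m.
Proof.
have [P [N [_ _ p0 n0 ->]]] := smeasure_jordan nu.
have [m1 [_ h1]] := gelfand_nonneg p0.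
have [|m2 [_ h2]] := @gelfand_nonneg (- smeasure_restr nu N).
  by move=> A; rewrite smeasureN oppr_ge0.
exists (m1 - m2) => f.
have b := bounded_borel_C0 (gelfand_op f).
rewrite (pairingBr _ _ (bounded_borel_C0 f)) h1 h2 (pairingNr _ b) opprK.
by rewrite (pairingDr _ _ b).
Qed.

Definition gelfand (nu : smeasure R Y) : smeasure R Z := sval (cid (gelfand_ex nu)).

Lemma gelfandP (nu : smeasure R Y) : is_gelfand_integral Psi nu (gelfand nu).
Proof. exact: svalP. Qed.

Hypothesis hZ : hausdorff_space Z.

Lemma gelfand_M1 (nu : smeasure R Y) : M1 nu -> M1 (gelfand nu).
Proof.
move=> [nu0 nu1]; split.
  apply: pairing_pos_smeasure => // f f0; rewrite gelfandP; apply: pairing_ge0 => //.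
    exact: (bounded_borel_C0 (gelfand_op f)).
  by move=> y; apply: pairing_ge0 => //; [exact: (Psi1 y).1|exact: bounded_borel_C0].
have -> : gelfand nu setT = pairing (cstC0 cZ 1) (gelfand nu).
  by rewrite pairing_cst mul1r.
rewrite gelfandP (_ : (fun y => _) = fun=> 1); first by rewrite pairing_cst nu1 mulr1.
by apply/funext => y; rewrite pairing_cst (Psi1 y).2 mulr1.
Qed.

Lemma gelfand_continuous : continuous gelfand.
Proof.
apply: weakstar_continuous => f.
rewrite (_ : (fun nu => _) = pairing (gelfand_op f)).
  exact: pairing_continuous.
by apply/funext => nu; rewrite gelfandP.
Qed.

End gelfand.

(** * Topology of the one-point compactification *)

Section compactification.
Context (R : realType) (X : pmetricType R).
Local Notation Xhat := (one_point_compactification X).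
Hypothesis sepX : separable X.
Hypothesis lcX : locally_compact [set: X].

Lemma hausdorffX : hausdorff_space X.
Proof. exact: metric_hausdorff. Qed.

Lemma compact_hat : compact [set: Xhat].
Proof. exact: one_point_compactification_compact. Qed.

Lemma hausdorff_hat : hausdorff_space Xhat.
Proof. exact: (one_point_compactification_hausdorff lcX hausdorffX). Qed.

Lemma separable_basis : exists B : nat -> set X, (forall n, open (B n)) /\
  forall (U : set X) x, open U -> U x -> exists n, B n x /\ B n `<=` U.
Proof.
have [D [cD dD]] := sepX.
have [d0 Dd0] : D !=set0.
  by have [|d [_ Dd]] := dD setT _ openT; [exists (point : X)|exists d].
have [i Hi] := countable_injP _ cD.
(* position [n] of the enumeration holds the point of [D] with code [n] *)
pose e n := xget d0 [set d | D d /\ i d = n].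
have eD d : D d -> e (i d) = d.
  move=> Dd; rewrite /e; case: xgetP => [d' _ [Dd' /Hi]|/(_ d)[]//].
  by apply; rewrite inE.
pose B n := if unpickle n is Some (k, m) then
  interior (ball (e k) (m.+1%:R^-1 : R)) else set0.
exists B; split=> [n|U x oU Ux].
  by rewrite /B; case: unpickle => [[k m]|]; [exact: open_interior|exact: open0].
have : nbhs x U by exact: open_nbhs_nbhs.
rewrite -nbhs_ballE => -[r /= r0 rU].
pose m := Num.trunc (2 / r); pose q := m.+1%:R^-1 : R.
have q0 : 0 < q by rewrite invr_gt0.
have qr : q + q <= r.
  rewrite -mulr2n -mulr_natl /q ler_pdivrMr// mulrC -ler_pdivrMr// ltW//.
  exact: truncnS_gt.
have q20 : 0 < q / 2 by rewrite divr_gt0.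
have [|d [bd Dd]] := dD (interior (ball x (q / 2))) _ (@open_interior _ _).
  by exists x; exact: nbhsx_ballx.
have xd : ball x (q / 2) d by exact: interior_subset bd.
have q2q : q / 2 <= q by rewrite ler_pdivrMr// mulr_natr mulr2n lerDl ltW.
exists (pickle (i d, m)); rewrite /B pickleK eD//; split.
  have : nbhs x (ball x (q / 2)) by exact: nbhsx_ballx.
  apply: filterS => y xy; rewrite -/q (splitr q).
  by apply: ball_triangle (ball_sym xd) xy.
move=> y /interior_subset dy; apply: rU; apply: (le_ball qr).
by apply: ball_triangle dy; exact: le_ball xd.
Qed.

(** For each basic set [B n] of [X] choose, if there is one, a continuous
    function equal to 1 on [B n] and to 0 off [U]; Urysohn functions show that the
    basic sets for which there is one cover the part of [U] in [X]. A last function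
    takes care of the point at infinity. The maxima of the first functions
    exhaust [U]. *)
Lemma exhaustible_hat (U : set Xhat) : open U -> exhaustible R U.
Proof.
move=> oU; have [B [oB hB]] := separable_basis.
pose good (W : set Xhat) (u : Xhat -> R) := [/\ continuous u,
  forall x, 0 <= u x <= 1, forall x, ~ U x -> u x = 0 & forall x, W x -> u x = 1].
have good0 : good set0 (fun=> 0).
  split; [exact: cst_continuous|by move=> x; rewrite lexx ler01|by []|by []].
have urys x : U x -> exists u, good [set x] u.
  move=> Ux; have [|||u [cu u01 uU ux]] :=
      @urysohn_compact R Xhat compact_hat hausdorff_hat (~` U) [set x].
  - exact: open_closedC.
  - exact/accessible_closed_set1/hausdorff_accessible/hausdorff_hat.
  - by apply/seteqP; split => // y /= [nU yx]; apply: nU; rewrite yx.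
  by exists u; split => // y ->; exact: ux.
(* 0 if infinity is not in [U] *)
have [uoo [cuoo uoo01 uooU uoo1]] : exists u, good (U `&` [set None]) u.
  have [Uoo|nU] := pselect (U None).
    have [u [h1 h2 h3 h4]] := urys _ Uoo; exists u; split => // x [_ ->]; exact: h4.
  by exists (fun=> 0); case: good0 => h1 h2 h3 _; split => // x [Ux xoo]; rewrite xoo in Ux.
have /choice[u hu] n : exists u, good set0 u /\
    ((exists v, good (Some @` B n) v) -> good (Some @` B n) u).
  have [[v hv]|nv] := pselect (exists v, good (Some @` B n) v).
    by exists v; split => //; case: hv => h1 h2 h3 _; split.
  by exists (fun=> 0); split => // /nv.
pose g := fix g n x := if n is k.+1 then Num.max (g k x) (u k x) else uoo x.
have gm x : nondecreasing_seq (g ^~ x).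
  by apply/nondecreasing_seqP => n /=; rewrite le_max lexx.
have g01 n x : 0 <= g n x <= 1.
  elim: n => [|n IH] //=; have [[_ /(_ x)/andP[h1 h2] _ _] _] := hu n.
  by have /andP[h3 h4] := IH; rewrite le_max h1 orbT ge_max h4.
exists g; split => //.
- elim=> [|n IH] //= x; apply: continuous_max; first exact: IH.
  by have [[cu _ _ _] _] := hu n; exact: cu.
- move=> n x nU; elim: n => [|n IH] /=; first exact: uooU.
  by rewrite IH; have [[_ _ -> // _] _] := hu n; rewrite maxxx.
move=> [x|] Ux; last by exists 0%N => /=; apply: uoo1.
have [h [ch h01 hU hx]] := urys _ Ux.
have oW : open ((h \o Some) @^-1` [set t : R | 2^-1 < t]).
  apply: open_comp; last exact: open_gt.
  move=> y _; apply: continuous_comp; last exact: ch.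
  exact: one_point_compactification_some_continuous.
have [|n [Bnx BW]] := hB _ x oW; first by rewrite /= hx// invf_lt1// ltr1n.
have [_ /(_ _)[]] := hu n.
  exists (fun y => Num.min (2 * h y) 1); split.
  - move=> y; apply: (@continuous_min _ _ (fun y => 2 * h y) (fun=> 1)); last exact: cst_continuous.
    by apply: continuousM; [exact: cst_continuous|exact: ch].
  - move=> y; have /andP[h1 h2] := h01 y.
    by rewrite le_min ler01 mulr_ge0//= ge_min lexx orbT.
  - by move=> y /hU ->; rewrite mulr0 min_l.
  - move=> _ [y /BW /= hy <-]; rewrite min_r//.
    by rewrite mulrC -ler_pdivrMr// mul1r ltW.
move=> _ _ _ un1; exists n.+1 => /=; apply/eqP; rewrite eq_le.
rewrite (andP (g01 n.+1 (Some x))).2 /= le_max un1 ?lexx ?orbT//.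
Qed.

End compactification.

(** * Invariant measures *)

Section invariance.
Context (R : realType) (S : Type) (Z : ptopologicalType) (a : S -> Z -> Z).
Hypothesis hZ : hausdorff_space Z.
Hypothesis ca : forall s, continuous (a s).
Implicit Types (nu mu : smeasure R Z) (A W : set Z).

Lemma MinvP nu : Minv R a nu <->
  forall s A, is_borel A -> nu (a s @^-1` A) = nu A.
Proof.
split=> [h s A mA|h s]; first by rewrite -{2}(h s) pushforwardME.
by apply: smeasure_ext => A mA; rewrite pushforwardME// h.
Qed.

Lemma Minv_pairing nu s f : Minv R a nu -> bounded_borel f ->
  pairing (f \o a s) nu = pairing f nu.
Proof. by move=> h bf; rewrite -{2}(h s) pairing_pushforward. Qed.

Lemma MinvZD (k : R) mu nu : Minv R a mu -> Minv R a nu -> Minv R a (k *: mu + nu).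
Proof. by move=> h1 h2 s; rewrite pushforwardM_linear// h1 h2. Qed.

Lemma Minv0 : Minv R a 0.
Proof. by move=> s; apply: smeasure_ext => A mA; rewrite pushforwardME. Qed.

Lemma MinvZ (k : R) nu : Minv R a nu -> Minv R a (k *: nu).
Proof. by move=> h; rewrite -[_ *: _]addr0; apply: MinvZD => //; exact: Minv0. Qed.

Lemma MinvD mu nu : Minv R a mu -> Minv R a nu -> Minv R a (mu + nu).
Proof. by move=> h1 h2; rewrite -[mu]scale1r; exact: MinvZD. Qed.

Lemma MinvB mu nu : Minv R a mu -> Minv R a nu -> Minv R a (mu - nu).
Proof. by move=> h1 h2; rewrite -scaleN1r addrC; exact: MinvZD. Qed.

Lemma Minv_restr nu W : (forall A, 0 <= nu A) -> Minv R a nu -> is_borel W ->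
  (forall s, nu (W `+` a s @^-1` W) = 0) -> Minv R a (smeasure_restr nu W).
Proof.
move=> nu0 /MinvP inv mW Winv; apply/MinvP => s A mA.
have msA := is_borel_preimage (@ca s) mA; have msW := is_borel_preimage (@ca s) mW.
rewrite !smeasure_restrE// -(inv s (A `&` W)); last exact: measurableI.
rewrite preimage_setI.
have mWW : is_borel (W `+` a s @^-1` W).
  by apply: (@measurableU _ (borel Z)); exact: measurableD.
have msAW : is_borel (a s @^-1` A `&` W) by exact: measurableI.
have msAsW : is_borel (a s @^-1` A `&` a s @^-1` W) by exact: measurableI.
rewrite (@smeasureDI _ _ nu (_ `&` W) (a s @^-1` W))//.
rewrite [RHS](@smeasureDI _ _ nu _ W)//.
rewrite (_ : nu ((a s @^-1` A `&` W) `\` a s @^-1` W) = 0); last first.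
  apply: (smeasure_subnull nu0 mWW _ (Winv s)) => x [[_ Wx] nWx].
  by left; split.
rewrite (_ : nu ((a s @^-1` A `&` a s @^-1` W) `\` W) = 0); last first.
  apply: (smeasure_subnull nu0 mWW _ (Winv s)) => x [[_ Wx] nWx].
  by right; split.
by rewrite !addr0 -!setIA (setIC W).
Qed.

(** Under the action the positive part can only grow, and it keeps its total
    mass, so it is invariant. *)
Lemma Minv_jordan nu : Minv R a nu -> exists P N : set Z,
  [/\ is_borel P, is_borel N, forall A, 0 <= smeasure_restr nu P A,
    forall A, smeasure_restr nu N A <= 0 &
    [/\ nu = smeasure_restr nu P + smeasure_restr nu N,
      Minv R a (smeasure_restr nu P) & Minv R a (smeasure_restr nu N)]].
Proof.
move=> inv; have [P [N [mP mN p0 n0 nuE]]] := smeasure_jordan nu.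
exists P, N; split => //.
have /MinvP invA := inv.
have le_p A : nu A <= smeasure_restr nu P A.
  by rewrite [in leLHS]nuE smeasureD -lerBrDl subrr.
have incr s A : is_borel A ->
    smeasure_restr nu P A <= smeasure_restr nu P (a s @^-1` A).
  move=> mA; have msA := is_borel_preimage (@ca s) mA.
  have mAP : is_borel (A `&` P) by exact: measurableI.
  rewrite [leLHS]smeasure_restrE// -(invA s)//; apply: le_trans (le_p _) _.
  apply: le_smeasure => //; first exact: is_borel_preimage.
  by move=> x [].
have invP : Minv R a (smeasure_restr nu P).
  apply/MinvP => s A mA; have msA := is_borel_preimage (@ca s) mA.
  have mCA : is_borel (~` A) by exact: (@measurableC _ (borel Z)).
  have := incr s A mA; have := incr s (~` A) mCA.
  by rewrite preimage_setC !smeasureC//; lra.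
split => //; rewrite (_ : smeasure_restr nu N = nu - smeasure_restr nu P).
  exact: MinvB.
by rewrite {2}nuE [X in X - _]addrC addrK.
Qed.

Lemma M1inv_cond mu W : M1inv R a mu -> is_borel W ->
  (forall s, mu (W `+` a s @^-1` W) = 0) -> 0 < mu W ->
  M1inv R a ((mu W)^-1 *: smeasure_restr mu W).
Proof.
move=> [[mu0 mu1] inv] mW Winv W0; split; first split.
- move=> A; rewrite smeasureZ; have [mA|/smeasure_nonborel->] := pselect (is_borel A).
    by rewrite smeasure_restrE// mulr_ge0// invr_ge0.
  by rewrite mulr0.
- rewrite smeasureZ smeasure_restrE//; last exact: measurableT.
  by rewrite setTI mulVf// gt_eqF.
by apply: MinvZ; exact: Minv_restr.
Qed.

Definition hitting (U : set Z) : set Z := [set x | exists s, U (a s x)].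

Lemma open_hitting U : open U -> open (hitting U).
Proof.
move=> oU; rewrite (_ : hitting U = \bigcup_(s in setT) a s @^-1` U).
  by apply: bigcup_open => s _; move/continuousP: (@ca s); exact.
by apply/seteqP; split=> x [s]; [exists s|exists s].
Qed.

Hypothesis aM : forall s t, exists u, forall x, a s (a t x) = a u x.

(** The hitting set contains its preimages, which have the same measure. *)
Lemma hitting_invariant mu U : M1inv R a mu -> open U ->
  forall s, mu (hitting U `+` a s @^-1` hitting U) = 0.
Proof.
move=> [[mu0 mu1] /MinvP inv] /open_hitting oW s.
have mW := open_is_borel oW; have msW := is_borel_preimage (@ca s) mW.
have sub : a s @^-1` hitting U `<=` hitting U.
  by move=> x [t Ux]; have [u hu] := aM t s; exists u; rewrite -hu.
have := @smeasureDI _ _ mu (hitting U) (a s @^-1` hitting U) mW msW.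
rewrite (setIidr sub) inv// => e.
rewrite (_ : _ `+` _ = hitting U `\` a s @^-1` hitting U); first by lra.
by apply/seteqP; split=> x => [[//|[/sub]//]|]; left.
Qed.

End invariance.

(** * Measures on the one-point compactification *)

Section compactified_measures.
Context (R : realType) (X : pmetricType R).
Local Notation Xhat := (one_point_compactification X).
Implicit Types (mu : smeasure R Xhat) (A : set X).

(** Clustering can be tested in [X], whose neighbourhoods are neighbourhoods in
    the compactification. *)
Lemma compact_preimage_some (K : set Xhat) : compact K -> ~ K None ->
  compact (Some @^-1` K).
Proof.
move=> cK nK F PF FK; have PSF : ProperFilter (Some @ F) by exact: fmap_proper_filter.
have [[x|] [Kx clx]] := cK (Some @ F) PSF FK; last by [].
exists x; split => // A B FA nB.
have FSA : (Some @ F) (Some @` A) by apply: (@filterS _ F _ A) FA => y Ay; exists y.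
have [z [[y Ay yz] [y' By' yz']]] :=
  clx _ _ FSA (@one_point_compactification_some_nbhs _ _ _ nB).
by exists y; split => //; move: yz'; rewrite -yz => -[<-].
Qed.

Lemma is_borel_some A : is_borel A -> is_borel (Some @` A : set Xhat).
Proof.
have mT : is_borel (Some @` setT : set Xhat).
  by apply: open_is_borel; exact/one_point_compactification_open_some/openT.
suff : @measurable _ (borel X) `<=` [set A | is_borel (Some @` A : set Xhat)] by apply.
apply: smallest_sub; last first.
  by move=> U oU; apply: open_is_borel; exact: one_point_compactification_open_some.
split.
- by rewrite /= image_set0; exact: (@measurable0 _ (borel Xhat)).
- move=> B mB /=; rewrite (_ : _ @` _ = Some @` setT `\` Some @` B); last first.
    apply/seteqP; split=> [_ [y [_ nB] <-]|_ [[y _ <-] nB]].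
      by split; [exists y|case=> z Bz [yz]; apply: nB; rewrite -yz].
    by exists y => //; split => // By; apply: nB; exists y.
  exact: (@measurableD _ (borel Xhat)).
- move=> F mF /=; rewrite image_bigcup.
  by apply: (@bigcup_measurable _ (borel Xhat)) => k _; exact: mF.
Qed.

Definition comap_some mu : smeasure R X :=
  smeasure_of (fun A => (mu (Some @` A))%:E).

Lemma comap_someE mu A : is_borel A -> comap_some mu A = mu (Some @` A).
Proof.
move=> mA; rewrite /comap_some smeasure_ofE// => {mA A}.
- by rewrite image_set0 smeasure0.
- move=> F mF tF mUF; have [_ madd _ _] := asboolW (smeasure_funP mu).
  rewrite image_bigcup; apply: madd.
  + by move=> n; exact: (is_borel_some (mF n)).
  + apply/trivIsetP => i j _ _ ij; move/trivIsetP : tF => /(_ i j I I ij) tF.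
    apply/seteqP; split => // _ [[y Fy <-] [z Fz [zy]]].
    have : (F i `&` F j) y by split => //; rewrite -zy.
    by rewrite tF.
  + by rewrite -image_bigcup; exact: (is_borel_some mUF).
- move=> A mA e e0.
  have [K [U [cK oU KA AU KU]]] := @smeasure_regular _ _ mu _ (is_borel_some mA) _ e0.
  exists (Some @^-1` K), (Some @^-1` U); split.
  + by apply: compact_preimage_some => // /KA[].
  + by move/continuousP : (@one_point_compactification_some_continuous X); exact.
  + by move=> x /KA[y Ay [<-]].
  + by move=> x Ax; apply: AU; exists x.
  + move=> B mB BUK; rewrite (asboolT mB) /=; apply: KU; first exact: is_borel_some.
    by move=> _ [x /BUK[Ux nK] <-].
Qed.

Lemma is_borel_someT : is_borel (Some @` setT : set Xhat).
Proof. by apply: is_borel_some; exact: measurableT. Qed.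

Lemma setC_some : ~` (Some @` setT : set Xhat) = [set None].
Proof.
apply/seteqP; split=> [[x|//] []|_ -> [x _]//].
by exists x.
Qed.

Lemma smeasure_hatE mu D : is_borel D -> (forall C, 0 <= mu C) ->
  mu [set None] = 0 -> mu D = comap_some mu (Some @^-1` D).
Proof.
move=> mA mu0 n0; have mT := is_borel_someT.
rewrite comap_someE; last first.
  by apply: (@is_borel_preimage X Xhat Some) => //; exact: one_point_compactification_some_continuous.
rewrite (@smeasureDI _ _ mu D (Some @` setT))//.
rewrite (_ : mu (D `\` _) = 0) ?addr0; last first.
  apply: (smeasure_subnull mu0 _ _ n0); first by rewrite -setC_some; exact: (@measurableC _ (borel Xhat)).
  by rewrite -setC_some => x [].
congr (mu _); apply/seteqP; split=> [x [Ax [y _ yx]]|_ [y Ay <-]].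
  by exists y => //=; rewrite yx.
by split => //; exists y.
Qed.

Lemma dirac_uniq mu : M1 mu -> mu (Some @` setT) = 0 -> mu = smeasure_dirac infty.
Proof.
move=> [mu0 mu1] T0; apply: smeasure_ext => A mA; rewrite dirac_inftyE//.
have mT := is_borel_someT.
rewrite indicE; have [Aoo|nA] := pselect (A infty).
  rewrite mem_set//; apply/eqP; rewrite eq_le; apply/andP; split.
    by rewrite -mu1; apply: le_smeasure => //; exact: measurableT.
  have := smeasureC mu mT; rewrite T0 subr0 mu1 setC_some => <-.
  apply: le_smeasure => //; last by move=> _ ->.
  by rewrite -setC_some; exact: (@measurableC _ (borel Xhat)).
rewrite memNset//; apply: (smeasure_subnull mu0 mT _ T0) => -[x|//] _.
by exists x.
Qed.

Lemma M1_dirac_infty : M1 (smeasure_dirac infty : smeasure R Xhat).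
Proof.
split; last by rewrite dirac_inftyE ?indicE ?in_setT//; exact: measurableT.
move=> A; have [mA|/smeasure_nonborel->//] := pselect (is_borel A).
by rewrite dirac_inftyE// indicE ler0n.
Qed.

Lemma pairing_dirac_infty (f : Xhat -> R) : bounded_borel f ->
  pairing f (smeasure_dirac infty) = f infty.
Proof.
move=> bf; have [d0 d1] := M1_dirac_infty.
rewrite (@pairing_null _ _ _ f (fun=> f infty) (Some @` setT))//.
- by rewrite pairing_cst d1 mulr1.
- exact: is_borel_someT.
- rewrite dirac_inftyE ?indicE ?memNset//; first by case.
  exact: is_borel_someT.
- exact: bounded_borel_cst.
- by move=> [x|//] []; exists x.
Qed.

End compactified_measures.

(** * The ergodic map of the compactified system *)

Section ergodic_map.
Context (R : realType) (S : semigroupType) (X : pmetricType R).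
Variable a : proper_action S X.
Hypothesis sepX : separable X.
Hypothesis lcX : locally_compact [set: X].
Hypothesis cpe : continuously_pointwise_ergodic a.
Local Notation Xhat := (one_point_compactification X).
Local Notation ahat := (act_hat a).
Local Notation Phi_oo := (Phi_infty a : Xhat -> smeasure R Xhat).

Let hX : hausdorff_space X := @hausdorffX R X.
Let hXhat : hausdorff_space Xhat := hausdorff_hat lcX.
Let cSome : continuous (Some : X -> Xhat) :=
  @one_point_compactification_some_continuous X.
Let ca := @act_continuous _ _ a.
Let cahat := @act_hat_continuous _ _ _ a.

(** Otherwise orbits are empty, no point escapes to infinity, and the empty set
    carries a probability measure. *)
Lemma act_inhabited : exists s : S, True.
Proof.
apply: contrapT => nS.
have o0 x : orbit a x = set0.
  by apply/seteqP; split => // y [s _ _]; apply: nS; exists s.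
have [_ h] := cpe.1 point; case: h.
  by rewrite /escapes o0 closure0; apply; exact: compact0.
move=> mu /seteqP[_ /(_ mu erefl)] [[[_ mu1] _]].
by rewrite o0 closure0 setC0 mu1 => /eqP; rewrite oner_eq0.
Qed.

Lemma orbit_hat y : orbit ahat (Some y) = Some @` orbit a y.
Proof.
apply/seteqP; split=> [_ [s _ <-]|_ [_ [s _ <-] <-]]; last by exists s.
by exists (a s y) => //; exists s.
Qed.

Lemma orbit_hat_infty : orbit ahat None = [set None].
Proof.
have [s _] := act_inhabited.
by apply/seteqP; split=> [_ [t _ <-]//|_ ->]; exists s.
Qed.

Lemma act_hatM s t : exists u, forall x, ahat s (ahat t x) = ahat u x.
Proof. by exists (s * t)%g => -[x|] //=; rewrite act_mul. Qed.

Lemma closed_infty : closed [set None : Xhat].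
Proof. exact/accessible_closed_set1/hausdorff_accessible. Qed.

Lemma closure_hat_some y z : closure (orbit ahat (Some y)) (Some z) <->
  closure (orbit a y) z.
Proof.
split=> h.
  move=> B nB.
  have [w []] := h _ (@one_point_compactification_some_nbhs _ _ _ nB).
  rewrite orbit_hat => -[t ot <-] [u Bu [ut]].
  by exists t; split=> //; rewrite -ut.
move=> B /cSome nB; have [t [ot Bt]] := h _ nB; exists (Some t); split => //.
by rewrite orbit_hat; exists t.
Qed.

Lemma comap_some_inv (mu : smeasure R Xhat) : Minv R ahat mu ->
  Minv R a (comap_some mu).
Proof.
move=> /(MinvP hXhat cahat) inv; apply/(MinvP hX ca) => s A mA.
have msA := is_borel_preimage (@ca s) mA.
rewrite !comap_someE// -(inv s (Some @` A)); last exact: is_borel_some.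
congr (mu _); apply/seteqP; split=> [_ [x Ax <-]|[x|] [y Ay]//].
  by exists (a s x).
by move=> [yx]; exists x => //; rewrite /= -yx.
Qed.

(** The step that brings pointwise unique ergodicity on [X] to bear on measures
    on the compactification. *)
Lemma comap_some_M1inv_on (mu : smeasure R Xhat) y :
  M1inv_on R ahat (closure (orbit ahat (Some y))) mu ->
  0 < mu (Some @` setT) ->
  M1inv_on R a (closure (orbit a y))
    ((mu (Some @` setT))^-1 *: comap_some mu).
Proof.
move=> [[[mu0 mu1] inv] muC] p0; split; first split.
- split=> [A|].
    rewrite smeasureZ mulr_ge0// ?invr_ge0//.
    by have [mA|/smeasure_nonborel->//] := pselect (is_borel A); rewrite comap_someE.
  rewrite smeasureZ comap_someE ?mulVf ?gt_eqF//; exact: measurableT.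
- by apply: MinvZ => //; exact: comap_some_inv.
have mC : is_borel (~` closure (orbit a y)).
  exact: borel_setC_closure.
rewrite smeasureZ comap_someE// (_ : mu (Some @` (~` closure (orbit a y))) = 0) ?mulr0//.
apply: (smeasure_subnull mu0 _ _ muC); first exact: borel_setC_closure.
by move=> _ [z nz <-] /closure_hat_some.
Qed.

Lemma Phi_nonescaping y : ~ escapes a y ->
  M1inv_on R a (closure (orbit a y)) = [set Phi a y].
Proof.
move=> ny; rewrite /Phi (asboolF ny).
by have [mu hmu] := (cpe.1 y).2 ny; rewrite hmu; congr [set _]; case: xgetP => [m _ ->|/(_ mu) []].
Qed.

Lemma Phi_inftyE y : ~ escapes a y -> Phi_oo (Some y) = pushforwardM (Some : X -> Xhat) (Phi a y).
Proof. by move=> ny; rewrite /= asboolF. Qed.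

Lemma Phi_infty_escaping y : escapes a y -> Phi_oo (Some y) = smeasure_dirac infty.
Proof. by move=> ey; rewrite /= asboolT. Qed.

Lemma M1inv_dirac_infty : M1inv R ahat (smeasure_dirac infty).
Proof. by have [] := E1_dirac_infty a. Qed.

Lemma closure_infty_escaping y : escapes a y ->
  closure (orbit ahat (Some y)) None.
Proof.
move=> ey; apply: contrapT => /existsNP[B /not_implyP[nB /set0P/negP/negPn/eqP oB]].
have [C [cC clC] CB] := nB; apply: ey.
apply: (subclosed_compact _ cC); first exact: closed_closure.
rewrite (closure_id C).1//; apply: closureS => z oz; apply: contrapT => nC.
suff : (orbit ahat (Some y) `&` B) (Some z) by rewrite oB.
by split; [rewrite orbit_hat; exists z|apply: CB; left; exists z].
Qed.

Lemma closure_hat_nonescaping y : ~ escapes a y ->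
  closure (orbit ahat (Some y)) `<=` Some @` setT.
Proof.
move=> /contrapT cC.
have cl : closed (Some @` closure (orbit a y) : set Xhat).
  apply: compact_closed => //; apply: continuous_compact => //.
  exact: continuous_subspaceT.
apply: (@subset_trans _ (Some @` closure (orbit a y))); last by move=> _ [z _ <-]; exists z.
rewrite ((closure_id _).1 cl); apply: (@closureS Xhat) => _ [s _ <-].
by exists (a s y) => //; apply: subset_closure; exists s.
Qed.

(** The part in [X] of an invariant probability measure on the closure of an
    orbit, if nonzero, rescales to one on the closure of the orbit in [X], where
    pointwise unique ergodicity applies. If it is zero, the measure is the Dirac
    mass at infinity, and the orbit escapes. *)
Lemma M1inv_on_hat x : M1inv_on R ahat (closure (orbit ahat x)) = [set Phi_oo x].
Proof.
have mT := @is_borel_someT R X.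
apply/seteqP; split=> [mu [[M1mu inv] muC]|_ ->]; last first.
  case: x => [y|].
    have [ey|ny] := pselect (escapes a y).
      rewrite Phi_infty_escaping//; split; first exact: M1inv_dirac_infty.
      rewrite dirac_inftyE; last exact: borel_setC_closure.
      rewrite indicE memNset//; apply; exact: closure_infty_escaping.
    rewrite Phi_inftyE//.
    have [[M1P invP] PC] : M1inv_on R a (closure (orbit a y)) (Phi a y).
      by rewrite Phi_nonescaping.
    split; first split.
    - exact: pushforwardM_M1.
    - move=> s; have cs := @cahat s; rewrite pushforwardM_comp//.
      rewrite -{2}(invP s) pushforwardM_comp//; exact: ca.
    - rewrite pushforwardME//; last exact: borel_setC_closure.
      apply: (smeasure_subnull M1P.1 _ _ PC).
        exact: borel_setC_closure.
      by move=> z /= nz /closure_hat_some.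
  split; first exact: M1inv_dirac_infty.
  rewrite orbit_hat_infty dirac_inftyE; last exact: borel_setC_closure.
  rewrite indicE memNset//; apply.
  exact: subset_closure.
have [mu0 mu1] := M1mu.
case: x muC => [y|] muC; last first.
  apply: dirac_uniq => //; apply: (smeasure_subnull mu0 _ _ muC).
    exact: borel_setC_closure.
  by rewrite orbit_hat_infty -((closure_id _).1 closed_infty) => _ [z _ <-].
have h := comap_some_M1inv_on (conj (conj M1mu inv) muC).
have [p0|p0] := ltP 0 (mu (Some @` setT)); last first.
  have e : mu (Some @` setT) = 0 by apply/eqP; rewrite eq_le p0 mu0.
  have [ey|ny] := pselect (escapes a y).
    by rewrite Phi_infty_escaping//; exact: dirac_uniq.
  have := smeasureC mu mT; rewrite e subr0 mu1.
  have -> : mu (~` (Some @` setT)) = 0.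
    apply: (smeasure_subnull mu0 _ _ muC); first exact: borel_setC_closure.
    by move=> x nx xC; apply: nx; exact: closure_hat_nonescaping xC.
  by move=> /eqP; rewrite eq_sym oner_eq0.
have {}h := h p0; have [ey|ny] := pselect (escapes a y).
  by have := (cpe.1 y).1 ey; rewrite -subset0 => /(_ _ h).
(* here the closure of the orbit lies in [X], so nothing needs rescaling *)
have Tc1 : mu (~` (Some @` setT)) = 0.
  apply: (smeasure_subnull mu0 _ _ muC); first exact: borel_setC_closure.
  by move=> x nx xC; apply: nx; exact: closure_hat_nonescaping xC.
have T1 : mu (Some @` setT) = 1.
  by move: Tc1; rewrite (smeasureC _ mT) mu1 => /eqP; rewrite subr_eq0 => /eqP <-.
move: h; rewrite T1 invr1 scale1r Phi_nonescaping// => h.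
apply: smeasure_ext => A mA; rewrite Phi_inftyE// -h pushforwardME//.
by apply: smeasure_hatE => //; rewrite -setC_some.
Qed.

Lemma Phi_infty_M1inv x : M1inv R ahat (Phi_oo x).
Proof.
by have [] : M1inv_on R ahat (closure (orbit ahat x)) (Phi_oo x) by rewrite M1inv_on_hat.
Qed.

(** The closure of the orbit of [s x] lies in that of the orbit of [x]. *)
Lemma Phi_infty_act s x : Phi_oo (ahat s x) = Phi_oo x.
Proof.
have : M1inv_on R ahat (closure (orbit ahat (ahat s x))) (Phi_oo (ahat s x)).
  by rewrite M1inv_on_hat.
move=> [inv null]; suff : M1inv_on R ahat (closure (orbit ahat x)) (Phi_oo (ahat s x)).
  by rewrite M1inv_on_hat.
split=> //; apply: (smeasure_subnull inv.1.1 _ _ null).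
  exact: borel_setC_closure.
apply: subsetC; apply: closureS => _ [t _ <-].
by have [u hu] := act_hatM t s; rewrite hu; exists u.
Qed.

Hypothesis van : vanishes_at_infinity a.

Let f0_vanishing (f : C0 R Xhat) : (fun y : X => f (Some y) - f None) \in @vanishing R X.
Proof.
have cf : continuous (fun x : Xhat => f x - f None : R).
  have cf0 := @C0_continuous R Xhat f.
  by move=> x; apply: (@continuousB R R^o Xhat f (fun=> f None)); [exact: cf0|exact: cst_continuous].
apply/asboolP; split.
  by move=> y; apply: (@continuous_comp _ _ _ (Some : X -> Xhat) (fun x : Xhat => f x - f None : R)); [exact: cSome|exact: cf].
move=> e e0; apply: (@compact_preimage_some _ _ [set x : Xhat | e <= `|f x - f None|]).
  apply: (subclosed_compact _ (@compact_hat R X)) => //.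
  apply: (@preimage_closed _ _ (fun x : Xhat => `|f x - f None|) [set t : R | e <= t]).
    by move=> x _; apply: (@continuous_comp _ _ _ (fun x : Xhat => f x - f None : R) (fun t : R => `|t|)); [exact: cf|exact: norm_continuous].
  exact: closed_ge.
by rewrite /= subrr normr0 leNgt e0.
Qed.

(** Write [f] as its value at infinity plus a function vanishing at infinity.
    The second part is integrated by [Phi] to a function on [X] that is continuous
    and vanishes at infinity, so that it extends by 0. *)
Lemma Phi_infty_continuous : continuous Phi_oo.
Proof.
apply: weakstar_continuous => f.
pose f0 : C0 R X := MkC0 (f0_vanishing f).
have /asboolP[cg vg] := van f0.
set g := (fun x => pairing f0 (Phi a x)) in cg vg.
have val y : pairing f (Phi_oo (Some y)) = f None + g y.
  have [ey|ny] := pselect (escapes a y).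
    rewrite Phi_infty_escaping// pairing_dirac_infty; last exact: bounded_borel_C0.
    by rewrite /g /Phi asboolT// pairing0r ?addr0//; exact: bounded_borel_C0.
  rewrite Phi_inftyE// pairing_pushforward//; last exact: bounded_borel_C0.
  have [[[_ P1] _] _] : M1inv_on R a (closure (orbit a y)) (Phi a y).
    by rewrite Phi_nonescaping.
  rewrite (_ : f \o Some = fun x => f0 x + f None); last first.
    by apply/funext => x /=; rewrite subrK.
  rewrite pairingDl; [|exact: bounded_borel_C0|exact: bounded_borel_cst].
  by rewrite pairing_cst P1 mulr1 addrC.
have valoo : pairing f (Phi_oo None) = f None.
  by rewrite pairing_dirac_infty//; exact: bounded_borel_C0.
move=> [y|].
  have cgc : continuous (fun y => f None + g y : R).
    by move=> z; apply: (@continuousD R R^o X (fun=> f None) g); [exact: cst_continuous|exact: cg].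
  move=> B; rewrite val => /(cgc y B).
  change (nbhs y ((fun z => f None + g z) @^-1` B) ->
          nbhs y (fun z => B (pairing f (Phi_oo (Some z))))).
  by apply: filterS => z /=; rewrite -val.
move=> B; rewrite valoo -nbhs_ballE => -[e /= e0 eB].
have cK := vg e e0; have clK := compact_closed hX cK.
exists [set x | e <= `|g x|]; first by split.
move=> _ [[y /= /negP ge <-]|->] /=; apply: eB; last by rewrite valoo; exact: ballxx.
by rewrite /ball /= val opprD addrA subrr sub0r normrN ltNge.
Qed.

End ergodic_map.

(** * Lexicographic minimisation on a compact set *)

Section lexicographic_minimum.
Context (R : realType) (T : topologicalType).

Lemma nested_compact (K : set T) (G : nat -> set T) : compact K ->
  (forall n, closed (G n)) -> (forall n, G n `<=` K) ->
  (forall n, G n !=set0) -> (forall n, G n.+1 `<=` G n) ->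
  exists x, forall n, G n x.
Proof.
move=> cK clG GK G0 Gd.
have Gm m n : (m <= n)%N -> G n `<=` G m.
  elim: n => [|n IH]; first by rewrite leqn0 => /eqP ->.
  by rewrite leq_eqVlt => /orP[/eqP ->//|/IH h]; apply: subset_trans h; exact: Gd.
have PF : ProperFilter (filter_from setT G).
  apply: filter_from_proper; last by move=> n _; exact: G0.
  apply: filter_from_filter; first by exists 0%N.
  move=> i j _ _; exists (maxn i j) => // x Gx.
  by split; [apply: (Gm i (maxn i j)) => //; rewrite leq_maxl
            |apply: (Gm j (maxn i j)) => //; rewrite leq_maxr].
have [|x [_ clx]] := cK _ PF; first by exists 0%N.
exists x => n; rewrite ((closure_id _).1 (clG n)) => B nB.
by apply: clx => //; exists n.
Qed.

Variables (K : set T) (J : nat -> T -> R).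
Hypothesis cK : compact K.
Hypothesis clK : closed K.
Hypothesis K0 : K !=set0.
Hypothesis lscJ : forall k c, closed [set m | K m /\ J k m <= c].
Hypothesis lbJ : forall k, exists b, forall m, K m -> b <= J k m.

Let F := fix F k : set T :=
  if k is j.+1 then [set m | F j m /\ J j m <= inf (J j @` F j)] else K.

Let FK k : F k `<=` K.
Proof. by elim: k => [|k IH] //= m [/IH]. Qed.

Let Flb k j : has_lbound (J k @` F j).
Proof. by have [b hb] := lbJ k; exists b => _ [m /FK /hb ? <-]. Qed.

Let closed_sub k c : closed (F k) -> closed [set m | F k m /\ J k m <= c].
Proof.
move=> clF; rewrite (_ : [set m | _] = F k `&` [set m | K m /\ J k m <= c]).
  exact: closedI.
by apply/seteqP; split=> m /= [Fm h]; [split=> //; split=> //; exact: (FK Fm)|case: h].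
Qed.

Let F_good k : closed (F k) /\ F k !=set0.
Proof.
elim: k => [//|k [clF F0]]; split; first exact: closed_sub.
pose G n := [set m | F k m /\ J k m <= inf (J k @` F k) + n.+1%:R^-1].
have [||||m Gm] := @nested_compact K G cK.
- by move=> n; exact: closed_sub.
- by move=> n m [/FK].
- move=> n; have hi : has_inf (J k @` F k).
    by split; [case: F0 => m Fm; exists (J k m), m|exact: Flb].
  have n0 : (0 : R) < n.+1%:R^-1 by rewrite invr_gt0.
  by have [_ [m Fm <-] /ltW ?] := inf_adherent n0 hi; exists m.
- move=> n m [Fm h]; split => //; apply: le_trans h _; rewrite lerD2l.
  by rewrite lef_pV2 ?posrE// ler_nat.
exists m; split; first by have [] := Gm 0%N.
apply/ler_addgt0Pr => e e0; pose N := Num.trunc e^-1.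
have [_ h] := Gm N; apply: le_trans h _; rewrite lerD2l.
rewrite -[leRHS]invrK lef_pV2 ?posrE ?invr_gt0//.
by apply/ltW/truncnS_gt.
Qed.

(** Each function is minimised over the minimisers of the previous ones; these
    form a decreasing sequence of nonempty closed sets. Used in place of the
    existence of extreme points. *)
Lemma lexicographic_min : exists m, K m /\ forall k m', K m' ->
  (forall j, (j < k)%N -> J j m' <= J j m) -> J k m <= J k m'.
Proof.
have [||||m Fm] := @nested_compact K F cK.
- by move=> k; exact: (F_good k).1.
- exact: FK.
- by move=> k; exact: (F_good k).2.
- by move=> k m [].
exists m; split; first exact: (Fm 0%N).
move=> k m' Km' h; have Fm' : F k m'.
  elim: k h => [//|k IH] h; split; first by apply: IH => j jk; apply: h; rewrite ltnS ltnW.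
  by apply: le_trans (h k _) _ => //; have [] := Fm k.+1.
have [_ /le_trans] := Fm k.+1; apply; apply: inf_lbound; first exact: Flb.
by exists m'.
Qed.

End lexicographic_minimum.

(** * Ergodic measures are the values of the ergodic map *)

Section ergodic_measures.
Context (R : realType) (S : semigroupType) (X : pmetricType R).
Variable a : proper_action S X.
Hypothesis sepX : separable X.
Hypothesis lcX : locally_compact [set: X].
Hypothesis cpe : continuously_pointwise_ergodic a.
Local Notation Xhat := (one_point_compactification X).
Local Notation ahat := (act_hat a).
Local Notation Phi_oo := (Phi_infty a : Xhat -> smeasure R Xhat).

Let hXhat : hausdorff_space Xhat := hausdorff_hat lcX.
Let cXhat : compact [set: Xhat] := @compact_hat R X.
Let cahat := @act_hat_continuous _ _ _ a.
Let aM := @act_hatM R S X a.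
Let hM : hausdorff_space (smeasure R Xhat) := weakstar_hausdorff cXhat hXhat.

Let hit01 (mu : smeasure R Xhat) (U : set Xhat) : Prop :=
  mu (hitting ahat U) = 0 \/ mu (hitting ahat U) = 1.

Let mhit (U : set Xhat) : open U -> is_borel (hitting ahat U).
Proof. by move=> oU; apply: open_is_borel; exact: open_hitting. Qed.

Lemma null_hitting (mu : smeasure R Xhat) (U : set Xhat) : M1inv R ahat mu ->
  open U -> mu (hitting ahat U) = 0 -> mu U = 0.
Proof.
move=> [[mu0 _] /(MinvP hXhat cahat) inv] oU h0.
have [s _] := act_inhabited cpe; rewrite -(inv s U); last exact: open_is_borel.
by apply: (smeasure_subnull mu0 (mhit oU) _ h0) => x Ux; exists s.
Qed.

Let someT : open (Some @` setT : set Xhat).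
Proof. exact/one_point_compactification_open_some/openT. Qed.

Let openB (B : set X) : open B -> open (Some @` B : set Xhat).
Proof. exact: one_point_compactification_open_some. Qed.

(** Almost every orbit enters every basic open set of positive measure, so the
    closure of some orbit carries the measure. *)
Lemma dense_orbit (B : nat -> set X) (mu : smeasure R Xhat) :
  (forall n, open (B n)) ->
  (forall (U : set X) x, open U -> U x -> exists n, B n x /\ B n `<=` U) ->
  M1inv R ahat mu -> hit01 mu (Some @` setT) ->
  (forall n, hit01 mu (Some @` B n)) -> exists x, mu = Phi_oo x.
Proof.
move=> oB hB muinv hT hBn; have [[mu0 mu1] inv] := muinv.
case: hT => [/(null_hitting muinv someT) T0|T1].
  by exists None; exact: dirac_uniq.
have mT : is_borel (Some @` setT : set Xhat) by exact: open_is_borel.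
have T1' : mu (Some @` setT) = 1.
  apply/eqP; rewrite eq_le; apply/andP; split.
    by rewrite -mu1; apply: le_smeasure => //; exact: measurableT.
  rewrite -T1; apply: le_smeasure => //; first exact: mhit.
  by move=> [x|] [s]; [exists x|case].
have oo0 : mu [set None] = 0 by rewrite -setC_some (smeasureC _ mT) T1' mu1 subrr.
(* [G n] is null: it is the set of points whose orbit misses the [n]-th basic set
   if almost every orbit meets it, and this basic set itself otherwise. *)
pose G n : set Xhat := if `[< mu (hitting ahat (Some @` B n)) = 1 >]
  then ~` hitting ahat (Some @` B n) else Some @` B n.
pose N := \bigcup_n G n `|` [set None].
have mG n : is_borel (G n).
  rewrite /G; case: ifP => _; last by apply: open_is_borel; exact: openB.
  by apply: (@measurableC _ (borel Xhat)); apply: mhit; exact: openB.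
have G0 n : mu (G n) = 0.
  rewrite /G; case: ifPn => [/asboolP h|/asboolPn h].
    by rewrite smeasureC ?mu1 ?h ?subrr//; apply: mhit; exact: openB.
  apply: null_hitting => //; first exact: openB.
  by case: (hBn n).
have moo : is_borel [set None : Xhat].
  by rewrite -setC_some; exact: (@measurableC _ (borel Xhat)).
have mUG : is_borel (\bigcup_n G n).
  by apply: (@bigcup_measurable _ (borel Xhat)) => n _; exact: mG.
have mN : is_borel N by exact: (@measurableU _ (borel Xhat)).
have N0 : mu N = 0.
  have -> : N = (\bigcup_n G n) `|` ([set None] `\` (\bigcup_n G n)).
    by rewrite /N setUDr setDv setD0.
  rewrite smeasureU//; first last.
  - by rewrite setIDA setIC -setIDA setDv setI0.
  - exact: (@measurableD _ (borel Xhat)).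
  rewrite smeasure_bigcup_null// add0r.
  by apply: (smeasure_subnull mu0 moo _ oo0); exact: subDsetl.
have [x nNx] : exists x, ~ N x.
  apply: contrapT => h; have : mu N = mu setT.
    congr (mu _); apply/seteqP; split => // x _; apply: contrapT => nx; apply: h.
    by exists x.
  by rewrite N0 mu1 => /eqP; rewrite eq_sym oner_eq0.
exists x; suff : M1inv_on R ahat (closure (orbit ahat x)) mu.
  by rewrite (M1inv_on_hat lcX cpe).
split=> //; apply: (smeasure_subnull mu0 mN _ N0) => -[z|_]; last by right.
move=> ncl; left; apply: contrapT => nG; apply: ncl => V nV.
have [W [oW Wz] WV] : exists2 W, open W /\ W z & W `<=` Some @^-1` V.
  have : nbhs z (Some @^-1` V) by exact: one_point_compactification_some_continuous.
  by rewrite nbhsE => -[W [oW Wz] WV]; exists W.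
have [n [Bz BW]] := hB W z oW Wz.
have [h|h] := pselect (mu (hitting ahat (Some @` B n)) = 1); last first.
  by exfalso; apply: nG; exists n => //; rewrite /G asboolF//; exists z.
have : hitting ahat (Some @` B n) x.
  apply: contrapT => nh; apply: nNx; left; exists n => //.
  by rewrite /G asboolT.
move=> [s [w Bw e]]; exists (Some w); split; first by exists s.
by apply: WV; exact: BW.
Qed.

Lemma ergodic_hit01 (mu : smeasure R Xhat) (U : set Xhat) : E1 R ahat mu ->
  open U -> hit01 mu U.
Proof.
move=> [inv erg] oU; apply: erg; first exact: mhit.
by apply: hitting_invariant.
Qed.

Lemma ergodic_Phi (mu : smeasure R Xhat) : E1 R ahat mu -> exists x, mu = Phi_oo x.
Proof.
move=> erg; have [B [oB hB]] := separable_basis sepX.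
apply: (dense_orbit oB hB); first by case: erg.
  exact: ergodic_hit01.
by move=> n; apply: ergodic_hit01 => //; exact: openB.
Qed.

(** The components of a decomposition are carried by the same orbit closure,
    where the invariant probability measure is unique. *)
Lemma Phi_extreme x : extreme_points (M1inv R ahat) (Phi_oo x).
Proof.
split; first exact: Phi_infty_M1inv.
move=> m1 m2 t K1 K2 t0 t1 e.
have [_ null] : M1inv_on R ahat (closure (orbit ahat x)) (Phi_oo x).
  by rewrite (M1inv_on_hat lcX cpe).
have p1 : 0 <= t * m1 (~` closure (orbit ahat x)) by rewrite mulr_ge0 ?K1.1.1 ?ltW.
have p2 : 0 <= (1 - t) * m2 (~` closure (orbit ahat x)).
  by rewrite mulr_ge0 ?K2.1.1 ?subr_ge0 ?ltW.
move: null; rewrite {1}e smeasureD !smeasureZ => null.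
have z1 : t * m1 (~` closure (orbit ahat x)) = 0 by lra.
have z2 : (1 - t) * m2 (~` closure (orbit ahat x)) = 0 by lra.
have h m : M1inv R ahat m -> m (~` closure (orbit ahat x)) = 0 -> m = Phi_oo x.
  move=> Km m0; have : M1inv_on R ahat (closure (orbit ahat x)) m by [].
  by rewrite (M1inv_on_hat lcX cpe).
split; apply: h => //.
- by move/eqP : z1; rewrite mulf_eq0 gt_eqF//= => /eqP.
- by move/eqP : z2; rewrite mulf_eq0 gt_eqF ?subr_gt0//= => /eqP.
Qed.

(** The two pieces are the normalised restrictions to the set and to its
    complement. *)
Lemma M1inv_split (mu : smeasure R Xhat) (A : set Xhat) : M1inv R ahat mu ->
  is_borel A -> (forall s, mu (A `+` ahat s @^-1` A) = 0) ->
  mu A <> 0 -> mu A <> 1 -> exists m1 m2, [/\ M1inv R ahat m1,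
    M1inv R ahat m2, 0 < mu A < 1, m1 A = 1 &
    mu = mu A *: m1 + (1 - mu A) *: m2].
Proof.
move=> muinv mA Ainv A0 A1; have [[mu0 mu1] inv] := muinv.
have mCA : is_borel (~` A) by exact: (@measurableC _ (borel Xhat)).
have pA : 0 < mu A by rewrite lt_neqAle mu0 andbT eq_sym; apply/eqP.
have pA1 : mu A < 1.
  by rewrite lt_neqAle -{2}mu1 le_smeasure ?andbT//; [apply/eqP|exact: measurableT].
have CA : mu (~` A) = 1 - mu A by rewrite smeasureC// mu1.
have pCA : 0 < mu (~` A) by rewrite CA subr_gt0.
have CAinv s : mu (~` A `+` ahat s @^-1` (~` A)) = 0.
  rewrite -(Ainv s); congr (mu _); rewrite preimage_setC.
  by apply/seteqP; split=> x [[h1 h2]|[h1 h2]];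
    [right|left|right|left]; split => //; exact: contrapT.
exists ((mu A)^-1 *: smeasure_restr mu A), ((mu (~` A))^-1 *: smeasure_restr mu (~` A)).
split.
- exact: M1inv_cond.
- exact: M1inv_cond.
- by rewrite pA pA1.
- by rewrite smeasureZ smeasure_restrE// setIid mulVf// gt_eqF.
rewrite -CA !scalerA !divff ?gt_eqF// !scale1r.
apply: smeasure_ext => B mB; rewrite smeasureD !smeasure_restrE// -setDE.
exact: smeasureDI.
Qed.

Lemma extreme_ergodic (mu : smeasure R Xhat) :
  extreme_points (M1inv R ahat) mu -> E1 R ahat mu.
Proof.
move=> [muinv ext]; split => // A mA Ainv; apply: contrapT => /not_orP[A0 A1].
have [m1 [m2 [K1 K2 /andP[p0 p1] m1A e]]] := M1inv_split muinv mA Ainv A0 A1.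
by have [m1mu _] := ext _ _ _ K1 K2 p0 p1 e; apply: A1; rewrite -m1mu.
Qed.

Lemma ergodicE : E1 R ahat = range Phi_oo.
Proof.
apply/seteqP; split=> [mu /ergodic_Phi[x ->]|_ [x _ <-]]; first by exists x.
by apply: extreme_ergodic; exact: Phi_extreme.
Qed.

Lemma extremeE : extreme_points (M1inv R ahat) = E1 R ahat.
Proof.
apply/seteqP; split=> [mu|mu /ergodic_Phi[x ->]]; first exact: extreme_ergodic.
exact: Phi_extreme.
Qed.

(** A continuous invariant function is constant on orbit closures. *)
Lemma pairing_Fix (g : C0 R Xhat) x : (forall s y, g (ahat s y) = g y) ->
  pairing g (Phi_oo x) = g x.
Proof.
move=> ginv; have [[[P0 P1] _] null] :
    M1inv_on R ahat (closure (orbit ahat x)) (Phi_oo x).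
  by rewrite (M1inv_on_hat lcX cpe).
rewrite (@pairing_null _ _ _ g (fun=> g x) (~` closure (orbit ahat x)))//.
- by rewrite pairing_cst P1 mulr1.
- exact: borel_setC_closure.
- exact: bounded_borel_C0.
- exact: bounded_borel_cst.
move=> y /contrapT ycl.
have cl : closed (g @^-1` [set g x]).
  apply: (@preimage_closed _ _ (g : Xhat -> R) [set g x]); last exact: closed_eq.
  by move=> z _; exact: C0_continuous.
have := closureS _ ycl; move=> /(_ (g @^-1` [set g x])).
rewrite -((closure_id _).1 cl); apply => _ [s _ <-].
exact: ginv.
Qed.

End ergodic_measures.

(** * Lower semicontinuity on open sets *)

Section lower_semicontinuity.
Context (R : realType) (Z : ptopologicalType).
Hypothesis cZ : compact [set: Z].

(** The exhausting functions lie below the indicator of [U], and [U] is the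
    increasing union of the closed sets where they reach 1. This makes
    [m |-> m U] weak* lower semicontinuous. *)
Lemma exhaustible_measure_le (U : set Z) (m : smeasure R Z) c :
  is_borel U -> (forall A, 0 <= m A) ->
  forall g : nat -> Z -> R, (forall n, continuous (g n)) ->
  (forall n x, 0 <= g n x <= 1) -> (forall x, nondecreasing_seq (g ^~ x)) ->
  (forall n x, ~ U x -> g n x = 0) -> (forall x, U x -> exists n, g n x = 1) ->
  m U <= c <-> forall n, pairing (g n) m <= c.
Proof.
move=> mU m0 g cg g01 gm gU0 gU1.
have bU := bounded_borel_indic R mU.
have bg n : bounded_borel (g n) by exact: bounded_borel_continuous.
split=> [h n|h].
  apply: le_trans h; rewrite -pairing_indic//; apply: le_pairing => // x.
  rewrite indicE; have [Ux|nUx] := pselect (U x).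
    by rewrite mem_set//; have /andP[] := g01 n x.
  by rewrite memNset// gU0.
pose F n := g n @^-1` [set 1].
have clF n : closed (F n).
  by apply: preimage_closed; [move=> x _; exact: cg|exact: closed_eq].
have mF n : is_borel (F n) by exact: closed_is_borel.
have FU : U = \bigcup_n F n.
  apply/seteqP; split=> x; first by move=> /gU1[n gn]; exists n.
  move=> [n _ gn]; apply: contrapT => /(gU0 n) g0.
  by move: gn; rewrite /F /= g0 => /eqP; rewrite eq_sym oner_eq0.
have FS : nondecreasing_seq F.
  apply/nondecreasing_seqP => n; apply/subsetPset => x /= gn; rewrite /F /=.
  apply/eqP; rewrite eq_le (andP (g01 _ _)).2 /= -gn.
  by apply: gm.
have mUF : measurable (\bigcup_n F n : set (borel Z)) by rewrite -FU.
have := @nondecreasing_cvg_mu _ (borel Z) R (pos_part m) F mF mUF FS.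
rewrite -FU => /cvg_lim cv; have e := (nonneg_parts m0 mU).1.
rewrite -lee_fin -e -cv//.
apply: lime_le; first by apply: ereal_nondecreasing_is_cvgn => i j ij;
  apply: le_measure; rewrite ?inE; [exact: mF|exact: mF|apply/subsetPset; exact: FS].
near=> n; apply: (@le_trans _ _ (m (F n))%:E).
  by rewrite le_eqVlt; apply/orP; left; apply/eqP; exact: (nonneg_parts m0 (mF n)).1.
rewrite lee_fin; apply: le_trans (h n); rewrite -pairing_indic//.
apply: le_pairing => //; first exact: bounded_borel_indic.
move=> x; rewrite indicE; have [Fx|nFx] := pselect (F n x).
  by rewrite mem_set// Fx.
by rewrite memNset//; have /andP[] := g01 n x.
Unshelve. all: by end_near. Qed.

End lower_semicontinuity.

(** * Invariant measures are integrals of the ergodic map *)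

Section bauer.
Context (R : realType) (S : semigroupType) (X : pmetricType R).
Variable a : proper_action S X.
Hypothesis sepX : separable X.
Hypothesis lcX : locally_compact [set: X].
Hypothesis cpe : continuously_pointwise_ergodic a.
Hypothesis van : vanishes_at_infinity a.
Local Notation Xhat := (one_point_compactification X).
Local Notation ahat := (act_hat a).
Local Notation Phi_oo := (Phi_infty a : Xhat -> smeasure R Xhat).

Let hXhat : hausdorff_space Xhat := hausdorff_hat lcX.
Let cXhat : compact [set: Xhat] := @compact_hat R X.
Let cahat := @act_hat_continuous _ _ _ a.
Let aM := @act_hatM R S X a.
Let hM : hausdorff_space (smeasure R Xhat) := weakstar_hausdorff cXhat hXhat.
Let exh := @exhaustible_hat R X sepX lcX.
Let cPhi : continuous Phi_oo := Phi_infty_continuous lcX cpe van.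

Lemma Phi_M1 x : M1 (Phi_oo x).
Proof. by have [] := Phi_infty_M1inv lcX cpe x. Qed.

Definition comp_act (s : S) (f : C0 R Xhat) : C0 R Xhat :=
  @C0_of R Xhat cXhat (f \o ahat s)
    (fun x => continuous_comp (@cahat s x) (@C0_continuous R Xhat f (ahat s x))).

Lemma Minv_pairingP (nu : smeasure R Xhat) :
  Minv R ahat nu <-> forall s f, pairing (comp_act s f) nu = pairing f nu.
Proof.
split=> [inv s f|h s]; first exact: (Minv_pairing hXhat cahat s inv (bounded_borel_C0 f)).
apply: (pairing_inj cXhat hXhat) => f; rewrite pairing_pushforward//; last exact: bounded_borel_C0.
exact: h.
Qed.

Lemma closed_Minv : closed (Minv R ahat).
Proof.
rewrite (_ : Minv R ahat = \bigcap_(s in setT) \bigcap_(f in setT)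
    [set nu : smeasure R Xhat | pairing (comp_act s f - f) nu = 0]).
  by apply: closed_bigI => s _; apply: closed_bigI => f _; exact: closed_pairing_eq.
have e s f (nu : smeasure R Xhat) : pairing (comp_act s f - f) nu =
    pairing (comp_act s f) nu - pairing f nu.
  rewrite (_ : (comp_act s f - f : Xhat -> R) = fun x => -1 * f x + comp_act s f x).
    by rewrite pairingZDl; [rewrite mulN1r addrC|exact: bounded_borel_C0|exact: bounded_borel_C0].
  by apply/funext => x; rewrite mulN1r addrC.
apply/seteqP; split=> nu.
  by move=> /Minv_pairingP h s _ f _ /=; rewrite e h subrr.
move=> h; apply/Minv_pairingP => s f.
by apply/eqP; rewrite -subr_eq0 -e; apply/eqP; exact: h.
Qed.

Lemma compact_M1inv : compact (M1inv R ahat).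
Proof.
rewrite /M1inv; apply: compact_closedI; last exact: closed_Minv.
exact: (M1_compact cXhat exh).
Qed.

Lemma closed_M1inv : closed (M1inv R ahat).
Proof. by apply: compact_closed => //; exact: compact_M1inv. Qed.

(** Shown below to be the mean ergodic projection of the compactified system. *)
Definition ergodic_mean : C0 R Xhat -> C0 R Xhat := gelfand_op cXhat cPhi.

Lemma ergodic_meanE f x : ergodic_mean f x = pairing f (Phi_oo x).
Proof. by []. Qed.

Lemma ergodic_mean_inv f s x : ergodic_mean f (ahat s x) = ergodic_mean f x.
Proof. by rewrite !ergodic_meanE (Phi_infty_act lcX cpe). Qed.

Lemma pairing_P_Phi f x : pairing (ergodic_mean f) (Phi_oo x) = ergodic_mean f x.
Proof. by apply: (pairing_Fix lcX cpe) => s y; exact: ergodic_mean_inv. Qed.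

Let open_target (B : nat -> set X) (n : nat) : set Xhat :=
  if n is k.+1 then Some @` B k else Some @` setT.

(** Minimise lexicographically the integral of [P f - f] and then the measures
    of the hitting sets of a basis. Were one of the latter neither 0 nor 1, the
    measure would split into two parts that are again minimal, one of them
    giving the hitting set measure 1. So the minimiser is some [Phi_oo x], where
    the integral is 0. *)
Lemma pairing_P_le (f : C0 R Xhat) (mu : smeasure R Xhat) : M1inv R ahat mu ->
  pairing f mu <= pairing (ergodic_mean f) mu.
Proof.
have [B [oB hB]] := separable_basis sepX.
have oU n : open (open_target B n).
  by case: n => [|n]; apply: one_point_compactification_open_some => //; exact: openT.
have mhit n : is_borel (hitting ahat (open_target B n)).
  by apply: open_is_borel; exact: open_hitting.
pose h : C0 R Xhat := ergodic_mean f - f.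
have hE m : pairing h m = pairing (ergodic_mean f) m - pairing f m.
  rewrite (_ : (h : Xhat -> R) = fun x => -1 * f x + ergodic_mean f x); last first.
    by apply/funext => x; rewrite mulN1r addrC.
  by rewrite pairingZDl; [rewrite mulN1r addrC|exact: bounded_borel_C0|exact: bounded_borel_C0].
pose J k (m : smeasure R Xhat) : R :=
  if k is n.+1 then m (hitting ahat (open_target B n)) else pairing h m.
have lsc k c : closed [set m | M1inv R ahat m /\ J k m <= c].
  case: k => [|n].
    apply: (@closedI _ (M1inv R ahat) [set m | pairing h m <= c]).
      exact: closed_M1inv.
    exact: closed_pairing_le.
  have [g [cg g01 gm gU0 gU1]] := exh (open_hitting cahat (oU n)).
  rewrite (_ : [set m | _] = M1inv R ahat `&`
      \bigcap_(i in setT) [set m | pairing (C0_of cXhat (cg i)) m <= c]).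
    apply: closedI; first exact: closed_M1inv.
    by apply: closed_bigI => i _; exact: closed_pairing_le.
  apply/seteqP; split=> m [Km h1]; split => //; have [[m0 _] _] := Km.
    by move=> i _; have [h2 _] := exhaustible_measure_le cXhat c (mhit n) m0 cg g01 gm gU0 gU1; exact: h2.
  have [_] := exhaustible_measure_le cXhat c (mhit n) m0 cg g01 gm gU0 gU1.
  by apply => i; exact: h1.
have lb k : exists b, forall m, M1inv R ahat m -> b <= J k m.
  case: k => [|n]; last by exists 0 => m [[m0 _] _]; exact: m0.
  exists (- `|h|) => m [M1m _] /=; rewrite lerNl -mulN1r.
  rewrite -(pairingZl _ _ (bounded_borel_C0 h)).
  apply: (pairing_M1_le M1m (bounded_borel_C0 (-1 *: h))) => x.
  rewrite [leLHS](_ : _ = -1 * h x)// mulN1r; apply: le_trans (ler_norm _) _; rewrite normrN.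
  exact: C0_norm_ub.
move=> muinv; have [|m [Km mmin]] :=
    @lexicographic_min R _ (M1inv R ahat) J compact_M1inv closed_M1inv _ lsc lb.
  by exists mu.
have Jaff t m1 m2 k : J k (t *: m1 + (1 - t) *: m2) = t * J k m1 + (1 - t) * J k m2.
  case: k => [|n] //; have bh := bounded_borel_C0 h.
  by rewrite /J (pairingDr _ _ bh) !(pairingZr _ _ bh).
have h01 n : m (hitting ahat (open_target B n)) = 0 \/
             m (hitting ahat (open_target B n)) = 1.
  apply: contrapT => /not_orP[n0 n1].
  have hinv := hitting_invariant hXhat cahat aM Km (oU n).
  have [m1 [m2 [K1 K2 /andP[p0 p1] m1W e]]] := M1inv_split lcX Km (mhit n) hinv n0 n1.
  set t := m _ in p0 p1 e n1.
  (* [J k] is affine and [m] minimises it once the previous values agree. *)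
  have eqJ k : J k m1 = J k m /\ J k m2 = J k m.
    elim/ltn_ind: k => k IH.
    have i1 : J k m <= J k m1 by apply: mmin => // j jk; rewrite (IH j jk).1.
    have i2 : J k m <= J k m2 by apply: mmin => // j jk; rewrite (IH j jk).2.
    have e' : J k m = t * J k m1 + (1 - t) * J k m2 by rewrite {1}e Jaff.
    move: i1 i2 e'; move: (J k m) (J k m1) (J k m2) => x y z i1 i2 e'.
    by split; nra.
  by apply: n1; have [] := eqJ n.+1; rewrite /= m1W.
have [x mx] : exists x, m = Phi_oo x.
  apply: (dense_orbit lcX cpe oB hB Km); first exact: (h01 0%N).
  by move=> n; exact: (h01 n.+1).
have : J 0%N m <= J 0%N mu by apply: mmin.
by rewrite /= !hE mx pairing_P_Phi ergodic_meanE subrr subr_ge0.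
Qed.

Lemma pairing_P_M1inv (f : C0 R Xhat) (mu : smeasure R Xhat) : M1inv R ahat mu ->
  pairing (ergodic_mean f) mu = pairing f mu.
Proof.
move=> inv; apply/eqP; rewrite eq_le pairing_P_le// andbT.
have bf := bounded_borel_C0 f; have bPf := bounded_borel_C0 (ergodic_mean f).
have := @pairing_P_le (-1 *: f) mu inv.
have -> : pairing (-1 *: f) mu = - pairing f mu by rewrite -[RHS]mulN1r -(pairingZl (-1) mu bf).
have -> : pairing (ergodic_mean (-1 *: f)) mu = - pairing (ergodic_mean f) mu.
  rewrite -[RHS]mulN1r -(pairingZl (-1) mu bPf); congr pairing; apply/funext => x.
  by rewrite !ergodic_meanE; exact: (pairingZl (-1) _ bf).
by rewrite lerN2.
Qed.

(** The Jordan parts of an invariant measure are invariant. *)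
Lemma pairing_P_Minv (f : C0 R Xhat) (nu : smeasure R Xhat) : Minv R ahat nu ->
  pairing (ergodic_mean f) nu = pairing f nu.
Proof.
have bf := bounded_borel_C0 f; have bPf := bounded_borel_C0 (ergodic_mean f).
have pos (p : smeasure R Xhat) : (forall A, 0 <= p A) -> Minv R ahat p ->
    pairing (ergodic_mean f) p = pairing f p.
  move=> p0 inv; have mT : is_borel (@setT Xhat) by exact: measurableT.
  have [pT|pT] := eqVneq (p setT) 0.
    have -> : p = 0.
      apply: smeasure_ext => A mA; rewrite (smeasure_subnull p0 mT _ pT)//.
    by rewrite !pairing0r.
  have := @pairing_P_M1inv f ((p setT)^-1 *: p).
  rewrite !pairingZr// => h; apply: (mulfI (invr_neq0 pT)); apply: h.
  split; last exact: (MinvZ hXhat cahat).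
  split=> [A|]; first by rewrite smeasureZ mulr_ge0// invr_ge0.
  by rewrite smeasureZ mulVf.
move=> /(Minv_jordan hXhat cahat)[P [N [_ _ p0 n0 [e Pinv Ninv]]]].
rewrite e !pairingDr// (pos _ p0 Pinv); congr (_ + _).
have inv' : Minv R ahat (- smeasure_restr nu N).
  by rewrite -scaleN1r; exact: (MinvZ hXhat cahat).
have p0' A : 0 <= (- smeasure_restr nu N) A by rewrite smeasureN oppr_ge0.
by apply: oppr_inj; rewrite -!pairingNr//; exact: pos.
Qed.

Lemma compact_range_Phi : compact (range Phi_oo).
Proof.
by apply: continuous_compact => //; exact: continuous_subspaceT.
Qed.

(** Normalise by the total mass; for the zero measure any invariant probability
    measure serves as base point. *)
Lemma cone_M1inv (m : smeasure R Xhat) : cone (M1inv R ahat) m <->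
  (forall A, 0 <= m A) /\ Minv R ahat m.
Proof.
split=> [[t [k [t0 [[k0 _] inv] ->]]]|[m0 inv]].
  split=> [A|]; first by rewrite smeasureZ mulr_ge0.
  exact: (MinvZ hXhat cahat).
have mT : is_borel (@setT Xhat) by exact: measurableT.
have [mT0|mT0] := eqVneq (m setT) 0.
  exists 0, (smeasure_dirac infty); split => //; first exact: M1inv_dirac_infty.
  rewrite scale0r; apply: smeasure_ext => A mA.
  by rewrite (smeasure_subnull m0 mT _ mT0).
exists (m setT), ((m setT)^-1 *: m); split => //.
  split; last exact: (MinvZ hXhat cahat).
  split=> [A|]; first by rewrite smeasureZ mulr_ge0// invr_ge0.
  by rewrite smeasureZ mulVf.
by rewrite scalerA divff// scale1r.
Qed.

Lemma convex_M1inv (t : R) (m1 m2 : smeasure R Xhat) : M1inv R ahat m1 ->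
  M1inv R ahat m2 -> 0 <= t -> t <= 1 ->
  M1inv R ahat (t *: m1 + (1 - t) *: m2).
Proof.
move=> [[p1 e1] i1] [[p2 e2] i2] t0 t1; have s0 : 0 <= 1 - t by rewrite subr_ge0.
split; last by apply: (MinvZD hXhat cahat) => //; exact: (MinvZ hXhat cahat).
split=> [A|]; first by rewrite smeasureD !smeasureZ addr_ge0// mulr_ge0.
by rewrite smeasureD !smeasureZ e1 e2; lra.
Qed.

(** The least upper bound of two invariant measures adds to one of them the
    positive part of the difference. *)
Lemma bauer_M1inv : bauer_simplex R ahat.
Proof.
split; last 2 first.
- exact: (extremeE sepX lcX cpe).
- exists (range Phi_oo); first by apply: compact_closed => //; exact: compact_range_Phi.
  rewrite (ergodicE sepX lcX cpe); apply/esym/setIidr => _ [x _ <-].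
  exact: Phi_infty_M1inv.
split.
- by exists (smeasure_dirac infty); exact: M1inv_dirac_infty.
- exact: compact_M1inv.
- move=> x y l; rewrite !inE => Kx Ky.
  have := @convex_M1inv l%:num x y Kx Ky; apply; first exact: ge0.
  exact: le1.
move=> m1 m2 /cone_M1inv[p1 i1] /cone_M1inv[p2 i2].
have [P [N [mP mN pP nN [e iP iN]]]] := Minv_jordan hXhat cahat (MinvB hXhat cahat i1 i2).
set p := smeasure_restr _ P in pP e iP; set n := smeasure_restr _ N in nN e iN.
exists (m2 + p); split.
- by apply/cone_M1inv; split=> [A|]; [rewrite smeasureD addr_ge0|exact: (MinvD hXhat cahat)].
- have -> : m2 + p - m1 = - n.
    have -> : m1 = p + n + m2 by rewrite -e subrK.
    by apply: smeasure_ext => A mA; rewrite !(smeasureD, smeasureN); lra.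
  apply/cone_M1inv; split=> [A|]; first by rewrite smeasureN oppr_ge0.
  by rewrite -scaleN1r; exact: (MinvZ hXhat cahat).
- by rewrite addrAC subrr add0r; apply/cone_M1inv.
move=> m' /cone_M1inv[p' i'] /cone_M1inv[q1 j1] /cone_M1inv[q2 j2].
apply/cone_M1inv; split; last by apply: (MinvB hXhat cahat) => //; exact: (MinvD hXhat cahat).
move=> A; have [mA|/smeasure_nonborel->//] := pselect (is_borel A).
have mAP : is_borel (A `&` P) by exact: measurableI.
have := q1 (A `&` P); have := le_smeasure q2 mAP mA (@subIsetl _ _ _).
by rewrite !smeasureD !smeasureN smeasureD /p smeasure_restrE// smeasureD smeasureN; lra.
Qed.

End bauer.

(** * The Hahn-Banach theorem *)

Section hahn_banach.
Context (R : realType) (V : lmodType R).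
Implicit Types (p q : V -> R) (x y v : V).

Definition sublinear q : Prop :=
  (forall x y, q (x + y) <= q x + q y) /\
  (forall (t : R) x, 0 <= t -> q (t *: x) = t * q x).

Lemma sublinear0 q : sublinear q -> q 0 = 0.
Proof. by move=> [_ h]; rewrite -(scale0r (0 : V)) h// mul0r. Qed.

Lemma sublinearN q x : sublinear q -> - q (- x) <= q x.
Proof.
move=> sq; have := sq.1 x (- x); rewrite subrr (sublinear0 sq); lra.
Qed.

Definition shrink_set q v x := [set q (x + t *: v) - t * q v | t in [set t : R | 0 <= t]].

(** The largest sublinear function below [q] that takes at [- v] a value of at
    most [- q v]. *)
Definition shrink q v x : R := inf (shrink_set q v x).

Lemma shrink_has_inf q v x : sublinear q -> has_inf (shrink_set q v x).
Proof.
move=> sq; split; first by exists (q (x + 0 *: v) - 0 * q v), 0 => /=.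
exists (- q (- x)) => _ [t /= t0 <-].
have := sq.1 (x + t *: v) (- x); rewrite addrAC subrr add0r sq.2//; lra.
Qed.

Lemma shrink_le q v x t : sublinear q -> 0 <= t ->
  shrink q v x <= q (x + t *: v) - t * q v.
Proof.
move=> sq t0; apply: inf_lbound; first exact: (shrink_has_inf v x sq).2.
by exists t.
Qed.

Lemma shrink_sublinear q v : sublinear q -> sublinear (shrink q v).
Proof.
move=> sq; have ne x := (shrink_has_inf v x sq).1.
have sub x y : shrink q v (x + y) <= shrink q v x + shrink q v y.
  rewrite -lerBlDr; apply: lb_le_inf => // _ [t1 /= t10 <-].
  rewrite lerBlDr -lerBlDl; apply: lb_le_inf => // _ [t2 /= t20 <-].
  rewrite lerBlDl; apply: le_trans (shrink_le v (x + y) sq (addr_ge0 t10 t20)) _.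
  rewrite scalerDl addrACA; have := sq.1 (x + t1 *: v) (y + t2 *: v); lra.
have scale_le (c : R) x : 0 < c -> shrink q v (c *: x) <= c * shrink q v x.
  move=> c0; rewrite -ler_pdivrMl//; apply: lb_le_inf => // _ [t /= t0 <-].
  rewrite ler_pdivrMl//.
  have := shrink_le v (c *: x) sq (mulr_ge0 (ltW c0) t0).
  by rewrite -scalerA -scalerDr sq.2 ?(ltW c0)// -mulrA -mulrBr.
split=> // c x; rewrite le_eqVlt => /orP[/eqP <-|c0].
  rewrite scale0r mul0r; apply/eqP; rewrite eq_le; apply/andP; split.
    have := shrink_le v 0 sq (lexx 0).
    by rewrite scale0r addr0 mul0r subr0 (sublinear0 sq).
  apply: lb_le_inf => // _ [t /= t0 <-].
  by rewrite add0r sq.2// subrr.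
apply/eqP; rewrite eq_le scale_le//=.
have := @scale_le c^-1 (c *: x).
rewrite scalerA mulVf ?gt_eqF// scale1r invr_gt0 => /(_ c0).
by rewrite ler_pdivlMl.
Qed.

Lemma shrinkW q v x : sublinear q -> shrink q v x <= q x.
Proof.
by move=> sq; have := shrink_le v x sq (lexx 0); rewrite scale0r addr0 mul0r subr0.
Qed.

Lemma shrinkN q v : sublinear q -> shrink q v (- v) <= - q v.
Proof.
move=> sq; have := shrink_le v (- v) sq ler01.
by rewrite scale1r addNr (sublinear0 sq) mul1r add0r.
Qed.

(** Zorn's lemma: along a chain, pointwise infima are finite, being bounded below
    by [- p (- x)], and sublinear, the chain being directed. *)
Lemma minimal_sublinear p : sublinear p -> exists q,
  [/\ sublinear q, forall x, q x <= p x &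
   forall q', sublinear q' -> (forall x, q' x <= q x) -> q' = q].
Proof.
move=> sp; pose T := {q : V -> R | sublinear q /\ forall x, q x <= p x}.
pose rT (s t : T) := `[< forall x, sval t x <= sval s x >].
have [|||A tot|t tmin] := @Zorn T rT.
- by move=> t; apply/asboolP.
- move=> r s t /asboolP h1 /asboolP h2; apply/asboolP => x.
  exact: le_trans (h2 x) (h1 x).
- move=> [s hs] [t ht] /asboolP h1 /asboolP h2.
  have e : s = t by apply/funext => x; apply/eqP; rewrite eq_le h1 h2.
  by move: hs ht h1 h2; rewrite e => hs ht _ _; congr exist; exact: Prop_irrelevance.
- have [[s0 As0]|nA] := pselect (exists s, A s); last first.
    pose qp : T := exist (fun q => sublinear q /\ forall x, q x <= p x) p (conj sp (fun x => lexx (p x))).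
    by exists qp => s As; case: nA; exists s.
  pose I x := [set sval s x | s in A].
  have lbI x : has_lbound (I x).
    exists (- p (- x)) => _ [s As <-]; have [ss sle] := svalP s.
    by apply: le_trans (sublinearN x ss); rewrite lerN2.
  have neI x : I x !=set0 by exists (sval s0 x), s0.
  have Ile s x : A s -> inf (I x) <= sval s x.
    by move=> As; apply: inf_lbound => //; exists s.
  have sI : sublinear (fun x => inf (I x)).
    split=> [x y|c x c0].
      rewrite -lerBlDr; apply: lb_le_inf => // _ [s As <-].
      rewrite lerBlDr -lerBlDl; apply: lb_le_inf => // _ [t At <-].
      rewrite lerBlDl.
      have [/asboolP h|/asboolP h] := tot s t As At.
        apply: le_trans (Ile _ (x + y) At) _; apply: le_trans ((svalP t).1.1 x y) _.
        by rewrite lerD2r.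
      apply: le_trans (Ile _ (x + y) As) _; apply: le_trans ((svalP s).1.1 x y) _.
      by rewrite lerD2l.
    move: c0; rewrite le_eqVlt => /orP[/eqP <-|c0].
      rewrite scale0r mul0r; apply/eqP; rewrite eq_le; apply/andP; split.
        by have := Ile _ 0 As0; rewrite (sublinear0 (svalP s0).1).
      by apply: lb_le_inf => // _ [s As <-]; rewrite (sublinear0 (svalP s).1).
    apply/eqP; rewrite eq_le; apply/andP; split.
      rewrite -ler_pdivrMl//; apply: lb_le_inf => // _ [s As <-].
      by rewrite ler_pdivrMl// -(svalP s).1.2 ?(ltW c0)//; exact: Ile.
    apply: lb_le_inf => // _ [s As <-].
    by rewrite (svalP s).1.2 ?(ltW c0)// ler_pM2l//; exact: Ile.
  have Ip x : inf (I x) <= p x by apply: le_trans (Ile _ x As0) _; exact: (svalP s0).2.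
  pose qI : T := exist (fun q => sublinear q /\ forall x, q x <= p x) _ (conj sI Ip).
  by exists qI => s As; apply/asboolP => x; exact: Ile.
exists (sval t); split; [exact: (svalP t).1|exact: (svalP t).2|].
move=> q' sq' q'le.
have q'p x : q' x <= p x by apply: le_trans (q'le x) _; exact: (svalP t).2.
pose tq' : T := exist (fun q => sublinear q /\ forall x, q x <= p x) q' (conj sq' q'p).
by rewrite -(tmin tq')//; apply/asboolP.
Qed.

(** A minimal sublinear function is odd, hence linear; making [p] odd at [h]
    beforehand forces the value there. *)
Theorem hahn_banach p h : sublinear p -> exists L : V -> R,
  [/\ forall k x y, L (k *: x + y) = k * L x + L y,
      forall x, L x <= p x & L h = p h].
Proof.
move=> sp; have sph := shrink_sublinear h sp.
have [q [sq qp qmin]] := minimal_sublinear sph.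
have odd v : q (- v) = - q v.
  have e := qmin _ (shrink_sublinear v sq) (fun x => shrinkW v x sq).
  have := shrinkN v sq; rewrite e => h1.
  by apply/eqP; rewrite eq_le h1 /= lerNl sublinearN.
have add x y : q (x + y) = q x + q y.
  apply/eqP; rewrite eq_le sq.1 /=; have := sq.1 (- x) (- y).
  by rewrite -opprD !odd; lra.
have scale k x : q (k *: x) = k * q x.
  have [k0|/ltW k0] := leP 0 k; first exact: sq.2.
  by rewrite -[k in LHS]opprK scaleNr odd sq.2 ?oppr_ge0// mulNr opprK.
exists q; split=> [k x y|x|].
- by rewrite add scale.
- by apply: le_trans (qp x) _; exact: (shrinkW h x sp).
apply/eqP; rewrite eq_le; apply/andP; split.
  by apply: le_trans (qp h) _; exact: (shrinkW h h sp).
have := le_trans (qp (- h)) (shrinkN h sp).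
by rewrite odd lerN2.
Qed.

End hahn_banach.

Section spans.
Context (R : realType) (V : lmodType R).

Lemma lin_span_sub (G : set V) v : G v -> lin_span G v.
Proof.
move=> Gv; exists 1%N, (fun=> 1), (fun=> v); split=> //.
by rewrite big_ord1 scale1r.
Qed.

Lemma lin_span0 (G : set V) : lin_span G 0.
Proof.
exists 0%N, (fun i => 0), (fun i => 0); split; first by case.
by rewrite big_ord0.
Qed.

Lemma lin_spanZD (G : set V) (k : R) u v : lin_span G u -> lin_span G v ->
  lin_span G (k *: u + v).
Proof.
move=> [n [c [w [Gw ->]]]] [m [d [z [Gz ->]]]].
exists (n + m)%N, (fun i => match fintype.split i with inl j => k * c j | inr j => d j end),
  (fun i => match fintype.split i with inl j => w j | inr j => z j end); split.
  by move=> i; case: (fintype.split i).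
rewrite big_split_ord /= scaler_sumr; congr (_ + _); apply: eq_bigr => i _.
  by rewrite (unsplitK (inl i)) scalerA.
by rewrite (unsplitK (inr i)).
Qed.

Lemma lin_span_ind (G : set V) (P : V -> Prop) : P 0 ->
  (forall k u v, P u -> P v -> P (k *: u + v)) -> (forall v, G v -> P v) ->
  forall v, lin_span G v -> P v.
Proof.
move=> P0 PZD PG _ [n [c [w [Gw ->]]]].
by elim/big_rec : _ => // i x _ Px; apply: PZD => //; exact: PG.
Qed.

End spans.

(** * Closed spans and annihilating measures *)

Section annihilators.
Context (R : realType) (Z : ptopologicalType).
Hypothesis cZ : compact [set: Z].
Hypothesis exh : forall U : set Z, open U -> exhaustible R U.
Variable G : set (C0 R Z).
Implicit Types g : (C0 R Z * C0 R Z)%type.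

(* These numbers are at least half the sum of the two functions at any point. *)
Let cost (g : C0 R Z * C0 R Z) := [set r : R | exists2 w, lin_span G w &
  forall x, g.1 x + w x <= r /\ g.2 x - w x <= r].
Let p g := inf (cost g).

Let cost_lb g : has_lbound (cost g).
Proof.
exists ((g.1 point + g.2 point) / 2) => r [w _ /(_ point)[h1 h2]].
by rewrite ler_pdivrMr//; lra.
Qed.

Let cost_ne g : cost g !=set0.
Proof.
exists (Num.max `|g.1| `|g.2|), 0; first exact: lin_span0.
have fl (f : C0 R Z) x : f x <= `|f|.
  by apply: le_trans (ler_norm _) _; exact: C0_norm_ub.
move=> x; rewrite [X in X <= _](_ : _ = g.1 x); last by rewrite -[RHS]addr0.
rewrite [X in _ /\ X <= _](_ : _ = g.2 x); last by rewrite -[RHS]subr0.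
by rewrite !le_max !fl orbT.
Qed.

Let p_le g w r : lin_span G w -> (forall x, g.1 x + w x <= r /\ g.2 x - w x <= r) ->
  p g <= r.
Proof. by move=> Gw h; apply: inf_lbound => //; exists w. Qed.

Let p_sublinear : sublinear p.
Proof.
have scale_le (t : R) g : 0 < t -> p (t *: g) <= t * p g.
  move=> t0; rewrite -ler_pdivrMl//; apply: lb_le_inf => // r [w Gw h].
  rewrite ler_pdivrMl//; apply: (@p_le _ (t *: w)).
    by rewrite -[_ *: _]addr0; apply: lin_spanZD => //; exact: lin_span0.
  move=> x; have [h1 h2] := h x.
  rewrite [X in X <= _](_ : _ = t * (g.1 x + w x)); last by rewrite mulrDr.
  rewrite [X in _ /\ X <= _](_ : _ = t * (g.2 x - w x)); last by rewrite mulrBr.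
  by rewrite !ler_pM2l.
split=> [g g'|t g].
  rewrite -lerBlDr; apply: lb_le_inf => // r [w Gw h].
  rewrite lerBlDr -lerBlDl; apply: lb_le_inf => // r' [w' Gw' h'].
  rewrite lerBlDl; apply: (@p_le _ (w + w')).
    by rewrite -[w]scale1r; exact: lin_spanZD.
  move=> x; have [h1 h2] := h x; have [h1' h2'] := h' x.
  rewrite [X in X <= _](_ : _ = (g.1 x + w x) + (g'.1 x + w' x)); last by rewrite addrACA.
  rewrite [X in _ /\ X <= _](_ : _ = (g.2 x - w x) + (g'.2 x - w' x)); last first.
    by rewrite [RHS]addrACA -opprD.
  by rewrite !lerD.
rewrite le_eqVlt => /orP[/eqP <-|t0].
  rewrite scale0r mul0r; apply/eqP; rewrite eq_le; apply/andP; split.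
    by apply: (@p_le _ 0); [exact: lin_span0|move=> x; rewrite addr0 subr0].
  apply: lb_le_inf => // r [w _ /(_ point)[h1 h2]].
  have {}h1 : w point <= r by apply: le_trans h1; rewrite [leRHS]add0r.
  have {}h2 : - w point <= r by apply: le_trans h2; rewrite [leRHS]add0r.
  by lra.
apply/eqP; rewrite eq_le scale_le//=.
have := @scale_le t^-1 (t *: g).
rewrite scalerA mulVf ?gt_eqF// scale1r invr_gt0 => /(_ t0).
by rewrite ler_pdivlMl.
Qed.

(** The Hahn-Banach theorem is applied on pairs of functions, at [(h, - h)], where
    [p] is the distance from [h] to the span. It thus directly produces two
    positive functionals, hence two measures; their difference kills [G], and its
    integral of [h] is that distance. *)
Lemma annihilator_closure (h : C0 R Z) :
  (forall nu : smeasure R Z, (forall f : C0 R Z, G f -> pairing f nu = 0) ->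
     pairing h nu = 0) -> closure (lin_span G) h.
Proof.
move=> hG; have [L [Llin Lp Lh]] := hahn_banach (h, - h) p_sublinear.
pose L1 (f : C0 R Z) := L (f, 0); pose L2 (f : C0 R Z) := L (0, f).
have L0 : L 0 = 0 by have := Llin 1 0 0; rewrite scaler0 addr0 mul1r => e; lra.
have LN (u : (C0 R Z * C0 R Z)%type) : L (- u) = - L u.
  by rewrite -[- u]addr0 -scaleN1r Llin L0 mulN1r addr0.
have pairE (f g : C0 R Z) : (f, g) = 1 *: (f, 0) + (0, g).
  by rewrite scale1r; congr pair; rewrite /= ?addr0 ?add0r.
have LE (f g : C0 R Z) : L (f, g) = L1 f + L2 g by rewrite pairE Llin mul1r.
have L1lin (k : R) (f g : C0 R Z) : L1 (k *: f + g) = k * L1 f + L1 g.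
  by rewrite /L1 -Llin; congr L; congr pair; rewrite /= scaler0 addr0.
have L2lin (k : R) (f g : C0 R Z) : L2 (k *: f + g) = k * L2 f + L2 g.
  by rewrite /L2 -Llin; congr L; congr pair; rewrite /= scaler0 addr0.
have neg (f g : C0 R Z) : (forall x, 0 <= f x) -> (forall x, 0 <= g x) -> 0 <= L (f, g).
  move=> f0 g0; rewrite -oppr_le0 -LN; apply: le_trans (Lp _) _.
  apply: (@p_le _ 0); first exact: lin_span0.
  move=> x; rewrite [X in X <= _](_ : _ = - f x); last by rewrite -[RHS]addr0.
  rewrite [X in _ /\ X <= _](_ : _ = - g x); last by rewrite -[RHS]subr0.
  by rewrite !oppr_le0.
have L1pos (f : C0 R Z) : (forall x, 0 <= f x) -> 0 <= L1 f by move=> f0; apply: neg.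
have L2pos (f : C0 R Z) : (forall x, 0 <= f x) -> 0 <= L2 f by move=> f0; apply: neg.
have [n1 [_ n1L]] := riesz_representation cZ exh L1lin L1pos.
have [n2 [_ n2L]] := riesz_representation cZ exh L2lin L2pos.
have L2N (g : C0 R Z) : L2 (- g) = - L2 g.
  by rewrite /L2 -LN; congr L; congr pair; rewrite oppr0.
have nuE (f : C0 R Z) : pairing f (n1 - n2) = L (f, - f).
  by rewrite pairingBr ?n1L ?n2L ?LE ?L2N//; exact: bounded_borel_C0.
have Lw (w : C0 R Z) : lin_span G w -> L (w, - w) <= 0.
  move=> Gw; apply: le_trans (Lp _) _; apply: (@p_le _ (- w)).
    by rewrite -[- w]addr0 -scaleN1r; apply: lin_spanZD => //; exact: lin_span0.
  move=> x; rewrite [X in X <= _](_ : _ = w x - w x)// subrr.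
  by rewrite [X in _ /\ X <= _](_ : _ = - w x - - w x)// subrr.
have ph : p (h, - h) = 0.
  rewrite -Lh -nuE; apply: hG => g Gg; rewrite nuE.
  have Gs : lin_span G g by exact: lin_span_sub.
  have GNs : lin_span G (- g).
    by rewrite -[- g]addr0 -scaleN1r; apply: lin_spanZD => //; exact: lin_span0.
  apply/eqP; rewrite eq_le; apply/andP; split; first exact: Lw.
  by rewrite -oppr_le0 -LN; exact: Lw GNs.
move=> B; rewrite -nbhs_ballE => -[e /= e0 eB].
have hi : has_inf (cost (h, - h)) by split.
have [r [w Gw hw] re] := inf_adherent e0 hi.
exists (- w); split.
  by rewrite -[- w]addr0 -scaleN1r; apply: lin_spanZD => //; exact: lin_span0.
apply: eB; rewrite -ball_normE /ball_ /= opprK.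
move: re; rewrite -/(p _) ph add0r; apply: le_lt_trans.
apply: C0_norm_le => [|x]; last first.
  have [h1 h2] := hw x; rewrite ler_norml lerNl; apply/andP; split=> //.
  by move: h2; rewrite /= -opprD.
have [/= h1 h2] := hw point.
have {}h2 : - h point - w point <= r by [].
by move: h1 h2; lra.
Qed.

End annihilators.

(** * Subspaces and compact spaces *)

Section set_types.
Context (T : topologicalType) (A : set T).

Definition set_in (x : T) (Ax : A x) : set_type A := SigSub (mem_set Ax).

Lemma set_val_in x (Ax : A x) : set_val (set_in Ax) = x.
Proof. by rewrite set_valE. Qed.

Lemma set_val_prop (u : set_type A) : A (set_val u).
Proof. by rewrite set_valE; exact: set_mem (valP u). Qed.

Lemma set_val_eq (u v : set_type A) : set_val u = set_val v -> u = v.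
Proof. by rewrite set_valE => /val_inj. Qed.

Lemma set_val_continuous : continuous (set_val : set_type A -> T).
Proof. exact: initial_continuous. Qed.

End set_types.

Lemma hausdorff_injective (Y Z : topologicalType) (f : Y -> Z) :
  hausdorff_space Z -> continuous f -> injective f -> hausdorff_space Y.
Proof.
move=> hZ cf fI x y xy; apply/fI/hZ => A B /cf nA /cf nB.
by have [z [Az Bz]] := xy _ _ nA nB; exists (f z).
Qed.

Lemma compact_homeomorphism (Y Z : topologicalType) (h : Y -> Z) (g : Z -> Y) :
  compact [set: Y] -> hausdorff_space Z -> continuous h ->
  cancel h g -> cancel g h -> homeomorphism h.
Proof.
move=> cY hZ ch hg gh; split=> //; exists g; split=> //.
apply/continuous_closedP => C clC; rewrite (_ : _ @^-1` _ = h @` C).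
  apply: compact_closed => //; apply: continuous_compact.
    exact: continuous_subspaceT.
  exact: subclosed_compact clC cY _.
by apply/seteqP; split=> [z Cz|_ [y Cy <-]] /=; [exists (g z)|rewrite hg].
Qed.

Lemma linear_ex (R : realType) (U V : lmodType R) (f : U -> V) : linear f ->
  exists F : {linear U -> V}, forall u, F u = f u.
Proof.
move=> flin; pose mixin := GRing.isLinear.Build R U V *:%R f flin.
pose F : {linear U -> V} := HB.pack f mixin.
by exists F.
Qed.

(** * Weak* closed subspaces *)

Section weak_star_closure.
Context (R : realType) (Z : ptopologicalType).
Implicit Types (f g : C0 R Z) (nu : smeasure R Z) (V : set (smeasure R Z)).

(** By induction on the list. A function that kills [V] also kills [nu]; any other
    one takes the value 1 at some [v0] in [V], and subtracting a multiple of [v0]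
    from [nu] reduces to the hyperplane of [V] where the function vanishes. *)
Lemma match_pairings (s : seq (C0 R Z)) V nu : V 0 ->
  (forall k u v, V u -> V v -> V (k *: u + v)) ->
  (forall f, (forall v, V v -> pairing f v = 0) -> pairing f nu = 0) ->
  exists2 v, V v & forall f, f \in s -> pairing f v = pairing f nu.
Proof.
have ZDr k (m n : smeasure R Z) f :
    pairing f (k *: m + n) = k * pairing f m + pairing f n.
  have bf := bounded_borel_C0 f; by rewrite (pairingDr _ _ bf) (pairingZr _ _ bf).
have ZDl k f g (m : smeasure R Z) :
    pairing (k *: f + g) m = k * pairing f m + pairing g m.
  exact: (pairingZDl _ _ (bounded_borel_C0 f) (bounded_borel_C0 g)).
elim: s V nu => [|f s IH] V nu V0 VZD ann; first by exists 0.
have [fV|] := pselect (forall v, V v -> pairing f v = 0).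
  have [v Vv vs] := IH V nu V0 VZD ann; exists v => // g.
  by rewrite inE => /orP[/eqP ->|/vs//]; rewrite fV// ann.
move=> /existsNP[w /not_implyP[Vw /eqP fw]].
pose v0 := (pairing f w)^-1 *: w.
have Vv0 : V v0 by rewrite /v0 -[_ *: _]addr0; exact: VZD.
have fv0 : pairing f v0 = 1.
  by rewrite /v0 (pairingZr _ _ (bounded_borel_C0 f)) mulVf.
pose V' := [set v | V v /\ pairing f v = 0].
pose nu' := - pairing f nu *: v0 + nu.
have [|k u v [Vu fu] [Vv fv]|g gV'|v' [Vv' fv'] v's] := IH V' nu'.
- by split => //; rewrite pairing0r//; exact: bounded_borel_C0.
- by split; [exact: VZD|rewrite ZDr fu fv mulr0 addr0].
- have : pairing (- pairing g v0 *: f + g) nu = 0.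
    apply: ann => v Vv.
    have := gV' (- pairing f v *: v0 + v).
    rewrite ZDr ZDl => h.
    have : V' (- pairing f v *: v0 + v).
      by split; [exact: VZD|rewrite ZDr fv0 mulr1 addNr].
    by move=> /h; lra.
  by rewrite /nu' ZDr ZDl; lra.
exists (pairing f nu *: v0 + v'); first exact: VZD.
move=> g; rewrite inE => /orP[/eqP ->|gs].
  by rewrite ZDr fv0 fv' mulr1 addr0.
by rewrite ZDr v's// /nu' ZDr; lra.
Qed.

(** The measures in [V] that match [nu] on finite sets of functions form a filter
    that converges to [nu]. *)
Lemma weakstar_closure V nu : V 0 ->
  (forall k u v, V u -> V v -> V (k *: u + v)) ->
  (forall f, (forall v, V v -> pairing f v = 0) -> pairing f nu = 0) ->
  closure V nu.
Proof.
move=> V0 VZD ann.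
pose N (s : seq (C0 R Z)) := [set v | V v /\
  forall f, f \in s -> pairing f v = pairing f nu].
have PF : ProperFilter (filter_from setT N).
  apply: filter_from_proper; last first.
    move=> s _; have [v Vv vs] := match_pairings s V0 VZD ann.
    by exists v.
  apply: filter_from_filter; first by exists [::].
  move=> s t _ _; exists (s ++ t) => // v [Vv h].
  by split; split=> // f fs; apply: h; rewrite mem_cat fs ?orbT.
have cv : filter_from setT N --> nu.
  apply/weakstar_cvgP => f B nB; exists [:: f] => // v [_ h] /=.
  by rewrite h ?inE//; exact: nbhs_singleton.
move=> B nB; have [s _ sB] := cv _ nB; have [v Vv vs] := match_pairings s V0 VZD ann.
by exists v; split=> //; apply: sB.
Qed.

Lemma pairing_M1_norm nu f : M1 nu -> `|pairing f nu| <= `|f|.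
Proof.
move=> M1nu; have bf := bounded_borel_C0 f.
have fl x : f x <= `|f| by apply: le_trans (ler_norm _) _; exact: C0_norm_ub.
have fg x : -1 * f x <= `|f|.
  by apply: le_trans (ler_norm _) _; rewrite mulN1r normrN; exact: C0_norm_ub.
rewrite ler_norml (pairing_M1_le M1nu bf fl) andbT lerNl -mulN1r.
rewrite -(pairingZl _ _ bf).
exact: (pairing_M1_le M1nu (bounded_borel_C0 (-1 *: f)) fg).
Qed.

End weak_star_closure.

(** * The mean ergodic projection *)

Section mean_ergodic.
Context (R : realType) (S : semigroupType) (X : pmetricType R).
Variable a : proper_action S X.
Hypothesis sepX : separable X.
Hypothesis lcX : locally_compact [set: X].
Hypothesis cpe : continuously_pointwise_ergodic a.
Hypothesis van : vanishes_at_infinity a.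
Local Notation Xhat := (one_point_compactification X).
Local Notation ahat := (act_hat a).
Local Notation Phi_oo := (Phi_infty a : Xhat -> smeasure R Xhat).

Let hXhat : hausdorff_space Xhat := hausdorff_hat lcX.
Let cXhat : compact [set: Xhat] := @compact_hat R X.
Let cahat := @act_hat_continuous _ _ _ a.
Let exh := @exhaustible_hat R X sepX lcX.
Let cPhi : continuous Phi_oo := Phi_infty_continuous lcX cpe van.
Let P := ergodic_mean lcX cpe van.

Lemma P_Fix (f : C0 R Xhat) : Fix R ahat f -> P f = f.
Proof.
move=> fF; apply: C0_ext => x; rewrite /P ergodic_meanE.
by apply: (pairing_Fix lcX cpe) => s y; exact: (congr1 (@^~ y) (fF s)).
Qed.

Lemma P_in_Fix (f : C0 R Xhat) : Fix R ahat (P f).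
Proof. by move=> s; apply/funext => x; exact: ergodic_mean_inv. Qed.

Lemma kills_Cob (nu : smeasure R Xhat) :
  (forall f : C0 R Xhat, Cob_gen ahat f -> pairing f nu = 0) -> Minv R ahat nu.
Proof.
move=> h; apply/(Minv_pairingP a lcX) => s f.
have e : (f - comp_act a s f : Xhat -> R) = fun x => -1 * comp_act a s f x + f x.
  by apply/funext => x; rewrite mulN1r addrC.
have cg : Cob_gen ahat (f - comp_act a s f) by exists f, s.
have := h _ cg.
rewrite e (pairingZDl _ _ (bounded_borel_C0 (comp_act a s f)) (bounded_borel_C0 f)); lra.
Qed.

Lemma P_linear : linear P.
Proof. by move=> k f g; exact: gelfand_op_linear. Qed.

Lemma P_norm (f : C0 R Xhat) : `|P f| <= `|f|.
Proof.
apply: C0_norm_le; first exact: C0_norm_ge0.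
by move=> x; apply: pairing_M1_norm; exact: (Phi_M1 lcX cpe).
Qed.

Lemma P_Cob (f : C0 R Xhat) : Cob_gen ahat f -> P f = 0.
Proof.
move=> [g [s e]]; apply: C0_ext => x; rewrite /P ergodic_meanE.
have -> : (f : Xhat -> R) = fun y => -1 * comp_act a s g y + g y.
  by apply/funext => y; rewrite e /= mulN1r addrC.
rewrite pairingZDl; [|exact: bounded_borel_C0|exact: bounded_borel_C0].
have [_ inv] := Phi_infty_M1inv lcX cpe x.
by rewrite ((Minv_pairingP a lcX _).1 inv) mulN1r addNr.
Qed.

(** Measures that kill the coboundaries are invariant, and an invariant measure
    gives [f] and its mean the same integral; so it kills [f] if the mean of [f] is
    zero. *)
Lemma mean_ergodic (PL : {linear C0 R Xhat -> C0 R Xhat}) :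
  (forall f, PL f = P f) -> mean_ergodic_projection ahat PL.
Proof.
move=> PLE; split.
- by exists 1 => f; rewrite PLE mul1r P_norm.
- by move=> f /=; rewrite !PLE; apply: P_Fix; exact: P_in_Fix.
- apply/seteqP; split=> [_ [f _ <-]|f fF]; first by rewrite PLE; exact: P_in_Fix.
  by exists f => //; rewrite PLE P_Fix.
apply/seteqP; split=> f /=; rewrite PLE => Pf0.
  apply: (annihilator_closure cXhat exh) => nu /kills_Cob inv.
  rewrite -(pairing_P_Minv sepX lcX cpe van f inv) -/P Pf0.
  have := bounded_borel_cst Xhat (0 : R) => b0.
  by rewrite (_ : (0 : C0 R Xhat) = (fun=> 0) :> (Xhat -> R))// pairing_cst mul0r.
have Pspan g : lin_span (Cob_gen ahat) g -> P g = 0.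
  apply: (@lin_span_ind _ _ _ (fun g => P g = 0)).
  - have := P_linear 1 0 0; rewrite !scale1r addr0 => e.
    by apply: (@addrI _ (P 0)); rewrite addr0 -e.
  - by move=> k u v Pu Pv; rewrite P_linear Pu Pv scaler0 addr0.
  - exact: P_Cob.
apply/eqP; rewrite -normr_le0; apply/ler_addgt0Pr => e e0; rewrite add0r.
have nB : nbhs f (ball f e) by exact: nbhsx_ballx.
have [g [gs fg]] := Pf0 _ nB.
have -> : P f = P (f - g).
  have := P_linear (-1) g f; rewrite (Pspan _ gs) scaler0 add0r => <-.
  by rewrite scaleN1r addrC.
apply: le_trans (P_norm _) _; apply: ltW.
by move: fg; rewrite -ball_normE.
Qed.

End mean_ergodic.

(** * The quotient and the ergodic decomposition *)

Section quotient.
Context (R : realType) (S : semigroupType) (X : pmetricType R).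
Variable a : proper_action S X.
Hypothesis sepX : separable X.
Hypothesis lcX : locally_compact [set: X].
Hypothesis cpe : continuously_pointwise_ergodic a.
Hypothesis van : vanishes_at_infinity a.
Local Notation Xhat := (one_point_compactification X).
Local Notation ahat := (act_hat a).
Local Notation Phi_oo := (Phi_infty a : Xhat -> smeasure R Xhat).
Local Notation Q := (Xquot a).
Local Notation E := (Ehat a).
Local Notation pi_oo := (@pi_infty R S X a).

Let hXhat : hausdorff_space Xhat := hausdorff_hat lcX.
Let cXhat : compact [set: Xhat] := @compact_hat R X.
Let cahat := @act_hat_continuous _ _ _ a.
Let exh := @exhaustible_hat R X sepX lcX.
Let cPhi : continuous Phi_oo := Phi_infty_continuous lcX cpe van.
Let hM : hausdorff_space (smeasure R Xhat) := weakstar_hausdorff cXhat hXhat.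

Lemma pi_inftyP x y : pi_oo x = pi_oo y <-> Phi_oo x = Phi_oo y.
Proof.
split; first by move/eqquotP/asboolP.
by move=> e; apply/eqquotP/asboolP.
Qed.

Lemma Phi_repr_pi x : Phi_oo (repr (pi_oo x)) = Phi_oo x.
Proof. by apply/pi_inftyP; rewrite /pi_infty reprK. Qed.

Lemma pi_repr (q : Q) : pi_oo (repr q) = q.
Proof. by rewrite /pi_infty reprK. Qed.

Lemma pi_infty_continuous : continuous pi_oo.
Proof. exact: pi_continuous. Qed.

Lemma continuous_repr (T : topologicalType) (f : Xhat -> T) : continuous f ->
  (forall x y, Phi_oo x = Phi_oo y -> f x = f y) ->
  continuous (f \o repr : Q -> T).
Proof.
move=> cf fP; apply/(@quotient_continuous _ _ T) => x.
rewrite (_ : _ \o _ = f); first exact: cf.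
by apply/funext => y /=; apply: fP; exact: Phi_repr_pi.
Qed.

Lemma Phi_tilde_continuous : continuous (@Phi_tilde R S X a).
Proof. exact: (continuous_repr cPhi). Qed.

Lemma Phi_tilde_inj : injective (@Phi_tilde R S X a).
Proof. by move=> p q /pi_inftyP; rewrite !pi_repr. Qed.

Lemma Phi_tilde_pi x : Phi_tilde (pi_oo x) = Phi_oo x.
Proof. exact: Phi_repr_pi. Qed.

Lemma compact_quotient : compact [set: Q].
Proof.
rewrite (_ : [set: Q] = pi_oo @` setT).
  by apply: continuous_compact => //; apply: continuous_subspaceT; exact: pi_infty_continuous.
by apply/seteqP; split=> // q _; exists (repr q) => //; exact: pi_repr.
Qed.

(** The induced map into the space of measures is continuous and injective. *)
Lemma hausdorff_quotient : hausdorff_space Q.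
Proof. exact: (hausdorff_injective hM Phi_tilde_continuous Phi_tilde_inj). Qed.

Lemma Phi_E1 x : E1 R ahat (Phi_oo x).
Proof. by rewrite (ergodicE sepX lcX cpe); exists x. Qed.

Definition Phi_E (x : Xhat) : E := set_in (Phi_E1 x).

Lemma Phi_EE x : Ehat_val (Phi_E x) = Phi_oo x.
Proof. exact: set_val_in. Qed.

Lemma Ehat_val_continuous : continuous (@Ehat_val R S X a).
Proof. exact: set_val_continuous. Qed.

Lemma Phi_E_continuous : continuous Phi_E.
Proof.
apply: (@continuous_comp_initial _ _ _ set_val).
by rewrite (_ : _ \o _ = Phi_oo)//; apply/funext => x; exact: set_val_in.
Qed.

Lemma Ehat_val_inj : injective (@Ehat_val R S X a).
Proof. by move=> u v; exact: set_val_eq. Qed.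

Lemma Phi_E_surj (e : E) : exists x, Phi_E x = e.
Proof.
have [x _ xe] : range Phi_oo (Ehat_val e).
  by have := ergodicE sepX lcX cpe => <-; exact: set_val_prop.
by exists x; apply: Ehat_val_inj; rewrite Phi_EE.
Qed.

Lemma compact_Ehat : compact [set: E].
Proof.
rewrite (_ : [set: E] = Phi_E @` setT).
  by apply: continuous_compact => //; apply: continuous_subspaceT; exact: Phi_E_continuous.
by apply/seteqP; split=> // e _; have [x xe] := Phi_E_surj e; exists x.
Qed.

Lemma hausdorff_Ehat : hausdorff_space E.
Proof. exact: (hausdorff_injective hM Ehat_val_continuous Ehat_val_inj). Qed.

Definition quot_to_E (q : Q) : E := Phi_E (repr q).

Lemma quot_to_E_homeo : homeomorphism quot_to_E /\
  forall q, Ehat_val (quot_to_E q) = Phi_tilde q.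
Proof.
split; last by move=> q; exact: Phi_EE.
have /choice[g hg] := Phi_E_surj.
apply: (@compact_homeomorphism _ _ quot_to_E (fun e => pi_oo (g e))).
- exact: compact_quotient.
- exact: hausdorff_Ehat.
- apply: (continuous_repr Phi_E_continuous) => x y xy.
  by apply: Ehat_val_inj; rewrite !Phi_EE.
- move=> q /=; rewrite -[RHS]pi_repr; apply/pi_inftyP.
  by rewrite -Phi_EE hg /quot_to_E Phi_EE.
- move=> e; apply: Ehat_val_inj.
  by rewrite /quot_to_E Phi_EE Phi_repr_pi -Phi_EE hg.
Qed.

Lemma Phi_tilde_M1 (q : Q) : M1 (Phi_tilde q : smeasure R Xhat).
Proof. exact: (Phi_M1 lcX cpe). Qed.

Lemma Ehat_val_M1inv (e : E) : M1inv R ahat (Ehat_val e).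
Proof. by have [] := set_val_prop e. Qed.

Lemma Ehat_val_M1 (e : E) : M1 (Ehat_val e).
Proof. by have [] := Ehat_val_M1inv e. Qed.

(** [P_star] is the adjoint of the mean ergodic projection. *)
Definition P_star : smeasure R Xhat -> smeasure R Xhat :=
  gelfand cXhat cXhat exh cPhi (Phi_M1 lcX cpe).
Definition quot_int : smeasure R Q -> smeasure R Xhat :=
  gelfand compact_quotient cXhat exh Phi_tilde_continuous Phi_tilde_M1.
Definition resultant : smeasure R E -> smeasure R Xhat :=
  gelfand compact_Ehat cXhat exh Ehat_val_continuous Ehat_val_M1.

Let push_pi : smeasure R Xhat -> smeasure R Q := pushforwardM pi_oo.
Let push_E : smeasure R Xhat -> smeasure R E := pushforwardM Phi_E.

(** A change of variables along [F]. *)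
Lemma gelfand_pushforward (Y : ptopologicalType) (F : Xhat -> Y)
    (Psi : Y -> smeasure R Xhat) (nu m : smeasure R Xhat) :
  compact [set: Y] -> hausdorff_space Y -> continuous F -> continuous Psi ->
  (forall x, Psi (F x) = Phi_oo x) ->
  is_gelfand_integral Psi (pushforwardM F nu) m <->
  is_gelfand_integral Phi_oo nu m.
Proof.
move=> cY hY cF cPsi PsiF.
have e (f : C0 R Xhat) : pairing (fun y => pairing f (Psi y)) (pushforwardM F nu) =
    pairing (fun x => pairing f (Phi_oo x)) nu.
  have bfP : bounded_borel (fun y => pairing f (Psi y)) := bounded_borel_C0 (gelfand_op cY cPsi f).
  have <- : (fun y => pairing f (Psi y)) \o F = (fun x => pairing f (Phi_oo x)).
    by apply/funext => x /=; rewrite PsiF.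
  exact: (pairing_pushforward nu hY cF bfP).
by split=> h f; [exact: etrans (h f) (e f)|exact: etrans (h f) (esym (e f))].
Qed.

(** A function lifted from [Y] is invariant, so [Phi_oo x] integrates it to its
    value at [x]. *)
Lemma pushforward_gelfand (Y : ptopologicalType) (F : Xhat -> Y)
    (Psi : Y -> smeasure R Xhat) (la : smeasure R Y) (m : smeasure R Xhat) :
  compact [set: Y] -> hausdorff_space Y -> continuous F ->
  (forall x, Psi (F x) = Phi_oo x) -> (forall y, exists x, F x = y) ->
  (forall x y, Phi_oo x = Phi_oo y -> F x = F y) ->
  is_gelfand_integral Psi la m -> pushforwardM F m = la.
Proof.
move=> cY hY cF PsiF Fsurj FPhi mla.
apply: (pairing_inj cY hY) => g.
have cgF : continuous (g \o F : Xhat -> R).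
  by move=> x; apply: continuous_comp; [exact: cF|exact: C0_continuous].
rewrite (pairing_pushforward _ hY cF (bounded_borel_C0 g)).
apply: etrans (mla (C0_of cXhat cgF)) _; apply: eq_pairing => y.
have [x <-] := Fsurj y; rewrite PsiF (pairing_Fix lcX cpe)// => s z.
by congr (g _); apply: FPhi; exact: (Phi_infty_act lcX cpe).
Qed.

Lemma gelfand_inv (Y : ptopologicalType) (Psi : Y -> smeasure R Xhat)
    (la : smeasure R Y) (m : smeasure R Xhat) :
  (forall y, Minv R ahat (Psi y)) -> is_gelfand_integral Psi la m ->
  Minv R ahat m.
Proof.
move=> Pinv mla; apply/(Minv_pairingP a lcX) => s f.
apply: etrans (mla _) _; apply: etrans _ (esym (mla f)).
by apply: eq_pairing => y; exact: ((Minv_pairingP a lcX _).1 (Pinv y)).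
Qed.

Lemma gelfand_uniq (Y : ptopologicalType) (Psi : Y -> smeasure R Xhat)
    (la : smeasure R Y) (m m' : smeasure R Xhat) :
  is_gelfand_integral Psi la m -> is_gelfand_integral Psi la m' -> m = m'.
Proof. by move=> h h'; apply: (pairing_inj cXhat hXhat) => f; exact: etrans (h f) (esym (h' f)). Qed.

Lemma Minv_gelfand (mu : smeasure R Xhat) : Minv R ahat mu ->
  is_gelfand_integral Phi_oo mu mu.
Proof. by move=> inv f; exact/esym/(pairing_P_Minv sepX lcX cpe van f inv). Qed.

Lemma quot_int_pi (mu : smeasure R Xhat) : Minv R ahat mu ->
  quot_int (push_pi mu) = mu.
Proof.
move=> inv; apply: (gelfand_uniq (gelfandP _ _ _ _ _ _)).
apply/(gelfand_pushforward _ _ compact_quotient hausdorff_quotient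
  pi_infty_continuous Phi_tilde_continuous Phi_tilde_pi).
exact: Minv_gelfand.
Qed.

Lemma pi_quot_int (la : smeasure R Q) : push_pi (quot_int la) = la.
Proof.
apply: (pushforward_gelfand compact_quotient hausdorff_quotient
  pi_infty_continuous Phi_tilde_pi _ _ (gelfandP _ _ _ _ _ _)).
  by move=> q; exists (repr q); exact: pi_repr.
by move=> x y /pi_inftyP.
Qed.

Lemma quot_int_inv (la : smeasure R Q) : Minv R ahat (quot_int la).
Proof.
apply: (gelfand_inv _ (gelfandP _ _ _ _ _ _)) => q.
by have [] := Phi_infty_M1inv lcX cpe (repr q).
Qed.

Lemma push_pi_continuous : continuous push_pi.
Proof.
exact: (pushforwardM_continuous cXhat hausdorff_quotient pi_infty_continuous).
Qed.

Lemma push_pi_linear : linear push_pi.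
Proof. exact: (pushforwardM_linear hausdorff_quotient pi_infty_continuous). Qed.

Lemma quot_int_continuous : continuous quot_int.
Proof. exact: gelfand_continuous. Qed.

Lemma resultant_inv (la : smeasure R E) : M1 la -> M1inv R ahat (resultant la).
Proof.
move=> M1la; split; first exact: gelfand_M1.
apply: (gelfand_inv _ (gelfandP _ _ _ _ _ _)) => e.
by have [] := Ehat_val_M1inv e.
Qed.

Lemma push_E_gelfand (nu m : smeasure R Xhat) :
  is_gelfand_integral (@Ehat_val R S X a) (push_E nu) m <->
  is_gelfand_integral Phi_oo nu m.
Proof.
exact: (gelfand_pushforward _ _ compact_Ehat hausdorff_Ehat Phi_E_continuous
  Ehat_val_continuous Phi_EE).
Qed.

Lemma resultant_push_E (nu : smeasure R Xhat) : resultant (push_E nu) = P_star nu.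
Proof.
apply: (gelfand_uniq (gelfandP _ _ _ _ _ _)).
by apply/push_E_gelfand; exact: gelfandP.
Qed.

Lemma push_E_resultant (la : smeasure R E) : push_E (resultant la) = la.
Proof.
apply: (pushforward_gelfand compact_Ehat hausdorff_Ehat Phi_E_continuous
  Phi_EE Phi_E_surj _ (gelfandP _ _ _ _ _ _)) => x y xy.
by apply: Ehat_val_inj; rewrite !Phi_EE.
Qed.

Lemma P_star_inv (mu : smeasure R Xhat) : Minv R ahat mu -> P_star mu = mu.
Proof.
by move=> inv; apply: (gelfand_uniq (gelfandP _ _ _ _ _ _)); exact: Minv_gelfand.
Qed.

Lemma affine_homeo : exists h : set_type (M1inv R ahat) -> set_type (@M1 R Q),
  homeomorphism h /\
  forall (t : R) (x y z : set_type (M1inv R ahat)), 0 <= t -> t <= 1 ->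
    set_val z = t *: set_val x + (1 - t) *: set_val y ->
    set_val (h z) = t *: set_val (h x) + (1 - t) *: set_val (h y).
Proof.
have M1push (x : set_type (M1inv R ahat)) : M1 (push_pi (set_val x)).
  apply: (pushforwardM_M1 hausdorff_quotient pi_infty_continuous).
  by have [] := set_val_prop x.
have M1int (y : set_type (@M1 R Q)) : M1inv R ahat (quot_int (set_val y)).
  split; last exact: quot_int_inv.
  by apply: gelfand_M1 => //; exact: set_val_prop.
exists (fun x => set_in (M1push x)); split; last first.
  move=> t x y z _ _ e; rewrite !set_val_in e push_pi_linear.
  by rewrite -[(1 - t) *: set_val y]addr0 push_pi_linear (_ : push_pi 0 = 0) ?addr0//;
    have := push_pi_linear 1 0 0; rewrite !scale1r addr0 => e0;
    apply: (@addrI _ (push_pi 0)); rewrite addr0 -e0.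
split.
  apply: (@continuous_comp_initial _ _ _ set_val).
  rewrite (_ : _ \o _ = push_pi \o set_val); last first.
    by apply/funext => x; exact: set_val_in.
  by move=> x; apply: continuous_comp; [exact: set_val_continuous|exact: push_pi_continuous].
exists (fun y => set_in (M1int y)); split.
- apply: (@continuous_comp_initial _ _ _ set_val).
  rewrite (_ : _ \o _ = quot_int \o set_val); last first.
    by apply/funext => x; exact: set_val_in.
  by move=> x; apply: continuous_comp; [exact: set_val_continuous|exact: quot_int_continuous].
- move=> x; apply: set_val_eq; rewrite !set_val_in quot_int_pi//.
  by have [] := set_val_prop x.
- by move=> y; apply: set_val_eq; rewrite !set_val_in pi_quot_int.
Qed.

Lemma linear_homeo : exists h : set_type (Minv R ahat) -> smeasure R Q,
  homeomorphism h /\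
  forall (k : R) (x y z : set_type (Minv R ahat)),
    set_val z = k *: set_val x + set_val y -> h z = k *: h x + h y.
Proof.
exists (fun x => push_pi (set_val x)); split; last first.
  by move=> k x y z ->; exact: push_pi_linear.
split.
  by move=> x; apply: continuous_comp; [exact: set_val_continuous|exact: push_pi_continuous].
exists (fun y => set_in (quot_int_inv y)); split.
- apply: (@continuous_comp_initial _ _ _ set_val).
  rewrite (_ : _ \o _ = quot_int); first exact: quot_int_continuous.
  by apply/funext => x; exact: set_val_in.
- move=> x; apply: set_val_eq; rewrite set_val_in quot_int_pi//.
  exact: set_val_prop.
- by move=> y; rewrite set_val_in pi_quot_int.
Qed.

Let pull_continuous (f : C0 R Q) : continuous (f \o pi_oo : Xhat -> R).
Proof.
by move=> x; apply: continuous_comp; [exact: pi_infty_continuous|exact: C0_continuous].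
Qed.

Definition pull (f : C0 R Q) : C0 R Xhat := C0_of cXhat (@pull_continuous f).

Lemma pull_norm (f : C0 R Q) : `|pull f| = `|f|.
Proof.
apply/eqP; rewrite eq_le; apply/andP; split; apply: C0_norm_le.
- exact: C0_norm_ge0.
- by move=> x; exact: (C0_norm_ub f (pi_oo x)).
- exact: C0_norm_ge0.
- by move=> q; have := C0_norm_ub (pull f) (repr q); rewrite /= pi_repr.
Qed.

Lemma Fix_pull (g : C0 R Xhat) : Fix R ahat g -> exists f, pull f = g.
Proof.
move=> gF.
have gE x : g x = pairing g (Phi_oo x).
  by rewrite (pairing_Fix lcX cpe)// => s y; exact: (congr1 (@^~ y) (gF s)).
have cg : continuous (g \o repr : Q -> R).
  apply: (continuous_repr (@C0_continuous _ _ g)) => x y xy.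
  by rewrite !gE xy.
exists (C0_of compact_quotient cg); apply: C0_ext => x /=.
by rewrite !gE Phi_repr_pi.
Qed.

Lemma pull_Fix (f : C0 R Q) : Fix R ahat (pull f).
Proof.
move=> s; apply/funext => x /=; congr (f _); apply/pi_inftyP.
exact: (Phi_infty_act lcX cpe).
Qed.

Lemma pull_linear : linear pull.
Proof. by move=> k f g; apply: C0_ext. Qed.

(** These measures detect invariance of a function. *)
Lemma point_evaluation (x : Xhat) : exists nu : smeasure R Xhat,
  forall f : C0 R Xhat, pairing f nu = f x.
Proof.
have [||nu [_ h]] := @riesz_representation R Xhat cXhat exh (fun f => f x).
- by [].
- by move=> f; exact.
by exists nu.
Qed.

(** The annihilator of the coboundaries of measures consists of the invariant
    functions, which are the functions lifted from the quotient. *)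
Lemma push_pi_kernel : [set nu | push_pi nu = 0] = Cob_star_closure R ahat.
Proof.
have pair_pull (f : C0 R Q) nu : pairing (pull f) nu = pairing f (push_pi nu).
  exact/esym/(pairing_pushforward _ hausdorff_quotient pi_infty_continuous (bounded_borel_C0 f)).
apply/seteqP; split=> nu nu0.
  apply: weakstar_closure.
  - exact: lin_span0.
  - by move=> k u v; exact: lin_spanZD.
  move=> f fV; have fF : Fix R ahat f.
    move=> s; apply/funext => x.
    have [d dE] := point_evaluation x.
    have := fV (d - pushforwardM (ahat s) d); rewrite (pairingBr _ _ (bounded_borel_C0 f)).
    rewrite (pairing_pushforward _ hXhat (@cahat s) (bounded_borel_C0 f)) dE.
    rewrite (dE (comp_act a s f)) => h; apply/eqP; rewrite eq_sym -subr_eq0; apply/eqP.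
    by apply: h; apply: lin_span_sub; exists d, s.
  have [g <-] := Fix_pull fF; rewrite pair_pull nu0.
  by rewrite pairing0r//; exact: bounded_borel_C0.
have cl : closed [set nu | push_pi nu = 0].
  apply: (@preimage_closed _ _ push_pi [set 0]).
    by move=> m _; exact: push_pi_continuous.
  apply: accessible_closed_set1; apply: hausdorff_accessible.
  exact: (weakstar_hausdorff compact_quotient hausdorff_quotient).
rewrite ((closure_id _).1 cl); move: nu nu0; apply: closureS => nu.
apply: (@lin_span_ind _ _ _ (fun m => push_pi m = 0)).
- have := push_pi_linear 1 0 0; rewrite !scale1r addr0 => e0.
  by apply: (@addrI _ (push_pi 0)); rewrite addr0 -e0.
- by move=> k u v u0 v0; rewrite push_pi_linear u0 v0 scaler0 addr0.
move=> _ [m [s ->]]; apply: (pairing_inj compact_quotient hausdorff_quotient) => f.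
rewrite -pair_pull (pairingBr _ _ (bounded_borel_C0 (pull f))).
rewrite (pairing_pushforward _ hXhat (@cahat s) (bounded_borel_C0 (pull f))).
rewrite (_ : pull f \o ahat s = pull f); last exact: pull_Fix.
by rewrite subrr pairing0r//; exact: bounded_borel_C0.
Qed.

End quotient.

Theorem theorem6p5 (R : realType) (S : semigroupType) (X : pmetricType R)
    (a : proper_action S X)
    (sepX : separable X) (lcX : locally_compact [set: X])
    (cpe : continuously_pointwise_ergodic a)
    (van : vanishes_at_infinity a) :
  let Xhat := one_point_compactification X in
  let Q := Xquot a in
  let E := Ehat a in
  let ahat := act_hat a in
  let Phi_oo : Xhat -> smeasure R Xhat := Phi_infty a in
  let pi_oo : Xhat -> Q := @pi_infty R S X a in
  let pi_oo_push : smeasure R Xhat -> smeasure R Q := pushforwardM pi_oo in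
  [/\ exists h : Q -> E,
        homeomorphism h /\ forall q, Ehat_val (h q) = Phi_tilde q,
      bauer_simplex R ahat &
      exists h : set_type (M1inv R ahat) -> set_type (@M1 R Q),
        homeomorphism h /\
        forall (t : R) (x y z : set_type (M1inv R ahat)), 0 <= t -> t <= 1 ->
          set_val z = t *: set_val x + (1 - t) *: set_val y ->
          set_val (h z) = t *: set_val (h x) + (1 - t) *: set_val (h y)] /\
  (exists (PhiE : Xhat -> E)
          (P : {linear C0 R Xhat -> C0 R Xhat})
          (Pstar : smeasure R Xhat -> smeasure R Xhat)
          (r : smeasure R E -> smeasure R Xhat),
     let PhiE_push : smeasure R Xhat -> smeasure R E := pushforwardM PhiE in
     [/\ (forall x, Ehat_val (PhiE x) = Phi_oo x),
         mean_ergodic_projection ahat P,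
         (forall (f : C0 R Xhat) nu, pairing f (Pstar nu) = pairing (P f) nu) &
         (forall lambda, M1 lambda ->
            M1inv R ahat (r lambda) /\
            is_gelfand_integral (@Ehat_val R S X a) lambda (r lambda))] /\
     [/\ (forall nu, M1 nu ->
            is_gelfand_integral Phi_oo nu (Pstar nu) /\
            is_gelfand_integral (@Ehat_val R S X a) (PhiE_push nu) (Pstar nu)),
         (forall mu, M1inv R ahat mu ->
            M1 (PhiE_push mu) /\ r (PhiE_push mu) = mu),
         (forall lambda, M1 lambda -> PhiE_push (r lambda) = lambda) &
         (forall nu, M1 nu ->
            M1 (PhiE_push nu) /\ r (PhiE_push nu) = Pstar nu)]) /\
  [/\ exists pullback : {linear C0 R Q -> C0 R Xhat},
        [/\ (forall f : C0 R Q, pullback f = f \o pi_oo :> (Xhat -> R)),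
            (forall f, `|pullback f| = `|f|) &
            range pullback = Fix R ahat],
      linear pi_oo_push /\ continuous pi_oo_push /\ range pi_oo_push = setT,
      [set nu | pi_oo_push nu = 0] = Cob_star_closure R ahat &
      exists h : set_type (Minv R ahat) -> smeasure R Q,
        homeomorphism h /\
        forall (k : R) (x y z : set_type (Minv R ahat)),
          set_val z = k *: set_val x + set_val y ->
          h z = k *: h x + h y].
Proof.
have hE : hausdorff_space (Ehat a) by exact: hausdorff_Ehat.
have cE : continuous (Phi_E sepX lcX cpe) by exact: Phi_E_continuous.
split; last split.
- split.
  + by eexists; exact: (quot_to_E_homeo sepX lcX cpe van).
  + exact: bauer_M1inv.
  + exact: affine_homeo.
- have [P PE] := linear_ex (P_linear lcX cpe van).
  exists (Phi_E sepX lcX cpe), P, (P_star sepX lcX cpe van), (resultant sepX lcX cpe van).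
  have pushM1 nu : M1 nu -> M1 (pushforwardM (Phi_E sepX lcX cpe) nu).
    exact: pushforwardM_M1.
  split; split.
  + exact: Phi_EE.
  + exact: (mean_ergodic sepX PE).
  + by move=> f nu; rewrite PE; exact: gelfandP.
  + by move=> la M1la; split; [exact: resultant_inv|exact: gelfandP].
  + by move=> nu _; split; [|apply/push_E_gelfand => //]; exact: gelfandP.
  + move=> mu [M1mu inv]; split; first exact: pushM1.
    by rewrite resultant_push_E; exact: P_star_inv.
  + by move=> la _; exact: push_E_resultant.
  + by move=> nu M1nu; split; [exact: pushM1|exact: resultant_push_E].
- split.
  + have [T TE] := linear_ex (@pull_linear R S X a).
    exists T; split.
    * by move=> f; rewrite TE.
    * by move=> f; rewrite TE; exact: pull_norm.
    apply/seteqP; split=> [_ [f _ <-]|g /Fix_pull[//|//|f <-]].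
      by rewrite TE; exact: (pull_Fix lcX cpe).
    by exists f; rewrite ?TE.
  + split; first exact: push_pi_linear.
    split; first exact: push_pi_continuous.
    by apply/seteqP; split=> // la _; exists (quot_int sepX lcX cpe van la) => //;
      exact: pi_quot_int.
  + exact: push_pi_kernel.
  + exact: linear_homeo.
Qed.
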